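(* Let $0<\alpha<1$, let $\Omega\subset\mathbb R^d$ be open, bounded and connected with $\mathcal C^{2,\alpha}$ boundary. Let $\varphi:\mathbb R^d\to\mathbb R$ be $\kappa$-strongly convex for some $\kappa>0$ and $\mathcal C^{3,\alpha}$ on a neighborhood of $\overline\Omega$. Let $\mu$ be a probability measure on $\Omega$ with a density in $\mathcal C^{1,\alpha}(\overline\Omega)$ bounded below by some $\lambda>0$ on $\Omega$. Let $\nu=(\nabla\varphi)_\#\mu$, let $X_1,\dots,X_n$ be i.i.d. with law $\nu$, $\widehat\nu_n=\frac1n\sum_{i=1}^n\delta_{X_i}$, and let $\widehat\varphi_n$ be a convex function with $(\nabla\widehat\varphi_n)_\#\mu=\widehat\nu_n$. (a) If $d\le3$, then $$\liminf_{n\to\infty}\sqrt n\;\mathbb E\Big[\inf_{a\in\mathbb R}\|\widehat\varphi_n-\varphi-a\|_{L^1(\mu)}\Big]>0.$$ (b) If $d\ge4$, $\Omega$ is convex and $\varphi(x)=\frac12\|x\|^2$ (so $\nu=\mu$), then there is a constant $c>0$, independent of $n$ and of the sample, such that for every sample $X_1,\dots,X_n$, $$\inf_{a\in\mathbb R}\|\widehat\varphi_n-\varphi-a\|_{L^1(\mu)}\ge c\,n^{-2/d}.$$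
   Context: A function $f$ is $\kappa$-strongly convex if $f-\frac\kappa2\|\cdot\|^2$ is convex. $T_\#\mu$ denotes push-forward. *)

(* Defs.v *)
From HB Require Import structures.
From mathcomp Require Import all_boot all_order all_algebra.
From mathcomp Require Import all_classical all_reals all_analysis measurable_realfun.

Set Implicit Arguments.
Unset Strict Implicit.
Unset Printing Implicit Defensive.

Import Order.TTheory GRing.Theory Num.Theory.
Import numFieldNormedType.Exports.

Local Open Scope classical_set_scope.
Local Open Scope ring_scope.

(* 'rV[R]_d carries its Borel sigma-algebra. *)
Section borel_rV.
Context {R : realType} (d : nat).

Let borel_rV : set (set 'rV[R]_d) := <<s @open 'rV[R]_d >>.

Let borel_rV0 : borel_rV set0.
Proof. exact: sigma_algebra0. Qed.

Let borel_rVC A : borel_rV A -> borel_rV (~` A).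
Proof. exact: sigma_algebraC. Qed.

Let borel_rV_bigcup (F : (set 'rV[R]_d)^nat) :
  (forall i, borel_rV (F i)) -> borel_rV (\bigcup_i F i).
Proof. exact: sigma_algebra_bigcup. Qed.

HB.instance Definition _ :=
  @isMeasurable.Build (sigma_display (@open 'rV[R]_d)) 'rV[R]_d borel_rV
    borel_rV0 borel_rVC borel_rV_bigcup.

End borel_rV.

Section rV_cons.
Context {R : realType} (d : nat).

Definition rV_cons (p : measurableTypeR R * 'rV[R]_d) : 'rV[R]_d.+1 :=
  row_mx (p.1 : R)%:M p.2.

Let rV_cons0 p : rV_cons p 0 0 = p.1.
Proof.
have -> : 0 = lshift d (0 : 'I_1) :> 'I_(1 + d) by apply/val_inj.
by rewrite [LHS]row_mxEl mxE eqxx mulr1n.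
Qed.

Let rV_consS p i : rV_cons p 0 (lift 0 i) = p.2 0 i.
Proof.
have -> : lift 0 i = rshift 1 i :> 'I_(1 + d) by apply/val_inj.
by rewrite [LHS]row_mxEr.
Qed.

Let rV_cons_ball (c : 'rV[R]_d.+1) (e : R) :
  rV_cons @^-1` ball c e =
  ball (c 0 0) e `*` ball (\row_i c 0 (lift 0 i)) e.
Proof.
apply/seteqP; split => [[a v] [e0 h]|[a v] /= [h1 [e0 h2]]].
  split; first by have := h 0 0; rewrite rV_cons0.
  split=> // i j; have := h 0 (lift 0 j).
  by rewrite rV_consS mxE (ord1 i).
split=> // i j; rewrite (ord1 i).
have [k ->|->] := unliftP 0 j; last by rewrite rV_cons0.
by rewrite rV_consS; have := h2 0 k; rewrite mxE.
Qed.

Let qball (q : 'rV[rat]_d.+1 * nat) : set 'rV[R]_d.+1 :=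
  ball (map_mx ratr q.1 : 'rV[R]_d.+1) q.2.+1%:R^-1.

Let open_bigcup_ratball (U : set 'rV[R]_d.+1) : open U ->
  U = \bigcup_q (if `[< qball q `<=` U >] then qball q else set0).
Proof.
move=> oU; apply/seteqP; split => [x Ux|x [q _]]; last first.
  by case: ifPn => // /asboolP qU; exact: qU.
have /nbhs_ballP[e /= e0 eU] : nbhs x U by exact: open_nbhs_nbhs.
have [k ke] : exists k, (k.+1%:R^-1 : R) < e / 2.
  have [k] := near_infty_natSinv_lt (PosNum (divr_gt0 e0 (ltr0Sn R 1))).
  by move=> _ /(_ k (leqnn k)); exists k.
have k0 : 0 < (k.+1%:R^-1 : R) by rewrite invr_gt0.
have /choice[q qx] i : exists r : rat, `|x 0 i - ratr r| < (k.+1%:R^-1 : R).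
  have [] := @rat_in_itvoo R (x 0 i - k.+1%:R^-1) (x 0 i + k.+1%:R^-1).
    by rewrite ltrBlDr -addrA ltrDl addr_gt0.
  move=> r; rewrite in_itv/= => /andP[r1 r2]; exists r.
  by rewrite distrC ltr_distl r1 r2.
exists (\row_i q i, k) => //=.
have qxb : qball (\row_i q i, k) x.
  split => // i j; rewrite (ord1 i) !mxE /ball/= distrC; exact: qx.
rewrite asboolT//; apply: subset_trans eU => y qy.
apply: (@le_ball _ _ x (k.+1%:R^-1 + k.+1%:R^-1)).
  by rewrite (splitr e) lerD// ltW.
by apply: ball_triangle qy; exact: ball_sym.
Qed.

Lemma measurable_rV_cons : measurable_fun setT rV_cons.
Proof.
apply: (@measurability _ _ _ _ setT rV_cons (@open 'rV[R]_d.+1)) => //.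
move=> _ [U oU <-]; rewrite setTI (open_bigcup_ratball oU) preimage_bigcup.
apply: countable_bigcupT_measurable; first exact: countableP.
move=> q; case: ifPn => _; last by rewrite preimage_set0.
rewrite rV_cons_ball; apply: measurableX.
  by apply: open_measurable; exact: ball_open.
by apply: sub_sigma_algebra; exact: ball_open.
Qed.

End rV_cons.

Section rV_tail.
Context {R : realType} (d : nat).

Definition rV_tail (v : 'rV[R]_d.+1) : 'rV[R]_d := \row_i v 0 (lift 0 i).

Lemma rV_cons_preimage (A : set R) (B : set 'rV[R]_d) :
  @rV_cons R d @^-1` [set v : 'rV[R]_d.+1 | A (v 0 0) /\ B (rV_tail v)] = A `*` B.
Proof.
have h0 p : @rV_cons R d p 0 0 = p.1.
  have -> : 0 = lshift d (0 : 'I_1) :> 'I_(1 + d) by apply/val_inj.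
  by rewrite [LHS]row_mxEl mxE eqxx mulr1n.
have ht p : rV_tail (@rV_cons R d p) = p.2.
  apply/rowP => i; rewrite mxE.
  have -> : lift 0 i = rshift 1 i :> 'I_(1 + d) by apply/val_inj.
  by rewrite [LHS]row_mxEr.
by apply/seteqP; split => p /=; rewrite h0 ht.
Qed.

Lemma measurable_rV_tail : measurable_fun setT rV_tail.
Proof.
apply: (@measurability _ _ _ _ setT rV_tail (@open 'rV[R]_d)) => //.
move=> _ [U oU <-]; rewrite setTI.
apply: sub_sigma_algebra; move: U oU; apply/continuousP => x.
move=> A /nbhs_ballP[e /= e0 eA]; apply/nbhs_ballP; exists e => //= y [_ xy].
by apply: eA; split => // i j; rewrite (ord1 i) !mxE; exact: xy.
Qed.

End rV_tail.

Section lebesgue_rV_cons.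
Local Open Scope ereal_scope.
Context {R : realType} (d : nat).
Variable m : {sigma_finite_measure set 'rV[R]_d -> \bar R}.

Definition lebesgue_rV_cons : set 'rV[R]_d.+1 -> \bar R :=
  pushforward (@lebesgue_measure R \x m) (@rV_cons R d).

HB.instance Definition _ := Measure.copy lebesgue_rV_cons
  (measure_function_pushforward__canonical__measure_function_Measure
     (@lebesgue_measure R \x m) (@measurable_rV_cons R d)).

Let lebesgue_rV_cons_sigma_finite : sigma_finite setT lebesgue_rV_cons.
Proof.
have /sigma_finiteP[F [TF ndF Foo]] := sigma_finiteT m.
exists (fun n => [set v : 'rV[R]_d.+1 |
    ball (0 : R)%R n%:R%R (v 0%R 0%R) /\ F n (rV_tail v)]).
  apply/esym; rewrite -subTset => v _.
  have [k _ Fk] : (\bigcup_i F i) (rV_tail v) by rewrite -TF.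
  have [l vl] : exists l, (`|v 0%R 0%R| < l%:R)%R.
    by exists (Num.truncn `|v 0%R 0%R|).+1; exact: truncnS_gt.
  exists (maxn k l) => //; split.
    rewrite /ball/= sub0r normrN (lt_le_trans vl)// ler_nat.
    exact: leq_maxr.
  by move: (rV_tail v) Fk; exact/subsetPset/ndF/leq_maxl.
move=> n; have [mF Fn] := Foo n.
split.
  apply: measurableI.
    apply: sub_sigma_algebra.
    have /continuousP := @coord_continuous R 1 d.+1 0%R 0%R.
    by apply; exact: ball_open.
  by rewrite -[X in measurable X]setTI; exact: measurable_rV_tail.
rewrite /lebesgue_rV_cons /pushforward rV_cons_preimage product_measure1E//; last first.
  by apply: open_measurable; exact: ball_open.
by rewrite [X in X * _]lebesgue_measure_ball// lte_mul_pinfty//.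
Qed.

HB.instance Definition _ := Measure_isSigmaFinite.Build _ _ _ lebesgue_rV_cons
  lebesgue_rV_cons_sigma_finite.

End lebesgue_rV_cons.

(* Iterated product of the one-dimensional Lebesgue measure; lebesgue_rV_box
   gives its value on boxes. *)
Fixpoint lebesgue_rV (R : realType) (d : nat) :
    {sigma_finite_measure set 'rV[R]_d -> \bar R} :=
  match d return {sigma_finite_measure set 'rV[R]_d -> \bar R} with
  | 0 => @dirac _ 'rV[R]_0 0 R
  | d'.+1 => lebesgue_rV_cons (lebesgue_rV R d')
  end.

Lemma measurable_rV_coord (R : realType) (d : nat) (i : 'I_d) :
  measurable_fun setT (fun v : 'rV[R]_d => v 0 i : R).
Proof.
apply: (measurability _ (RGenOpens.measurableE R)) => //.
move=> _ [_ [a [b ->]] <-]; rewrite setTI.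
apply: sub_sigma_algebra.
have /continuousP := @coord_continuous R 1 d 0 i.
by apply; exact: interval_open.
Qed.

Lemma lebesgue_rV_box (R : realType) (d : nat) (A : 'I_d -> set R) :
  (forall i, measurable (A i)) ->
  lebesgue_rV R d [set v : 'rV[R]_d | forall i, A i (v 0 i)] =
  (\prod_(i < d) lebesgue_measure (A i))%E.
Proof.
elim: d A => [|d IHd] A mA.
  by rewrite big_ord0/= diracE mem_set// => -[].
rewrite big_ord_recl -IHd//=.
have -> : [set v : 'rV[R]_d.+1 | forall i, A i (v 0 i)] =
    [set v : 'rV[R]_d.+1 | A 0 (v 0 0) /\
      [set w : 'rV[R]_d | forall i, A (lift 0 i) (w 0 i)] (rV_tail v)].
  apply/seteqP; split => v /=.
    by move=> Av; split => // i; rewrite mxE.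
  move=> [A0 AS] i; have [j ->|->//] := unliftP 0 i.
  by have := AS j; rewrite mxE.
rewrite /lebesgue_rV_cons /pushforward rV_cons_preimage product_measure1E//.
  exact: mA.
rewrite (_ : [set w : 'rV[R]_d | _] =
    \bigcap_(i in [set: 'I_d]) [set w : 'rV[R]_d | A (lift 0 i) (w 0 i)]); last first.
  by apply/seteqP; split => w /= Aw i => [_|]; exact: Aw.
apply: fin_bigcap_measurable => // i _.
rewrite -[X in measurable X]setTI.
by apply: measurable_rV_coord => //; exact: mA.
Qed.

Section smoothness.
Context {R : realType}.

Definition partials d (s : seq 'I_d) (f : 'rV[R]_d -> R) : 'rV[R]_d -> R :=
  foldr (fun i g => 'D_('e_i) g) f s.

(* For bounded open U this is C^{k, alpha} of the closure of U: partial
   derivatives up to order k extend continuously to the closure, those of order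
   k are alpha-Hoelder on U. The library norm on 'rV is the sup norm, which only
   affects the constant C. *)
Definition holder_class d (k : nat) (alpha : R) (U : set 'rV[R]_d)
    (f : 'rV[R]_d -> R) :=
  [/\ forall s : seq 'I_d, (size s < k)%N ->
        forall i x, U x -> derivable (partials s f) x 'e_i,
      forall s : seq 'I_d, (size s <= k)%N ->
        exists2 g : 'rV[R]_d -> R,
          {within closure U, continuous g} & {in U, partials s f =1 g} &
      forall s : seq 'I_d, size s = k ->
        exists C : R, forall x y, U x -> U y ->
          `|partials s f x - partials s f y| <= C * `|x - y| `^ alpha].

(* Near each boundary point, Omega lies on one side of the graph of a C^{k, alpha}
   function of d - 1 of the coordinates (col' i drops the i-th one). *)
Definition holder_boundary d (k : nat) (alpha : R) (Omega : set 'rV[R]_d) :=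
  forall x0, (closure Omega `\` Omega°) x0 ->
  exists (i : 'I_d) (b : bool) (r : R) (g : 'rV[R]_d.-1 -> R),
    [/\ 0 < r, holder_class k alpha (ball (col' i x0) r) g &
        forall x, ball x0 r x -> Omega x <-> g (col' i x) < (-1) ^+ b * x 0 i].

Definition sqnorm d (x : 'rV[R]_d) : R := \sum_(i < d) x 0 i ^+ 2.

Definition strongly_convex d (kappa : R) (f : 'rV[R]_d -> R) :=
  convex_function setT (fun x => f x - kappa / 2 * sqnorm x).

(* Where a partial derivative does not exist, 'D_ returns a junk constant. For a
   convex function on R^d this happens only on a Lebesgue-null set, and the
   function below is Borel measurable. *)
Definition gradient d (f : 'rV[R]_d -> R) (x : 'rV[R]_d) : 'rV[R]_d :=
  \row_i 'D_('e_i) f x.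

End smoothness.

Section transport.
Context {R : realType} (d : nat).
Local Open Scope ereal_scope.

(* The measures are compared on Borel sets only: the value of a measure on
   nonmeasurable sets is unspecified. *)
Definition gradient_pushes (mu : probability 'rV[R]_d R) (f : 'rV[R]_d -> R)
    (nu : set 'rV[R]_d -> \bar R) :=
  forall A, measurable A -> pushforward mu (gradient f) A = nu A.

Definition has_density_on (mu : probability 'rV[R]_d R) (Omega : set 'rV[R]_d)
    (rho : 'rV[R]_d -> R) :=
  forall A, measurable A ->
    mu A = \int[lebesgue_rV R d]_(x in A `&` Omega) (rho x)%:E.

Definition empirical n (x : 'I_n -> 'rV[R]_d) : set 'rV[R]_d -> \bar R :=
  fun A => (n%:R^-1)%:E * \sum_(i < n) \d_(x i) A.

Definition L1_dist_mod_cst (mu : probability 'rV[R]_d R)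
    (f g : 'rV[R]_d -> R) : \bar R :=
  ereal_inf [set 'N[mu]_1[EFin \o (f \- g \- cst a)%R] | a in [set: R]].

Definition mutually_independent d1 (T : measurableType d1)
    (P : probability T R) (X : nat -> {RV P >-> 'rV[R]_d}) :=
  forall (J : seq nat) (A : nat -> set 'rV[R]_d), uniq J ->
    (forall i, measurable (A i)) ->
    P (\bigcap_(i in [set` J]) X i @^-1` A i) = \prod_(i <- J) P (X i @^-1` A i).

Definition iid d1 (T : measurableType d1) (P : probability T R)
    (X : nat -> {RV P >-> 'rV[R]_d}) (nu : probability 'rV[R]_d R) :=
  mutually_independent X /\
  forall i A, measurable A -> distribution P (X i) A = nu A.

End transport.

(* Main.v *)
Require Import Defs.
From mathcomp Require Import all_boot all_order all_algebra.
From mathcomp Require Import all_classical all_reals all_analysis measurable_realfun.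
From mathcomp Require Import ring lra.
Import Order.TTheory GRing.Theory Num.Theory.
Import numFieldNormedType.Exports.
Set Implicit Arguments.
Unset Strict Implicit.
Unset Printing Implicit Defensive.
Local Open Scope classical_set_scope.
Local Open Scope ring_scope.

(* Let h y = max(0, r^2 - |y - grad phi x0|^2)^2 with x0 in Omega, and u = phihat - phi - a. The
   one-sided Taylor bound of h bounds h (grad phi) - h (grad phihat) by a term linear in grad u
   plus a multiple of cap (grad u), where cap t = min(|t|, t^2). Near x0 the function u is
   semiconvex along the axes. Hence a discrete integration by parts bounds the integral of the
   linear term by that of |u|, and so does, for cap (grad u), a comparison of u with its
   translates on the dyadic level sets of its partial derivatives. It follows that
     \int h d(nu) - \int h d(nuhat) <= C \int |u| d(mu).
   For (a), the left-hand side is a centered mean of n i.i.d. bounded variables of positive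
   variance, whose positive part has expectation of order at least n^(-1/2) by comparing second
   and fourth moments. For (b), grad phihat takes almost surely at most n values, so that
   |grad phihat x - x| >= c n^(-1/d) on half of a ball, where the integral of cap (grad u) is
   then at least of order n^(-2/d). *)

(** All estimates hold for every convex f in place of phihat, with a constant not depending on f, so
    no bound on grad f is available. Convexity of f bounds u = f - phi - a from below only, with a
    loss [Lam * t ^+ 2] due to the smoothness of phi, and the proofs use this lower bound alone.
    With t proportional to the derivative p of u along an axis it gives p^2 <= C (|u x| + |u (x + t
    v)|). To integrate the right-hand side by translation invariance, t must be constant on pieces,
    whence the dyadic levels; t is also limited by the size of the ball, whence the linear growth of
    [cap]. The radius kappa * del of h is matched to strong convexity: grad phi expands distances by
    kappa at least, so h (grad phi) vanishes on Omega outside the ball of radius del around x0. The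
    weight of the linear term then vanishes off that ball, so no boundary term arises and all
    translations stay in a ball twice as large, inside Omega. Since the partial derivatives of f may
    fail to exist on a null set, where a default value is returned, right derivatives, which exist
    everywhere, are used instead and identified with them almost everywhere. *)

(** * Convex functions on row vectors: reduction to the axes and continuity *)

Section convex_rV.
Context {R : realType} {d : nat}.
Implicit Types (f : 'rV[R]_d -> R) (x v : 'rV[R]_d).

Lemma open_measurable_rV (U : set 'rV[R]_d) : open U -> measurable U.
Proof. by move=> oU; exact: sub_sigma_algebra. Qed.

Lemma continuous_measurable_rV f : continuous f -> measurable_fun setT f.
Proof.
move=> cf; apply: (measurability _ (RGenOpens.measurableE R)) => //.
move=> _ [_ [a [b ->]] <-]; rewrite setTI.
apply: open_measurable_rV; move/continuousP: cf; apply.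
exact: interval_open.
Qed.

Lemma norm_rV_leP v (c : R) : 0 <= c -> (forall i, `|v 0 i| <= c) -> `|v| <= c.
Proof.
move=> c0 vc; rewrite [`|v|]mx_normrE; apply/bigmax_leP; split => // -[i j] _ /=.
by rewrite (ord1 i).
Qed.

Lemma ler_norm_rV v (i : 'I_d) : `|v 0 i| <= `|v|.
Proof.
rewrite [`|v|]mx_normrE.
exact: (le_bigmax _ (fun k : 'I_1 * 'I_d => `|v k.1 k.2|) (0, i)).
Qed.

Lemma norm_delta_le (i : 'I_d) : `|'e_i : 'rV[R]_d| <= 1.
Proof.
apply: norm_rV_leP => // j; rewrite mxE.
by case: (_ && _); rewrite ?normr1 ?normr0.
Qed.

Lemma ball_rVE x e y : ball x e y = (`|x - y| < e) :> Prop.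
Proof. by rewrite mx_norm_ball. Qed.

Lemma convex_functionP f : convex_function setT f ->
  forall x y t, 0 <= t <= 1 -> f (t *: x + (1 - t) *: y) <= t * f x + (1 - t) * f y.
Proof.
move=> cf x y t t01.
by have := cf (Itv01 (proj1 (andP t01)) (proj2 (andP t01))) x y; rewrite !inE; apply.
Qed.

Lemma convex_ray f x v t : convex_function setT f -> 0 <= t <= 1 ->
  f (x + t *: v) <= f x + t * (f (x + v) - f x).
Proof.
move=> cf t01; have := convex_functionP cf (x + v) x t01.
rewrite (_ : t *: (x + v) + _ = x + t *: v); last first.
  by rewrite scalerDr scalerBl scale1r addrAC addrCA subrr addr0 addrC.
by move/le_trans; apply; lra.
Qed.

Lemma convex_mean f (n : nat) (y : 'I_n.+1 -> 'rV[R]_d) :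
  convex_function setT f ->
  f (n.+1%:R^-1 *: \sum_i y i) <= n.+1%:R^-1 * \sum_i f (y i).
Proof.
move=> cf; elim: n y => [|n IH] y.
  by rewrite !big_ord1 invr1 scale1r mul1r.
rewrite big_ord_recl [in leRHS]big_ord_recl.
have n0 : 0 < n.+2%:R :> R by rewrite ltr0n.
have m0 : 0 < n.+1%:R :> R by rewrite ltr0n.
have t01 : 0 <= (n.+2%:R^-1 : R) <= 1.
  by rewrite invr_ge0 ltW//= invf_le1// ler1n.
have e : 1 - n.+2%:R^-1 = n.+2%:R^-1 * n.+1%:R :> R.
  by rewrite -[n.+2%:R]natr1; field; lra.
have := convex_functionP cf (y ord0) (n.+1%:R^-1 *: \sum_(i < n.+1) y (lift ord0 i)) t01.
rewrite scalerA e mulfK ?gt_eqF// -scalerDr => /le_trans; apply.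
rewrite [leRHS]mulrDr lerD2l -mulrA ler_wpM2l ?invr_ge0 ?(ltW n0)//.
by rewrite -ler_pdivlMl// IH.
Qed.

Lemma row_sum_axes v : v = \sum_i v 0 i *: 'e_i.
Proof. exact: row_sum_delta. Qed.

(** x + v is the barycenter of the d points x + d v_i e_i. This reduces an arbitrary direction to
    the axes, along which alone semiconcavity of phi is assumed later. *)
Lemma convex_axes f x v : (0 < d)%N -> convex_function setT f ->
  f (x + v) <= d%:R^-1 * \sum_i f (x + (d%:R * v 0 i) *: 'e_i).
Proof.
move=> d0 cf.
have d1 : d%:R != 0 :> R by rewrite pnatr_eq0 -lt0n.
pose c := cast_ord (prednK d0); pose c' := cast_ord (esym (prednK d0)).
have c'b P : {on P, bijective c'}.
  by exists c => i _; rewrite /c /c' ?cast_ordK ?cast_ordKV.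
have := @convex_mean f d.-1 (fun i => x + (d%:R * v 0 (c i)) *: 'e_(c i)) cf.
rewrite (reindex c')//= [X in _ <= _ * X -> _](reindex c')//=.
rewrite (_ : d.-1.+1%:R = d%:R); last by rewrite prednK.
under eq_bigr do rewrite /c /c' cast_ordKV.
under [X in _ <= _ * X -> _]eq_bigr do rewrite /c /c' cast_ordKV.
rewrite big_split/= sumr_const card_ord -[x *+ d]scaler_nat scalerDr scalerA mulVf// scale1r.
under [X in d%:R^-1 *: X]eq_bigr do rewrite -scalerA.
by rewrite -scaler_sumr -row_sum_axes scalerA mulVf// scale1r.
Qed.

(** By [convex_axes], f (x + v) is controlled by values on the segments from x to x + e_i and x -
    e_i; the condition on v keeps d |v_i| in [0, 1]. *)
Lemma convex_lipschitz_at f x : (0 < d)%N -> convex_function setT f ->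
  exists C, 0 <= C /\ forall v, d%:R * `|v| <= 1 -> `|f (x + v) - f x| <= C * `|v|.
Proof.
move=> d0 cf.
have d1 : 0 < d%:R :> R by rewrite ltr0n.
pose C := \sum_i (`|f (x + 'e_i) - f x| + `|f (x - 'e_i) - f x|).
have C0 : 0 <= C by apply: sumr_ge0 => i _; rewrite addr_ge0.
exists (d%:R * C); split; first by rewrite mulr_ge0// ler0n.
have up v : d%:R * `|v| <= 1 -> f (x + v) - f x <= d%:R * C * `|v|.
  move=> v1; have := convex_axes x v d0 cf.
  rewrite lerBlDl => /le_trans; apply.
  have [vi0 vi1] : (forall i, 0 <= d%:R * `|v 0 i|) /\ (forall i, d%:R * `|v 0 i| <= 1).
    split => i; first by rewrite mulr_ge0// ler0n.
    by apply: le_trans v1; rewrite ler_pM2l// ler_norm_rV.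
  rewrite ler_pdivrMl//.
  rewrite (_ : d%:R * _ = \sum_(i < d) (f x + d%:R * C * `|v|)); last first.
    by rewrite sumr_const card_ord mulr_natl.
  apply: ler_sum => i _.
  have Ci : `|f (x + 'e_i) - f x| <= C /\ `|f (x - 'e_i) - f x| <= C.
    rewrite /C (bigD1 i)//=.
    have := @sumr_ge0 R _ (index_enum 'I_d) (fun j => j != i) (fun j => `|f (x + 'e_j) - f x| + `|f
      (x - 'e_j) - f x|) (fun j _ => addr_ge0 (normr_ge0 _) (normr_ge0 _)).
    have := normr_ge0 (f (x + 'e_i) - f x); have := normr_ge0 (f (x - 'e_i) - f x).
    by lra.
  have viv : d%:R * `|v 0 i| * C <= d%:R * C * `|v|.
    by rewrite mulrAC ler_wpM2l ?mulr_ge0 ?ler_norm_rV// ltW.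
  have [vi|vi] := ler0P (v 0 i); last first.
    have := @convex_ray f x 'e_i (d%:R * v 0 i) cf; rewrite -(gtr0_norm vi) vi0 vi1 => /(_ erefl).
    move/le_trans; apply; rewrite lerD2l.
    apply: le_trans viv; rewrite ler_wpM2l//; have := ler_norm (f (x + 'e_i) - f x); lra.
  have := @convex_ray f x (- 'e_i) (d%:R * - v 0 i) cf; rewrite -(ler0_norm vi) vi0 vi1 => /(_ erefl).
  rewrite (ler0_norm vi) mulrN scaleNr scalerN opprK -mulrN -(ler0_norm vi).
  move/le_trans; apply; rewrite lerD2l.
  apply: le_trans viv; rewrite ler_wpM2l//; have := ler_norm (f (x - 'e_i) - f x); lra.
(* The lower bound follows from the upper one at - v, x being the midpoint of x + v and x - v. *)
move=> v v1; rewrite ler_norml up// andbT lerNl.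
have := up (- v); rewrite normrN => /(_ v1); apply: le_trans.
have := @convex_functionP f cf (x + v) (x - v) (2^-1).
rewrite (_ : _ *: _ + _ = x); first by move=> /(_ _); rewrite (_ : 0 <= _ <= _) => [/(_ erefl)|]; lra.
rewrite (_ : 1 - 2^-1 = 2^-1 :> R); last by field.
rewrite -scalerDr addrACA subrr addr0 -mulr2n -[x *+ 2]scaler_nat scalerA mulVf ?scale1r//.
Qed.

Lemma lipschitz_at_continuous f x C r : 0 < r -> 0 <= C ->
  (forall v, `|v| <= r -> `|f (x + v) - f x| <= C * `|v|) -> {for x, continuous f}.
Proof.
move=> r0 C0 fC A /nbhs_ballP[e /= e0 eA]; apply/nbhs_ballP.
have C1 : 0 < C + 1 by lra.
exists (Num.min r (e / (C + 1))); first by rewrite /= lt_min r0 divr_gt0.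
move=> y; rewrite ball_rVE lt_min => /andP[yr ye]; apply: eA.
have := fC (y - x); rewrite (_ : x + (y - x) = y) ?[x + _]addrC ?subrK//.
rewrite [`|y - x|]distrC [`|f y - _|]distrC => /(_ (ltW yr)).
move/le_lt_trans; apply; rewrite ltr_pdivlMr// in ye.
by have := normr_ge0 (x - y); lra.
Qed.

Lemma convex_continuous f : (0 < d)%N -> convex_function setT f -> continuous f.
Proof.
move=> d0 cf x; have [C [C0 fC]] := convex_lipschitz_at x d0 cf.
have d1 : 0 < d%:R :> R by rewrite ltr0n.
apply: (@lipschitz_at_continuous f x C d%:R^-1) => //; first by rewrite invr_gt0.
by move=> v vd; apply: fC; rewrite -ler_pdivlMl// mulr1.
Qed.

Lemma measurable_shift (w : 'rV[R]_d) : measurable_fun setT (fun x : 'rV[R]_d => x + w).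
Proof.
apply: (@measurability _ _ _ _ setT (fun x : 'rV[R]_d => x + w) (@open 'rV[R]_d)) => //.
move=> _ [U oU <-]; rewrite setTI; apply: open_measurable_rV.
move: U oU; apply/continuousP => x A /nbhs_ballP[e /= e0 eU].
apply/nbhs_ballP; exists e => //= y; rewrite ball_rVE => xy; apply: eU.
by rewrite ball_rVE opprD addrACA subrr addr0.
Qed.

End convex_rV.

(** The sigma-algebra is generated by open sets, not by coordinates; measurability of [rV_cons]
    allows one coordinate to be split off at a time. *)
Lemma measurable_rV_fun (R : realType) d1 (T : measurableType d1) (d : nat) (F : T -> 'rV[R]_d) :
  (forall i, measurable_fun setT (fun x => F x 0 i)) -> measurable_fun setT F.
Proof.
elim: d F => [|d IH] F mF.
  by rewrite (_ : F = cst 0) //; apply/funext => x; apply/rowP => -[].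
have -> : F = rV_cons (d := d) \o (fun x => (F x 0 0, rV_tail (F x))).
  apply/funext => x /=; apply/rowP => i.
  have [j ->|->] := unliftP 0 i; last first.
    have -> : 0 = lshift d (0 : 'I_1) :> 'I_(1 + d) by apply/val_inj.
    rewrite [RHS]row_mxEl mxE eqxx mulr1n.
    by congr (F x 0 _); apply/val_inj.
  have -> : lift 0 j = rshift 1 j :> 'I_(1 + d) by apply/val_inj.
  rewrite [RHS]row_mxEr mxE; congr (F x 0 _); exact/val_inj.
apply: measurableT_comp; first exact: measurable_rV_cons.
apply/measurable_fun_pairP; split => /=; first exact: mF.
by apply: IH => i; under eq_fun do rewrite mxE; exact: mF.
Qed.

(** * One-sided derivatives of convex functions *)

Section right_derivative.
Context {R : realType} {d : nat}.
Implicit Types (f : 'rV[R]_d -> R) (x v : 'rV[R]_d).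

Definition slope f v x (t : R) : R := (f (x + t *: v) - f x) / t.

(** For convex f the slopes are nondecreasing in t, so this infimum is the right derivative; it
    exists at every point. *)
Definition dplus f v x : R := inf [set slope f v x t | t in [set t | 0 < t]].

Lemma slope_le f v x s t : convex_function setT f -> 0 < s -> s <= t ->
  slope f v x s <= slope f v x t.
Proof.
move=> cf s0 st; have t0 : 0 < t by exact: lt_le_trans st.
have := @convex_ray _ _ f x (t *: v) (s / t) cf.
rewrite scalerA divfK ?gt_eqF// ler_pdivrMr// mul1r st divr_ge0 ?(ltW s0) ?(ltW t0)// => /(_ erefl).
rewrite /slope => h; rewrite ler_pdivrMr//.
by rewrite [X in _ <= X](_ : _ = s / t * (f (x + t *: v) - f x)) ?lerBlDl//; ring.
Qed.

(** x is a convex combination of x - s v and x + t v with weights t / (s + t) and s / (s + t). *)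
Lemma slopeN_le f v x s t : convex_function setT f -> 0 < s -> 0 < t ->
  - slope f (- v) x s <= slope f v x t.
Proof.
move=> cf s0 t0; have st : 0 < s + t by rewrite addr_gt0.
have := @convex_functionP _ _ f cf (x + s *: - v) (x + t *: v) (t / (s + t)).
rewrite divr_ge0 ?(ltW st) ?(ltW t0)//= ler_pdivrMr// mul1r lerDr (ltW s0) => /(_ erefl).
rewrite (_ : 1 - t / (s + t) = s / (s + t)); last by field; lra.
rewrite (_ : _ *: _ + _ = x); last first.
  by apply/rowP => i; rewrite !mxE; field; lra.
move=> h; rewrite /slope.
rewrite -mulNr ler_pdivrMr// mulrAC ler_pdivlMr//.
rewrite -(ler_pM2r st) in h.
rewrite (_ : (t / _ * _ + _) * (s + t) = t * f (x + s *: - v) + s * f (x + t *: v)) in h; last by field; lra.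
by lra.
Qed.

Lemma slope_has_inf f v x : convex_function setT f ->
  has_inf [set slope f v x t | t in [set t | 0 < t]].
Proof.
move=> cf; split; first by exists (slope f v x 1); exists 1 => //=.
by exists (- slope f (- v) x 1) => _ [t t0 <-]; exact: slopeN_le.
Qed.

Lemma dplus_le_slope f v x t : convex_function setT f -> 0 < t ->
  dplus f v x <= slope f v x t.
Proof. by move=> cf t0; apply: ge_inf; [exact: (slope_has_inf _ _ cf).2|exists t]. Qed.

Lemma dplus_ge f v x c : convex_function setT f ->
  (forall t, 0 < t -> c <= slope f v x t) -> c <= dplus f v x.
Proof.
move=> cf h; apply: lb_le_inf; first exact: (slope_has_inf _ _ cf).1.
by move=> _ [t t0 <-]; exact: h.
Qed.

Lemma dplus_near f v x e : convex_function setT f -> 0 < e ->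
  exists2 t, 0 < t & slope f v x t < dplus f v x + e.
Proof.
move=> cf e0; have := inf_adherent e0 (slope_has_inf v x cf).
by move=> [_ [t t0 <-] h]; exists t.
Qed.

Lemma dplusN_le f v x : convex_function setT f -> - dplus f (- v) x <= dplus f v x.
Proof.
move=> cf; apply: dplus_ge => // t t0; rewrite lerNl; apply: dplus_ge => // s s0.
by rewrite lerNl; exact: slopeN_le.
Qed.

(** Negative t are allowed: there the slope along - v is used, and [dplusN_le] compares the two
    one-sided derivatives. *)
Lemma dplus_subgradient f v x t : convex_function setT f ->
  f x + t * dplus f v x <= f (x + t *: v).
Proof.
move=> cf; have [t0|t0|<-] := ltgtP 0 t; last by rewrite mul0r scale0r !addr0.
  by have := dplus_le_slope v x cf t0; rewrite /slope ler_pdivlMr//; lra.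
have t1 : 0 < - t by lra.
have := dplus_le_slope (- v) x cf t1.
rewrite /slope ler_pdivlMr// scaleNr scalerN opprK => h.
have := dplusN_le v x cf; rewrite -(ler_pM2l t1); lra.
Qed.

(** Add the subgradient inequalities at the two ends of the segment. An arbitrarily small shift thus
    turns the right derivative into a lower bound for the left one. *)
Lemma dplus_shift_le f v x t : convex_function setT f -> 0 < t ->
  dplus f v x <= - dplus f (- v) (x + t *: v).
Proof.
move=> cf t0; have h1 := dplus_subgradient v x t cf.
have := dplus_subgradient (- v) (x + t *: v) t cf.
rewrite scalerN addrK => h2.
by rewrite -(ler_pM2l t0); lra.
Qed.

Lemma dplus_norm_le f v x : convex_function setT f ->
  `|dplus f v x| <= `|f (x + v) - f x| + `|f (x - v) - f x|.
Proof.
move=> cf.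
have := dplus_subgradient v x 1 cf; have := dplus_subgradient v x (-1) cf.
rewrite scale1r scaleN1r !mul1r mulN1r => h1 h2.
have := ler_norm (f (x + v) - f x); have := ler_norm (f (x - v) - f x).
have := normr_ge0 (f (x + v) - f x); have := normr_ge0 (f (x - v) - f x).
by rewrite ler_norml; lra.
Qed.

(** A sequence of steps exhibits [dplus f v] as a pointwise limit of continuous functions of x,
    hence as a measurable function. *)
Lemma cvg_dplus f v x : convex_function setT f ->
  (fun n => slope f v x n.+1%:R^-1) @ \oo --> dplus f v x.
Proof.
move=> cf; apply/cvgrPdist_lt => e e0.
have [t t0 ht] := dplus_near v x cf e0.
near=> n.
have n0 : 0 < n.+1%:R^-1 :> R by rewrite invr_gt0.
have nt : n.+1%:R^-1 <= t.
  by apply: ltW; near: n; exact: (near_infty_natSinv_lt (PosNum t0)).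
have h1 := dplus_le_slope v x cf n0.
have h2 := slope_le v x cf n0 nt.
by rewrite distrC ger0_norm; lra.
Unshelve. all: by end_near. Qed.

Lemma measurable_dplus f v : (0 < d)%N -> convex_function setT f ->
  measurable_fun setT (dplus f v).
Proof.
move=> d0 cf; apply: (@measurable_fun_cvg _ _ _ _ (fun n x => slope f v x n.+1%:R^-1)); last first.
  by move=> x _; exact: cvg_dplus.
move=> n; have mf := continuous_measurable_rV (convex_continuous d0 cf).
apply: measurable_funM => //; apply: measurable_funB => //.
by apply: measurableT_comp => //; exact: measurable_shift.
Qed.

Lemma cvg_slope_convex f v x : convex_function setT f ->
  dplus f v x = - dplus f (- v) x ->
  (fun h => h^-1 *: (f (h *: v + x) - f x)) @ 0^' --> dplus f v x.
Proof.
move=> cf e; apply/cvgrPdist_lt => /= a a0.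
have [t t0 ht] := dplus_near v x cf a0; have [s s0 hs] := dplus_near (- v) x cf a0.
exists (Num.min t s); first by rewrite /= lt_min t0 s0.
move=> h /=; rewrite sub0r normrN lt_min => /andP[hht hhs] h0.
have [h1|h1|h1] := ltgtP h 0; last by rewrite h1 eqxx in h0.
  have h2 : 0 < - h by lra.
  rewrite ltr0_norm// in hht hhs.
  have := slope_le (- v) x cf h2 (ltW hhs); have := dplus_le_slope (- v) x cf h2.
  have -> : slope f (- v) x (- h) = - (h^-1 *: (f (h *: v + x) - f x)).
    by rewrite /slope scalerN scaleNr opprK [x + _]addrC invrN mulrN -[_ *: (_ - _)]/(_ * _) mulrC.
  by move=> *; rewrite ltr_norml; lra.
rewrite gtr0_norm// in hht hhs.
have := slope_le v x cf h1 (ltW hht); have := dplus_le_slope v x cf h1.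
have -> : slope f v x h = h^-1 *: (f (h *: v + x) - f x).
  by rewrite /slope [x + _]addrC -[_ *: (_ - _)]/(_ * _) mulrC.
by move=> *; rewrite ltr_norml; lra.
Qed.

Lemma derivable_convexP f v x : convex_function setT f ->
  derivable f x v <-> dplus f v x = - dplus f (- v) x.
Proof.
move=> cf; split.
  move=> /cvg_ex[l /= /cvgrPdist_lt fl].
  apply/eqP; rewrite eq_le (dplusN_le _ _ cf) andbT -subr_le0 opprK.
  apply/ler_addgt0Pl => e e0; rewrite addr0.
  have e2 : 0 < e / 2 by lra.
  have [r /= r0 hr] := fl _ e2.
  have r2 : 0 < r / 2 by lra.
  have hp : `|l - (r/2)^-1 *: (f ((r/2) *: v + x) - f x)| < e / 2.
    by apply: hr; rewrite /= ?sub0r ?normrN ?gtr0_norm ?gt_eqF//; lra.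
  have hn : `|l - (- (r/2))^-1 *: (f ((- (r/2)) *: v + x) - f x)| < e / 2.
    by apply: hr; rewrite /= ?sub0r ?opprK ?gtr0_norm ?lt_eqF//; lra.
  have sp := dplus_le_slope v x cf r2; have sn := dplus_le_slope (- v) x cf r2.
  rewrite /slope scalerN -scaleNr ![x + _]addrC in sp sn.
  have r2' : r / 2 != 0 by rewrite gt_eqF.
  move: hp hn; rewrite !ltr_norml -![_ *: (_ - _)]/(_ * _) invrN mulNr ![_^-1 * _]mulrC.
  lra.
by move=> e; apply/cvg_ex; exists (dplus f v x); exact: cvg_slope_convex.
Qed.

(** Gives the value also where the derivative does not exist (the default [point]), so that
    measurability of [gradient] holds without an exceptional set. *)
Lemma derive_convexE f v x : convex_function setT f ->
  'D_v f x = if dplus f v x == - dplus f (- v) x then dplus f v x else point.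
Proof.
move=> cf; case: eqP => [e|ne].
  by apply/cvg_lim => //; exact: cvg_slope_convex.
by apply: dvgP => h; apply: ne; exact/(derivable_convexP v x cf).
Qed.

Lemma measurable_gradient f : (0 < d)%N -> convex_function setT f ->
  measurable_fun setT (gradient f).
Proof.
move=> d0 cf; apply: measurable_rV_fun => i.
rewrite (_ : (fun x => _) = fun x => if dplus f 'e_i x == - dplus f (- 'e_i) x
  then dplus f 'e_i x else point); last first.
  by apply/funext => x; rewrite mxE derive_convexE.
have m1 := measurable_dplus 'e_i d0 cf; have m2 := measurable_dplus (- 'e_i) d0 cf.
apply: measurable_fun_ifT => //.
apply: measurable_fun_eqr => //.
by apply: measurableT_comp.
Qed.

End right_derivative.

(** * Translation invariance of Lebesgue measure *)

Section lebesgue_shift.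
Context {R : realType}.

(** The translated measure agrees with Lebesgue measure on half-open intervals; uniqueness does the
    rest. *)
Lemma lebesgue_measure_shift (a : R) (A : set R) : measurable A ->
  lebesgue_measure ((fun x : R => x + a) @^-1` A) = lebesgue_measure A.
Proof.
move=> mA.
have ms : measurable_fun setT (fun x : measurableTypeR R => (x + a : measurableTypeR R)).
  by apply: measurable_funD => //; exact: measurable_cst.
pose m' : {measure set (measurableTypeR R) -> \bar R} :=
  measure_function_pushforward__canonical__measure_function_Measure (@lebesgue_measure R) ms.
apply/esym; rewrite (@lebesgue_measure_unique R m')//= => _ [[b c]] _ <-.
rewrite /pushforward.
rewrite (_ : _ @^-1` _ = `]b - a, c - a]%classic); last first.
  by apply/seteqP; split => x /=; rewrite !in_itv/= ltrBlDr lerBrDr.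
rewrite !lebesgue_measure_itv/= !lte_fin ltrD2r.
by case: ifPn => // _; rewrite -!EFinD; congr EFin; lra.
Qed.

(** A translation acts separately on the head and the tail of a row, so uniqueness of the product
    measure applies, by induction on d. *)
Lemma lebesgue_rV_shift (d : nat) (w : 'rV[R]_d) (A : set 'rV[R]_d) : measurable A ->
  lebesgue_rV R d ((fun x => x + w) @^-1` A) = lebesgue_rV R d A.
Proof.
elim: d w A => [|d IH] w A mA.
  congr (lebesgue_rV R 0 _); apply/funext => x /=.
  by congr (A _); apply/rowP => -[].
rewrite /= /lebesgue_rV_cons /pushforward.
pose s (p : measurableTypeR R * 'rV[R]_d) : measurableTypeR R * 'rV[R]_d :=
  ((p.1 : R) + w 0 0, p.2 + rV_tail w).
have ms : measurable_fun setT s.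
  apply/measurable_fun_pairP; split => /=.
    by apply: measurable_funD => //; exact: measurable_cst.
  exact: (measurableT_comp (measurable_shift (rV_tail w)) measurable_snd).
have -> : rV_cons (d:=d) @^-1` ((fun x => x + w) @^-1` A) = s @^-1` (rV_cons (d:=d) @^-1` A).
  apply/funext => p /=; congr (A _); apply/rowP => i.
  have [j ->|->] := unliftP 0 i.
    have -> : lift 0 j = rshift 1 j :> 'I_(1 + d) by apply/val_inj.
    rewrite mxE ![rV_cons _ 0 _]row_mxEr !mxE; congr (_ + w 0 _); exact/val_inj.
  have -> : 0 = lshift d (0 : 'I_1) :> 'I_(1 + d) by apply/val_inj.
  rewrite mxE ![rV_cons _ 0 _]row_mxEl !mxE eqxx !mulr1n; congr (_ + w 0 _); exact/val_inj.
pose m' : {measure set (measurableTypeR R * 'rV[R]_d) -> \bar R} :=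
  measure_function_pushforward__canonical__measure_function_Measure
    (@lebesgue_measure R \x lebesgue_rV R d)%E ms.
have mB : measurable (rV_cons (d:=d) @^-1` A).
  by rewrite -[X in measurable X]setTI; exact: measurable_rV_cons.
rewrite [RHS](@product_measure_unique _ _ _ _ _ _ _ m')// => B C mB' mC.
rewrite /m' /= /pushforward.
have -> : s @^-1` (B `*` C) =
    ((fun x : R => x + w 0 0) @^-1` B) `*` ((fun x => x + rV_tail w) @^-1` C) by [].
rewrite product_measure1E; first last.
- by rewrite -[X in measurable X]setTI; exact: measurable_shift.
- rewrite -[X in measurable X]setTI.
  have : measurable_fun setT (fun x : measurableTypeR R => (x + w 0 0 : measurableTypeR R)).
    by apply: measurable_funD => //; exact: measurable_cst.
  by apply.
by congr (_ * _)%E; [exact: lebesgue_measure_shift|exact: IH].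
Qed.

End lebesgue_shift.

(** * Real-valued integration of bounded functions with bounded support *)

Section bounded_support_functions.
Context {R : realType} {d : nat}.
Local Notation m := (lebesgue_rV R d).
Implicit Types (f g : 'rV[R]_d -> R).

(** Closed under sums, products and translations, and containing the right derivatives of convex
    functions; multiplied by a cutoff, such functions have a finite integral. *)
Definition locally_bounded f :=
  measurable_fun setT f /\ forall M : R, exists C : R, forall x, `|x| <= M -> `|f x| <= C.

Definition bounded_support f := locally_bounded f /\ exists M : R, forall x, M < `|x| -> f x = 0.

Lemma locally_bounded_cst (c : R) : locally_bounded (fun=> c).
Proof. by split=> // M; exists `|c|. Qed.

Lemma locally_boundedD f g : locally_bounded f -> locally_bounded g ->
  locally_bounded (fun x => f x + g x).
Proof.
move=> [mf bf] [mg bg]; split; first exact: measurable_funD.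
move=> M; have [C hC] := bf M; have [D hD] := bg M; exists (C + D) => x xM.
by rewrite (le_trans (ler_normD _ _))// lerD ?hC ?hD.
Qed.

Lemma locally_boundedM f g : locally_bounded f -> locally_bounded g ->
  locally_bounded (fun x => f x * g x).
Proof.
move=> [mf bf] [mg bg]; split; first exact: measurable_funM.
move=> M; have [C hC] := bf M; have [D hD] := bg M; exists (C * D) => x xM.
by rewrite normrM ler_pM ?hC ?hD.
Qed.

Lemma locally_boundedN f : locally_bounded f -> locally_bounded (fun x => - f x).
Proof.
move=> [mf bf]; split; first exact: measurableT_comp.
by move=> M; have [C hC] := bf M; exists C => x xM; rewrite normrN hC.
Qed.

Lemma locally_boundedB f g : locally_bounded f -> locally_bounded g ->
  locally_bounded (fun x => f x - g x).
Proof. by move=> bf bg; apply: locally_boundedD => //; exact: locally_boundedN. Qed.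

Lemma locally_bounded_norm f : locally_bounded f -> locally_bounded (fun x => `|f x|).
Proof.
move=> [mf bf]; split; first exact: measurableT_comp.
by move=> M; have [C hC] := bf M; exists C => x xM; rewrite normr_id hC.
Qed.

Lemma locally_bounded_max f g : locally_bounded f -> locally_bounded g ->
  locally_bounded (fun x => Num.max (f x) (g x)).
Proof.
move=> bf bg; have [mf _] := bf; have [mg _] := bg.
split; first exact: measurable_maxr.
move=> M; have [_ /(_ M) [C hC]] := bf; have [_ /(_ M) [D hD]] := bg.
exists (C + D) => x xM; have := hC _ xM; have := hD _ xM.
have := normr_ge0 (f x); have := normr_ge0 (g x).
by case: (leP (f x) (g x)); lra.
Qed.

Lemma locally_bounded_sum I (r : seq I) (P : pred I) (F : I -> 'rV[R]_d -> R) :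
  (forall i, P i -> locally_bounded (F i)) ->
  locally_bounded (fun x => \sum_(i <- r | P i) F i x).
Proof.
move=> bF; elim: r => [|i r IH].
  by under eq_fun do rewrite big_nil; exact: locally_bounded_cst.
under eq_fun do rewrite big_cons.
have [Pi|//] := boolP (P i); apply: locally_boundedD => //; exact: bF.
Qed.

Lemma locally_bounded_shift f w : locally_bounded f -> locally_bounded (fun x => f (x + w)).
Proof.
move=> [mf bf]; split; first by apply: measurableT_comp => //; exact: measurable_shift.
move=> M; have [C hC] := bf (M + `|w|); exists C => x xM; apply: hC.
by rewrite (le_trans (ler_normD _ _))// lerD2r.
Qed.

Lemma locally_bounded_indic (A : set 'rV[R]_d) : measurable A ->
  locally_bounded (\1_A : 'rV[R]_d -> R).
Proof.
move=> mA; split; first exact: measurable_indic.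
by move=> M; exists 1 => x _; rewrite indicE; case: (_ \in _); rewrite ?normr1 ?normr0.
Qed.

Lemma locally_bounded_continuous f : continuous f -> locally_bounded f.
Proof.
move=> cf; split; first exact: continuous_measurable_rV.
move=> M.
have /compact_bounded[C [_ hC]] : compact (f @` closed_ball_ (fun x => `|x|) 0 M).
  apply: continuous_compact; first exact: continuous_subspaceT.
  apply: bounded_closed_compact; last exact: closed_closed_ball_.
  exists M; split; first exact: num_real.
  move=> N MN x; rewrite /closed_ball_/= sub0r normrN => xM.
  by apply: le_trans xM _; exact: ltW.
exists (C + 1) => x xM; apply: (hC (C + 1)); first by rewrite ltrDl.
by exists x => //; rewrite /closed_ball_/= sub0r normrN.
Qed.

Lemma locally_bounded_dplus f v : (0 < d)%N -> convex_function setT f ->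
  locally_bounded (dplus f v).
Proof.
move=> d0 cf; split; first exact: measurable_dplus.
have bf := locally_bounded_continuous (convex_continuous d0 cf).
have := locally_boundedD
  (locally_bounded_norm (locally_boundedB (locally_bounded_shift v bf) bf))
  (locally_bounded_norm (locally_boundedB (locally_bounded_shift (- v) bf) bf)).
move=> [_ h] M; have [C hC] := h M; exists C => x /hC; rewrite ger0_norm ?addr_ge0//.
by apply: le_trans; exact: dplus_norm_le.
Qed.

Lemma bounded_support0 : bounded_support (fun=> 0).
Proof. by split; [exact: locally_bounded_cst|exists 0]. Qed.

Lemma bounded_supportD f g : bounded_support f -> bounded_support g -> bounded_support (fun x => f x + g x).
Proof.
move=> [bf [M hM]] [bg [N hN]]; split; first exact: locally_boundedD.
by exists (Num.max M N) => x; rewrite gt_max => /andP[xM xN]; rewrite hM// hN// addr0.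
Qed.

Lemma bounded_supportMr f g : bounded_support f -> locally_bounded g -> bounded_support (fun x => f x * g x).
Proof.
move=> [bf [M hM]] bg; split; first exact: locally_boundedM.
by exists M => x xM; rewrite hM// mul0r.
Qed.

Lemma bounded_supportMl f g : bounded_support f -> locally_bounded g -> bounded_support (fun x => g x * f x).
Proof. by move=> nf bg; under eq_fun do rewrite mulrC; exact: bounded_supportMr. Qed.

Lemma bounded_supportZ f (c : R) : bounded_support f -> bounded_support (fun x => c * f x).
Proof. by move=> nf; apply: bounded_supportMl => //; exact: locally_bounded_cst. Qed.

Lemma bounded_supportN f : bounded_support f -> bounded_support (fun x => - f x).
Proof.
move=> [bf [M hM]]; split; first exact: locally_boundedN.
by exists M => x xM; rewrite hM// oppr0.
Qed.

Lemma bounded_supportB f g : bounded_support f -> bounded_support g -> bounded_support (fun x => f x - g x).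
Proof. by move=> nf ng; apply: bounded_supportD => //; exact: bounded_supportN. Qed.

Lemma bounded_support_sum I (r : seq I) (P : pred I) (F : I -> 'rV[R]_d -> R) :
  (forall i, P i -> bounded_support (F i)) -> bounded_support (fun x => \sum_(i <- r | P i) F i x).
Proof.
move=> bF; elim: r => [|i r IH].
  by under eq_fun do rewrite big_nil; exact: bounded_support0.
under eq_fun do rewrite big_cons.
have [Pi|//] := boolP (P i); apply: bounded_supportD => //; exact: bF.
Qed.

Lemma bounded_support_shift f w : bounded_support f -> bounded_support (fun x => f (x + w)).
Proof.
move=> [bf [M hM]]; split; first exact: locally_bounded_shift.
exists (M + `|w|) => x xM; apply: hM.
by have := ler_normB (x + w) w; rewrite addrK; lra.
Qed.

Lemma bounded_support_indic (A : set 'rV[R]_d) M : measurable A -> (forall x, A x -> `|x| <= M) ->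
  bounded_support (\1_A : 'rV[R]_d -> R).
Proof.
move=> mA AM; split; first exact: locally_bounded_indic.
exists M => x Mx; rewrite indicE memNset// => /AM; rewrite leNgt.
by rewrite Mx.
Qed.

Lemma lebesgue_rV_bounded (A : set 'rV[R]_d) M : measurable A ->
  (forall x, A x -> `|x| <= M) -> (m A < +oo)%E.
Proof.
move=> mA AM; have mI : measurable (`[- M, M]%classic : set R) by [].
have := @lebesgue_rV_box R d (fun=> `[- M, M]%classic) (fun=> mI).
set Q := [set v | _] => mQ.
have MQ : measurable Q.
  rewrite (_ : Q = \bigcap_(i in [set: 'I_d]) ((fun v => v 0 i) @^-1` `[- M, M]%classic)); last first.
    by apply/seteqP; split => w /= Aw i => [_|]; exact: Aw.
  apply: fin_bigcap_measurable => // i _.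
  by rewrite -[X in measurable X]setTI; exact: measurable_rV_coord.
apply: (@le_lt_trans _ _ (m Q)).
  apply: le_measure; rewrite ?inE// => x Ax i.
  rewrite /= in_itv/= -ler_norml; apply: le_trans (AM _ Ax); exact: ler_norm_rV.
rewrite mQ (eq_bigr (fun=> (fine (lebesgue_measure `[- M, M]))%:E)); last first.
  move=> i _; rewrite fineK// ge0_fin_numE//.
  by rewrite lebesgue_measure_itv/=; case: ifP; rewrite ?ltry.
by rewrite prodEFin ltry.
Qed.

Definition integral_rV (f : 'rV[R]_d -> R) : R := \int[m]_x f x.

Lemma bounded_support_integrable f : bounded_support f -> m.-integrable setT (EFin \o f).
Proof.
move=> [[mf bf] [M hM]]; have [C hC] := bf M.
pose A := closed_ball_ (fun x => `|x|) (0 : 'rV[R]_d) M.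
have mA : measurable A.
  rewrite -[A]setCK; apply: measurableC; apply: open_measurable_rV.
  by rewrite openC; exact: closed_closed_ball_.
have AM x : A x <-> `|x| <= M by rewrite /A /closed_ball_/= sub0r normrN.
have := @measurable_bounded_integrable _ _ _ m f A mA.
move=> /(_ _ _ _)/integrable_mkcond => /(_ mA).
rewrite (_ : (EFin \o f) \_ A = EFin \o f); last first.
  apply/funext => x; rewrite patchE; case: ifPn => //; rewrite notin_setE AM => /negP.
  by rewrite -ltNge => xM /=; rewrite hM.
apply.
- exact: (lebesgue_rV_bounded mA (fun x => (AM x).1)).
- exact: measurable_funTS.
- exists C; split; first exact: num_real.
  by move=> N CN x /= /AM /hC /le_trans; apply; exact: ltW.
Qed.

Lemma integral_rVD f g : bounded_support f -> bounded_support g ->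
  integral_rV (fun x => f x + g x) = integral_rV f + integral_rV g.
Proof. by move=> nf ng; rewrite /integral_rV RintegralD//; exact: bounded_support_integrable. Qed.

Lemma integral_rVB f g : bounded_support f -> bounded_support g ->
  integral_rV (fun x => f x - g x) = integral_rV f - integral_rV g.
Proof. by move=> nf ng; rewrite /integral_rV RintegralB//; exact: bounded_support_integrable. Qed.

Lemma integral_rVZ (c : R) f : bounded_support f -> integral_rV (fun x => c * f x) = c * integral_rV f.
Proof. by move=> nf; rewrite /integral_rV RintegralZl//; exact: bounded_support_integrable. Qed.

Lemma integral_rV_sum I (r : seq I) (P : pred I) (F : I -> 'rV[R]_d -> R) :
  (forall i, P i -> bounded_support (F i)) ->
  integral_rV (fun x => \sum_(i <- r | P i) F i x) = \sum_(i <- r | P i) integral_rV (F i).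
Proof.
move=> nF; elim: r => [|i r IH].
  rewrite big_nil (_ : (fun x => _) = fun=> 0); last by apply/funext => x; rewrite big_nil.
  by rewrite /integral_rV /Rintegral integral0.
under eq_fun do rewrite big_cons; rewrite big_cons.
have [Pi|//] := boolP (P i); rewrite integral_rVD ?IH//; first exact: nF.
exact: bounded_support_sum.
Qed.

Lemma ler_integral_rV f g : bounded_support f -> bounded_support g -> (forall x, f x <= g x) ->
  integral_rV f <= integral_rV g.
Proof. by move=> nf ng fg; apply: le_Rintegral => //; exact: bounded_support_integrable. Qed.

Lemma integral_rV_ge0 f : (forall x, 0 <= f x) -> 0 <= integral_rV f.
Proof. by move=> f0; apply: Rintegral_ge0. Qed.

Lemma integral_rV_shift f w : bounded_support f -> integral_rV (fun x => f (x + w)) = integral_rV f.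
Proof.
move=> nf; rewrite /integral_rV /Rintegral.
pose ms := @measurable_shift R d w.
pose m' : {measure set 'rV[R]_d -> \bar R} :=
  measure_function_pushforward__canonical__measure_function_Measure m ms.
have <- : (\int[m']_x (f x)%:E = \int[m]_x (f x)%:E)%E.
  apply: eq_measure_integral => A mA _; exact: lebesgue_rV_shift.
rewrite /m' /= integral_pushforward//.
- by have [[mf _] _] := nf; exact/measurable_EFinP.
- exact: (bounded_support_integrable (bounded_support_shift w nf)).
Qed.

Lemma integral_rV_eq0_ae f : bounded_support f -> (forall x, 0 <= f x) -> integral_rV f = 0 ->
  {ae m, forall x, f x = 0}.
Proof.
move=> nf f0 If; have inf := bounded_support_integrable nf.
have [[mf _] _] := nf.
have h : (\int[m]_x `|(f x)%:E| = 0)%E.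
  under eq_integral do rewrite gee0_abs ?lee_fin//.
  by rewrite -[LHS]fineK ?integrable_fin_num//= [fine _]If.
have mf' : measurable_fun setT (EFin \o f) by exact/measurable_EFinP.
have := (ae_eq_integral_abs m measurableT mf').1 h.
by apply: filterS => x /(_ I) [].
Qed.

End bounded_support_functions.

Lemma max0_lipschitz (R : realDomainType) (a b : R) :
  `|Num.max 0 a - Num.max 0 b| <= `|a - b|.
Proof.
case: (leP 0 a) => a0; case: (leP 0 b) => b0; rewrite ?subrr ?subr0 ?sub0r ?normr0 ?normrN//.
- by rewrite !ger0_norm//; lra.
- by rewrite distrC !ger0_norm//; lra.
Qed.

(** Serves for each passage to the limit t -> 0 below, where the error is linear in t. *)
Lemma ler_vanishing (R : realFieldType) (a b c r : R) : 0 < r ->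
  (forall t, 0 < t -> t <= r -> a <= b + t * c) -> a <= b.
Proof.
move=> r0 h; apply/ler_addgt0Pl => e e0.
have c0 : 0 < `|c| + 1 by have := normr_ge0 c; lra.
have := h (Num.min r (e / (`|c| + 1))).
rewrite lt_min r0 divr_gt0// ge_min lexx => /(_ erefl erefl)/le_trans; apply.
rewrite addrC lerD2r; apply: (@le_trans _ _ (e / (`|c| + 1) * (`|c| + 1))).
  apply: (@le_trans _ _ (Num.min r (e / (`|c| + 1)) * (`|c| + 1))).
    rewrite ler_wpM2l// ?le_min ?ltW ?divr_gt0//.
    by have := ler_norm c; lra.
  by rewrite ler_wpM2r ?ge_min ?lexx ?orbT// ltW.
by rewrite divfK// gt_eqF.
Qed.

(** * Translation estimates for semiconvex functions *)

Section directional_estimates.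
Context {R : realType} {d : nat}.
Local Notation m := (lebesgue_rV R d).
Implicit Types (f u p G W : 'rV[R]_d -> R) (v w : 'rV[R]_d).

Lemma bounded_support_bump (k : R) : bounded_support (fun x : 'rV[R]_d => Num.max 0 (k - `|x|)).
Proof.
split; last by exists k => x kx; rewrite max_l//; lra.
apply: locally_bounded_max; first exact: locally_bounded_cst.
apply: locally_boundedB; first exact: locally_bounded_cst.
by apply: locally_bounded_continuous; exact: norm_continuous.
Qed.

(* [D x := - dplus f (- v) x] satisfies D x <= dplus f v x <= D (x + t v) for t > 0, and the
   integrals of D and of its translates agree up to o(1) as t tends to 0. *)
Lemma ae_dplusN f v : (0 < d)%N -> convex_function setT f ->
  {ae m, forall x, dplus f v x = - dplus f (- v) x}.
Proof.
move=> d0 cf.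
pose D x := - dplus f (- v) x; pose W (k : nat) (x : 'rV[R]_d) : R := Num.max 0 (k%:R - `|x|).
have bD : locally_bounded D by apply: locally_boundedN; exact: locally_bounded_dplus.
have bd : locally_bounded (dplus f v) by exact: locally_bounded_dplus.
have nW k : bounded_support (W k) by exact: bounded_support_bump.
have W0 k x : 0 <= W k x by rewrite /W le_max lexx.
have g0 x : 0 <= dplus f v x - D x by rewrite subr_ge0 dplusN_le.
suff h k : {ae m, forall x, W k x * (dplus f v x - D x) = 0}.
  have := ae_foralln h; apply: filterS => x hx.
  have [k kx] : exists k : nat, `|x| < k%:R.
    by exists (Num.truncn `|x|).+1; exact: truncnS_gt.
  move/eqP: (hx k); rewrite mulf_eq0 => /orP[|]; last by rewrite subr_eq0 => /eqP.
  by rewrite /W max_r ?subr_eq0 ?gt_eqF// subr_ge0 ltW.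
have nWg : bounded_support (fun x => W k x * (dplus f v x - D x)).
  by apply: bounded_supportMr => //; exact: locally_boundedB.
apply: integral_rV_eq0_ae => //; first by move=> x; rewrite mulr_ge0.
apply/eqP; rewrite eq_le integral_rV_ge0 ?andbT; last by move=> x; rewrite mulr_ge0.
(* Contains the supports of the cutoff [W k] and of its translates by t v with 0 < t <= 1. *)
pose Q := closed_ball_ (fun x => `|x|) (0 : 'rV[R]_d) (k%:R + `|v|).
have QE x : Q x <-> `|x| <= k%:R + `|v| by rewrite /Q /closed_ball_/= sub0r normrN.
have nQ : bounded_support (\1_Q : 'rV[R]_d -> R).
  apply: (@bounded_support_indic _ _ _ (k%:R + `|v|)); last by move=> x /QE.
  rewrite -[Q]setCK; apply: measurableC; apply: open_measurable_rV.
  by rewrite openC; exact: closed_closed_ball_.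
apply: (@ler_vanishing _ _ 0 (`|v| * integral_rV (fun x => \1_Q x * `|D x|)) 1) => // t t0 t1.
have nWD s : bounded_support (fun x => W k (x + s) * D x) by apply: bounded_supportMr => //;
  exact: bounded_support_shift.
have nWs : bounded_support (fun x => W k x * D (x + t *: v)).
  by apply: bounded_supportMr => //; exact: locally_bounded_shift.
have nWD0 : bounded_support (fun x => W k x * D x) by apply: bounded_supportMr.
apply: (@le_trans _ _ (integral_rV (fun x => W k x * D (x + t *: v) - W k x * D x))).
  apply: ler_integral_rV => //; first exact: bounded_supportB.
  move=> x; rewrite -mulrBr ler_wpM2l// lerD2r /D; exact: dplus_shift_le.
rewrite integral_rVB//.
(* The translation is moved from D, which is only locally bounded, to the 1-Lipschitz cutoff. *)
have -> : integral_rV (fun x => W k x * D (x + t *: v)) = integral_rV (fun x => W k (x + - (t *: v)) * D x).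
  by rewrite -[RHS](integral_rV_shift (t *: v))//; congr integral_rV; apply/funext => x; rewrite addrK.
rewrite -integral_rVB// add0r mulrA -integral_rVZ; last by apply: bounded_supportMr => //;
  exact: locally_bounded_norm.
apply: ler_integral_rV; first exact: bounded_supportB.
  by apply: bounded_supportZ; apply: bounded_supportMr => //; exact: locally_bounded_norm.
move=> x; rewrite -mulrBl; apply: (le_trans (ler_norm _)); rewrite normrM mulrA.
apply: ler_wpM2r => //; rewrite indicE.
have [xQ|xQ] := boolP (x \in Q).
  rewrite mulr1; apply: (le_trans (max0_lipschitz _ _)).
  rewrite opprB addrC addrA subrK; apply: (le_trans (ler_dist_dist _ _)).
  by rewrite opprB addrC subrK normrZ gtr0_norm.
have {}xQ : k%:R + `|v| < `|x|.
  by rewrite ltNge; apply: contra xQ => xQ; rewrite inE; exact/QE.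
have := ler_normB (x + - (t *: v)) (- (t *: v)); rewrite opprK subrK normrN normrZ gtr0_norm// => h.
have tv : t * `|v| <= `|v| by rewrite ler_piMl.
have v0 := normr_ge0 v.
by rewrite /W !max_l ?subrr ?normr0 ?mulr0//; lra.
Qed.

(** A change of variables moves the difference from u to G. Both G and its translate vanish off B',
    so only u on B' enters. *)
Lemma integral_rV_shift_diff (B B' : set 'rV[R]_d) M u G w (l : R) :
  measurable B' -> (forall x, B' x -> `|x| <= M) ->
  locally_bounded u -> locally_bounded G ->
  (forall x, ~ B x -> G x = 0) -> B `<=` B' -> (forall x, B x -> B' (x + w)) ->
  (forall x, `|G (x - w) - G x| <= l) ->
  integral_rV (fun x => G x * (u (x + w) - u x)) <= l * integral_rV (fun x => \1_B' x * `|u x|).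
Proof.
move=> mB' B'M bu bG G0 BB' BwB' Gl.
have nB' : bounded_support (\1_B' : 'rV[R]_d -> R) by exact: bounded_support_indic B'M.
have nG : bounded_support G.
  split=> //; exists M => x xM; apply: G0 => /BB'/B'M; rewrite leNgt.
  by rewrite xM.
have n1 : bounded_support (fun x => G x * u (x + w)) by apply: bounded_supportMr => //;
  exact: locally_bounded_shift.
have n2 : bounded_support (fun x => G x * u x) by exact: bounded_supportMr.
have n3 : bounded_support (fun x => G (x - w) * u x) by apply: bounded_supportMr => //;
  exact: bounded_support_shift.
rewrite (_ : (fun x => _) = (fun x => G x * u (x + w) - G x * u x)); last first.
  by apply/funext => x; rewrite mulrBr.
rewrite integral_rVB//.
have -> : integral_rV (fun x => G x * u (x + w)) = integral_rV (fun x => G (x - w) * u x).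
  by rewrite -[RHS](integral_rV_shift w)//; congr integral_rV; apply/funext => x; rewrite addrK.
have n4 : bounded_support (fun x => \1_B' x * `|u x|) by apply: bounded_supportMr => //;
  exact: locally_bounded_norm.
rewrite -integral_rVB// -integral_rVZ//; apply: ler_integral_rV;
  [exact: bounded_supportB|exact: bounded_supportZ|] => x.
rewrite -mulrBl; apply: (le_trans (ler_norm _)); rewrite normrM mulrA.
apply: ler_wpM2r => //; rewrite indicE.
have [_|xB'] := boolP (x \in B'); first by rewrite mulr1.
have {}xB' : ~ B' x by move=> h; rewrite mem_set in xB'.
rewrite (G0 x); last by move/BB'.
by rewrite G0 ?subrr ?normr0 ?mulr0// => /BwB'; rewrite subrK.
Qed.

Section one_direction.
Variables (B B' : set 'rV[R]_d) (v : 'rV[R]_d) (u p : 'rV[R]_d -> R) (M0 Lam del : R).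
Hypotheses (mB' : measurable B') (B'M : forall x, B' x -> `|x| <= M0).
Hypothesis del0 : 0 < del.
Hypothesis BB' : forall x t, B x -> `|t| <= del -> B' (x + t *: v).
Hypotheses (bu : locally_bounded u) (bp : locally_bounded p).
Hypothesis up : forall x t, B x -> `|t| <= del -> u x + t * p x - Lam * t ^+ 2 <= u (x + t *: v).

Let BsubB' : B `<=` B'.
Proof. by move=> x Bx; have := @BB' x 0 Bx; rewrite normr0 scale0r addr0; apply; exact: ltW. Qed.

(* Discrete integration by parts. Stepping forward where W > 0 and backward where W < 0, only
   the lower Taylor bound on u is needed. *)
Lemma linear_estimate W (L : R) : locally_bounded W -> (forall x, ~ B x -> W x = 0) ->
  (forall x t, `|t| <= del -> `|W (x + t *: v) - W x| <= L * `|t|) ->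
  integral_rV (fun x => W x * p x) <= 2 * L * integral_rV (fun x => \1_B' x * `|u x|).
Proof.
move=> bW W0 WL.
have nW : bounded_support W.
  split=> //; exists M0 => x xM; apply: W0 => /BsubB'/B'M; rewrite leNgt.
  by rewrite xM.
(* After division by t the quadratic Taylor errors leave t * Lam times the integral of |W|. The
   factor 2 comes from adding the forward steps, weighted by [Wp], and the backward ones, weighted
   by [Wn]. *)
apply: (@ler_vanishing _ _ _ (Lam * integral_rV (fun x => `|W x|)) del) => // t t0 td.
pose Wp x := Num.max 0 (W x); pose Wn x := Num.max 0 (- W x).
have bWp : locally_bounded Wp by apply: locally_bounded_max => //; exact: locally_bounded_cst.
have bWn : locally_bounded Wn.
  by apply: locally_bounded_max; [exact: locally_bounded_cst|exact: locally_boundedN].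
have Wp0 x : ~ B x -> Wp x = 0 by move=> /W0; rewrite /Wp => ->; rewrite maxxx.
have Wn0 x : ~ B x -> Wn x = 0 by move=> /W0; rewrite /Wn => ->; rewrite oppr0 maxxx.
have tn : `|t| = t by rewrite gtr0_norm.
have ntn : `|- t| = t by rewrite normrN gtr0_norm.
have ep : integral_rV (fun x => Wp x * (u (x + t *: v) - u x)) <=
  (L * t) * integral_rV (fun x => \1_B' x * `|u x|).
  apply: (@integral_rV_shift_diff B B' M0) => //.
    by move=> x Bx; apply: BB' => //; rewrite tn.
  move=> x; apply: (le_trans (max0_lipschitz _ _)).
  by have := @WL x (- t); rewrite ntn scaleNr; apply.
have en : integral_rV (fun x => Wn x * (u (x + - t *: v) - u x)) <=
  (L * t) * integral_rV (fun x => \1_B' x * `|u x|).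
  apply: (@integral_rV_shift_diff B B' M0) => //.
    by move=> x Bx; apply: BB' => //; rewrite ntn.
  move=> x; apply: (le_trans (max0_lipschitz _ _)).
  rewrite -opprD normrN scaleNr opprK.
  by have := @WL x t; rewrite tn; apply.
have nn (F : 'rV[R]_d -> R) w : (forall x, ~ B x -> F x = 0) -> locally_bounded F ->
  bounded_support (fun x => F x * (u (x + w) - u x)).
  move=> F0 bF; apply: bounded_supportMr; last by apply: locally_boundedB => //; exact: locally_bounded_shift.
  split=> //; exists M0 => x xM; apply: F0 => /BsubB'/B'M; rewrite leNgt.
  by rewrite xM.
have n1 := nn Wp (t *: v) Wp0 bWp; have n2 := nn Wn (- t *: v) Wn0 bWn.
have n3 : bounded_support (fun x => `|W x|).
  split; first exact: locally_bounded_norm.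
  by have [_ [M hM]] := nW; exists M => x /hM ->; rewrite normr0.
have key : integral_rV (fun x => t * (W x * p x)) <= integral_rV (fun x => Wp x * (u (x + t *: v) - u x) +
    Wn x * (u (x + - t *: v) - u x) + (t ^+ 2 * Lam) * `|W x|).
  apply: ler_integral_rV.
  - by apply: bounded_supportZ; exact: bounded_supportMr.
  - by apply: bounded_supportD; [exact: bounded_supportD|exact: bounded_supportZ].
  move=> x; have [Bx|nBx] := pselect (B x); last first.
    by rewrite Wp0// Wn0// W0// normr0 !mul0r !mulr0 !addr0.
  have h1 := @up x t Bx; have h2 := @up x (- t) Bx.
  rewrite tn ntn in h1 h2; move: h1 h2 => /(_ td) h1 /(_ td) h2.
  rewrite sqrrN in h2; rewrite /Wp /Wn.
  have [w0|w0] := leP 0 (W x).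
    rewrite max_l ?oppr_le0// mul0r addr0 ger0_norm//.
    have := ler_wpM2l w0 h1; lra.
  rewrite max_r ?oppr_ge0 ?(ltW w0)// mul0r add0r ltr0_norm//.
  have w0' : 0 <= - W x by lra.
  have := ler_wpM2l w0' h2; lra.
rewrite !integral_rVD// in key; [|exact: bounded_supportD|exact: bounded_supportZ].
rewrite !integral_rVZ// in key; last exact: bounded_supportMr.
rewrite -(ler_pM2l t0); move: key ep en; lra.
Qed.

End one_direction.
End directional_estimates.

(** Any two indices satisfying P are consecutive, which excludes three of them. This bounds the
    overlap of the translated level sets. *)
Lemma sum_adjacent_le2 (P : nat -> bool) n :
  (forall k l, (k < l)%N -> P k -> P l -> l = k.+1) -> (\sum_(k < n) P k <= 2)%N.
Proof.
have one (Q : nat -> bool) m : (forall k, (k < m)%N -> Q k -> k = m.-1) -> (\sum_(k < m) Q k <= 1)%N.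
  case: m => [|m] h; first by rewrite big_ord0.
  rewrite big_ord_recr/= big1 ?add0n ?leq_b1// => i _.
  case E : (Q i) => //; have := h _ (ltnW (ltn_ord i : (i < m)%N)) E => /= im.
  by have := ltn_ord i; rewrite im ltnn.
move=> h; elim: n => [|n IH]; first by rewrite big_ord0.
rewrite big_ord_recr/=; case E : (P n); last by rewrite addn0.
rewrite -[nat_of_bool true]/1%N addn1 ltnS; apply: one => k kn Pk.
by rewrite (h k n kn Pk E).
Qed.

Section quadratic.
Context {R : realType} {d : nat}.
Local Notation m := (lebesgue_rV R d).
Implicit Types (f : 'rV[R]_d -> R).

Lemma locally_bounded_min (f g : 'rV[R]_d -> R) : locally_bounded f -> locally_bounded g ->
  locally_bounded (fun x => Num.min (f x) (g x)).
Proof.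
move=> bf bg.
rewrite (_ : (fun x => _) = fun x => - Num.max (- f x) (- g x)); last first.
  by apply/funext => x; rewrite -oppr_min opprK.
by apply: locally_boundedN; apply: locally_bounded_max; exact: locally_boundedN.
Qed.

(** Where |p| > 1 the length of the translation no longer grows with p, so comparing u with its
    translates controls |p| and not p^2. *)
Definition cap (a : R) : R := Num.min `|a| (a ^+ 2).

(** The part of [cap] seen when stepping along v, where p > 0; points with p < 0 are treated by
    stepping along - v. *)
Definition cap_pos (a : R) : R := Num.max 0 (Num.min a (a ^+ 2)).

Lemma cap_posE (a : R) : cap a = cap_pos a + cap_pos (- a).
Proof.
have a2 := sqr_ge0 a.
rewrite /cap /cap_pos sqrrN; have [a0|a0] := leP 0 a.
  rewrite ger0_norm// [Num.min (- a) _]min_l ?[Num.max 0 (- a)]max_l ?addr0; [|lra|lra].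
  by rewrite max_r// le_min a0.
rewrite ltr0_norm// [Num.min a _]min_l ?[Num.max 0 a]max_l ?add0r; [|lra|lra].
by rewrite max_r// le_min a2; lra.
Qed.

Lemma cap_pos_le_sq (a : R) : cap_pos a <= a ^+ 2.
Proof. by rewrite /cap_pos ge_max sqr_ge0 ge_min lexx orbT. Qed.

Lemma cap_pos_le (a : R) : 0 <= a -> cap_pos a <= a.
Proof. by move=> a0; rewrite /cap_pos ge_max a0 ge_min lexx. Qed.

Lemma cap_pos0 (a : R) : a <= 0 -> cap_pos a = 0.
Proof.
move=> a0; have := sqr_ge0 a; rewrite /cap_pos => a2.
by rewrite min_l ?max_l; lra.
Qed.

Lemma locally_bounded_cap_pos f : locally_bounded f -> locally_bounded (fun x => cap_pos (f x)).
Proof.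
move=> bf; apply: locally_bounded_max; first exact: locally_bounded_cst.
apply: locally_bounded_min => //.
by under eq_fun do rewrite expr2; exact: locally_boundedM.
Qed.

Section dyadic.
Variables (B B' : set 'rV[R]_d) (v : 'rV[R]_d) (u p : 'rV[R]_d -> R) (M0 Lam del M : R).
Hypotheses (mB : measurable B) (mB' : measurable B') (B'M : forall x, B' x -> `|x| <= M0).
Hypotheses (del0 : 0 < del) (Lam0 : 0 <= Lam).
Hypothesis BB' : forall x t, B x -> `|t| <= del -> B' (x + t *: v).
Hypotheses (bu : locally_bounded u) (bp : locally_bounded p).
Hypothesis up : forall x t, B x -> `|t| <= del -> u x + t * p x - Lam * t ^+ 2 <= u (x + t *: v).
Hypotheses (M_gt0 : 0 < M) (LamM : 4 * Lam <= M) (Mdel : 1 <= M * del).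

(* The dyadic level set [e k] of p is translated by [r k], comparable to p / M there: at that
   distance the linear growth of u still dominates [Lam * t ^+ 2]. *)
Let s (k : nat) : R := 2^-1 ^+ k.
Let r (k : nat) : R := s k / M.
Let e (k : nat) (x : 'rV[R]_d) : bool :=
  [&& x \in B, s k < p x & (if k is k'.+1 then p x <= s k' else true)].

Let s_gt0 k : 0 < s k. Proof. by rewrite exprn_gt0. Qed.

Let s_half k : s k = 2 * s k.+1.
Proof. by rewrite /s exprS; field. Qed.

Let s_le k l : (k <= l)%N -> s l <= s k.
Proof. by move=> kl; rewrite /s; apply: ler_wiXn2l => //; lra. Qed.

Let s_le1 k : s k <= 1.
Proof. exact: (@s_le 0). Qed.

Let r_gt0 k : 0 < r k. Proof. by rewrite divr_gt0. Qed.

Let r_del k : r k <= del.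
Proof.
rewrite /r ler_pdivrMr// mulrC; apply: le_trans Mdel; exact: s_le1.
Qed.

Let measurable_e k : measurable [set x | e k x].
Proof.
have mp := bp.1.
rewrite (_ : [set x | _] = B `&` (p @^-1` `]s k, +oo[) `&`
   (if k is k'.+1 then p @^-1` `]-oo, s k'] else setT)).
  apply: measurableI; first apply: measurableI => //.
    by rewrite -[X in measurable X]setTI; exact: mp.
  by case: k => // k; rewrite -[X in measurable X]setTI; exact: mp.
apply/seteqP; split => x; rewrite /= /e in_itv/= andbT.
  by case: k => [/and3P[/set_mem]|k /and3P[/set_mem]] //; rewrite /= in_itv.
case: k => [[[Bx sp] _]|k [[Bx sp]]]; first by rewrite mem_set// sp.
by rewrite /= in_itv/= => ps; rewrite mem_set// sp.
Qed.

Let e_B k x : e k x -> B x.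
Proof. by move=> /and3P[/set_mem]. Qed.

Let BsubB' x : B x -> B' x.
Proof. by move=> Bx; have := @BB' x 0 Bx; rewrite normr0 scale0r addr0; apply; exact: ltW. Qed.

Let bounded_support_e k : bounded_support (fun x => (e k x)%:R).
Proof.
rewrite (_ : (fun x => _) = \1_[set x | e k x]).
  by apply: (@bounded_support_indic _ _ _ M0) => // x /= /e_B /BsubB' /B'M.
apply/funext => x; rewrite indicE; congr (nat_of_bool _)%:R.
by apply/idP/idP; [move=> ?; apply/mem_set|move=> /set_mem].
Qed.

Let e_cover x n : B x -> s n < p x -> exists2 k, (k < n.+1)%N & e k x.
Proof.
move=> Bx; elim: n => [|n IH] sp; first by exists 0%N => //; rewrite /e mem_set// sp.
have [/IH[k kn ek]|ps] := ltP (s n) (p x); first by exists k => //; exact: ltnW.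
by exists n.+1 => //; rewrite /e mem_set// sp ps.
Qed.

(** As 4 Lam (r k) <= s k < p, the quadratic loss in [up] is at most a quarter of (r k) p, hence s k
    * p = M (r k) p <= 2 M (|u (x + r k v)| + |u x|). On level k, [cap_pos] is at most 2 (s k) p,
    because p <= 2 s k if k > 0 and s 0 = 1. *)
Let e_bound k x : e k x -> cap_pos (p x) <= 4 * M * (`|u (x + r k *: v)| + `|u x|).
Proof.
move=> /[dup] /e_B Bx /and3P[_ sp ps].
have p0 : 0 < p x by apply: lt_trans sp; exact: s_gt0.
have h1 : cap_pos (p x) <= 2 * (s k * p x).
  case: k {sp} ps => [_|k ps].
    by rewrite /s expr0 mul1r; have := cap_pos_le (ltW p0); lra.
  apply: le_trans (cap_pos_le_sq _) _; rewrite mulrA -s_half expr2.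
  by rewrite ler_pM2r.
apply: le_trans h1 _.
have rk : `|r k| <= del by rewrite gtr0_norm.
have := up Bx rk.
have rM : s k = r k * M by rewrite /r divfK// gt_eqF.
have : Lam * r k ^+ 2 <= r k * p x / 4.
  have : Lam * (4 * r k) <= p x.
    apply: le_trans (ltW sp); rewrite rM mulrCA mulrA mulrC [in leRHS]mulrC mulrC.
    by have := ler_wpM2r (ltW (r_gt0 k)) LamM; lra.
  have := ltW (r_gt0 k); move=> r0 /(ler_wpM2l r0); rewrite expr2; lra.
have := ler_norm (u (x + r k *: v)); have := ler_norm (- u x); rewrite normrN.
set Q := `|_| + `|_|; move=> h1 h2 h3 h4.
have h5 : r k * p x <= 2 * Q.
  have : 0 <= Q by rewrite addr_ge0.
  rewrite /Q in h1 h2 *; lra.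
have := ler_wpM2l (ltW M_gt0) h5.
by rewrite rM; lra.
Qed.

(* Semiconvexity of u makes p almost nondecreasing along v: at most two of the translated
   level sets meet at a given point. *)
Let e_adjacent x k l : (k < l)%N -> e k (x - r k *: v) -> e l (x - r l *: v) -> l = k.+1.
Proof.
move=> kl; set y := x - r k *: v; set z := x - r l *: v.
move=> /[dup] /e_B By /and3P[_ sy _] /[dup] /e_B Bz /and3P[_ _ ].
have rlk : 0 <= r k - r l.
  by rewrite subr_ge0 /r ler_pM2r ?invr_gt0// s_le// ltnW.
set t := r k - r l in rlk.
have tr : t <= r k by rewrite /t; have := r_gt0 l; lra.
have zy : z = y + t *: v.
  by rewrite /z /y /t scalerBl addrA subrK.
have tdel : `|t| <= del by rewrite ger0_norm//; exact: le_trans (r_del k).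
have ntdel : `|- t| <= del by rewrite normrN.
have h1 := up By tdel; have h2 := up Bz ntdel.
rewrite -zy in h1; rewrite scaleNr sqrrN (_ : z - t *: v = y) ?zy ?addrK// -zy in h2.
have h3 : t * (p y - p z) <= t * (2 * Lam * t) by lra.
have [t0|t0] := eqVneq t 0.
  exfalso; have : s l < s k.
    apply: (@le_lt_trans _ _ (s k.+1)); first exact: s_le.
    by rewrite [X in _ < X]s_half; have := s_gt0 k.+1; lra.
  move: t0; rewrite /t => /eqP; rewrite subr_eq0 => /eqP rr.
  suff -> : s k = s l by rewrite ltxx.
  by have := congr1 (fun a => a * M) rr; rewrite /r !divfK// gt_eqF.
rewrite ler_pM2l in h3; last by rewrite lt_neqAle eq_sym t0.
(* Hence p z >= p y - s k / 2 > s k.+1, whereas l > k.+1 would put p z below s k.+1 by the upper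
   bound defining level l. *)
have h4 : 2 * Lam * t <= s k / 2.
  have rM : s k = r k * M by rewrite /r divfK// gt_eqF.
  have a1 := ler_wpM2l Lam0 tr; have a2 := ler_wpM2r (ltW (r_gt0 k)) LamM.
  by rewrite rM; lra.
case: l kl @z @t rlk tr zy tdel ntdel h1 h2 t0 h3 h4 Bz => // l kl z t rlk tr zy _ _ _ _ _ h3 h4 Bz h5.
congr S; apply/eqP; rewrite eqn_leq andbC; move: kl; rewrite ltnS => ->/=.
rewrite leqNgt; apply/negP => kl; have h6 := s_le kl.
by have := s_half k; lra.
Qed.

(** Points with p <= s n contribute at most (s n)^2 times the volume of B, which vanishes as n
    grows. The others lie in one of n + 1 level sets; in each of the two sums given by [e_bound] at
    most two terms overlap, whence 4 M (2 + 2) = 16 M. *)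
Lemma cap_pos_estimate :
  integral_rV (fun x => \1_B x * cap_pos (p x)) <= 16 * M * integral_rV (fun x => \1_B' x * `|u x|).
Proof.
have nB : bounded_support (\1_B : 'rV[R]_d -> R).
  by apply: (@bounded_support_indic _ _ _ M0) => // x /BsubB' /B'M.
have nB' : bounded_support (\1_B' : 'rV[R]_d -> R) by exact: bounded_support_indic B'M.
have bau : locally_bounded (fun x => `|u x|) by exact: locally_bounded_norm.
have step n : integral_rV (fun x => \1_B x * cap_pos (p x)) <=
    16 * M * integral_rV (fun x => \1_B' x * `|u x|) + s n ^+ 2 * integral_rV \1_B.
  have n1 k : bounded_support (fun x => (e k x)%:R * `|u (x + r k *: v)|).
    by apply: bounded_supportMr => //; exact: locally_bounded_shift bau.
  have n2 k : bounded_support (fun x => (e k x)%:R * `|u x|) by exact: bounded_supportMr.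
  have n3 k : bounded_support (fun x => (e k (x - r k *: v))%:R * `|u x|).
    by apply: bounded_supportMr => //; exact: (bounded_support_shift (- (r k *: v)) (bounded_support_e k)).
  have n4 := @bounded_support_sum R d _ (index_enum 'I_n.+1) xpredT _ (fun k _ => n1 k).
  have n5 := @bounded_support_sum R d _ (index_enum 'I_n.+1) xpredT _ (fun k _ => n2 k).
  have n6 := @bounded_support_sum R d _ (index_enum 'I_n.+1) xpredT _ (fun k _ => n3 k).
  have n7 : bounded_support (fun x => \1_B' x * `|u x|) by exact: bounded_supportMr.
  have h : integral_rV (fun x => \1_B x * cap_pos (p x)) <=
      integral_rV (fun x => 4 * M * (\sum_(k < n.+1) (e k x)%:R * `|u (x + r k *: v)| +
        \sum_(k < n.+1) (e k x)%:R * `|u x|) + s n ^+ 2 * \1_B x).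
    apply: ler_integral_rV.
    - by apply: bounded_supportMr => //; exact: locally_bounded_cap_pos.
    - by apply: bounded_supportD; [apply: bounded_supportZ; exact: bounded_supportD|exact: bounded_supportZ].
    move=> x; have M4 : 0 <= 4 * M by rewrite mulr_ge0// ltW.
    have sum0 (F : nat -> R) : (forall k, 0 <= F k) -> 0 <= \sum_(k < n.+1) (e k x)%:R * F k.
      by move=> F0; apply: sumr_ge0 => k _; rewrite mulr_ge0.
    have sum00 : 0 <= 4 * M * (\sum_(k < n.+1) (e k x)%:R * `|u (x + r k *: v)| +
        \sum_(k < n.+1) (e k x)%:R * `|u x|).
      by rewrite mulr_ge0// addr_ge0//; [apply: (sum0 (fun k => `|u (x + r k *: v)|))|
        apply: (sum0 (fun=> `|u x|))].
    have [Bx|nBx] := pselect (B x); last first.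
      by rewrite indicE memNset// mul0r mulr0 addr0.
    rewrite indicE mem_set// mul1r mulr1.
    have [sp|ps] := ltP (s n) (p x); last first.
      apply: (@le_trans _ _ (s n ^+ 2)).
        have [p0|p0] := leP 0 (p x); last by rewrite (cap_pos0 (ltW p0)) sqr_ge0.
        apply: le_trans (cap_pos_le_sq _) _.
        by rewrite ler_sqr// nnegrE// ltW.
      by rewrite lerDr.
    have [k kn ek] := e_cover Bx sp.
    apply: le_trans (e_bound ek) _;
      apply: (@le_trans _ _ (4 * M * (\sum_(k < n.+1) (e k x)%:R * `|u (x + r k *: v)| +
        \sum_(k < n.+1) (e k x)%:R * `|u x|))); last by rewrite lerDl exprn_ge0// ltW.
    rewrite ler_wpM2l// lerD//.
      rewrite (bigD1 (Ordinal kn))//= ek mul1r lerDl sumr_ge0// => i _; by rewrite mulr_ge0.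
    rewrite (bigD1 (Ordinal kn))//= ek mul1r lerDl sumr_ge0// => i _; by rewrite mulr_ge0.
  apply: (le_trans h); rewrite integral_rVD; [|by apply: bounded_supportZ;
    exact: bounded_supportD|exact: bounded_supportZ].
  rewrite !integral_rVZ//; last exact: bounded_supportD.
  rewrite lerD2r integral_rVD// (_ : 16 * M = 4 * M * (2 + 2)); last by ring.
  rewrite -[leRHS]mulrA ler_wpM2l ?mulr_ge0 ?(ltW M_gt0)// mulrDl.
  have count (F : nat -> 'rV[R]_d -> bool) :
      (forall k, bounded_support (fun x => (F k x)%:R * `|u x|)) ->
      (forall k x, F k x -> B' x) ->
      (forall x k l, (k < l)%N -> F k x -> F l x -> l = k.+1) ->
      integral_rV (fun x => \sum_(k < n.+1) (F k x)%:R * `|u x|) <=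
        2 * integral_rV (fun x => \1_B' x * `|u x|).
    move=> nF FB' Fadj; rewrite -integral_rVZ//; apply: ler_integral_rV; [|exact: bounded_supportZ|].
      by apply: bounded_support_sum.
    move=> x; rewrite -mulr_suml mulrA ler_wpM2r// indicE.
    have [B'x|nB'x] := boolP (x \in B').
      rewrite mulr1 -natr_sum ler_nat; apply: (sum_adjacent_le2 (P := fun k => F k x)) => k l; exact: Fadj.
    rewrite mulr0 big1// => i _; case E : (F i x) => //.
    by move/FB' : E => /mem_set E; rewrite E in nB'x.
  apply: lerD.
    have -> : integral_rV (fun x => \sum_(k < n.+1) (e k x)%:R * `|u (x + r k *: v)|) =
        integral_rV (fun x => \sum_(k < n.+1) (e k (x - r k *: v))%:R * `|u x|).
      rewrite !integral_rV_sum//; apply: eq_bigr => k _.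
      rewrite -[RHS](integral_rV_shift (r k *: v))//; congr integral_rV; apply/funext => x.
      by rewrite addrK.
    apply: (count (fun k x => e k (x - r k *: v))) => //.
    move=> k x /e_B Bx; rewrite -[x](subrK (r k *: v)); apply: BB' => //.
    by rewrite gtr0_norm.
  (* The untranslated level sets are pairwise disjoint, so the adjacency condition holds
     vacuously. *)
  apply: count => //; first by move=> k x /e_B/BsubB'.
  move=> x k l kl /and3P[_ sk _]; case: l kl => // l kl /and3P[_ _ ps].
  by exfalso; have := s_le (kl : (k <= l)%N); lra.
have I0 : 0 <= integral_rV (\1_B : 'rV[R]_d -> R) by apply: integral_rV_ge0 => x; rewrite indicE.
apply/ler_addgt0Pl => a a0.
pose c := integral_rV (\1_B : 'rV[R]_d -> R) + 1.
have c0 : 0 < c by rewrite /c; lra.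
have [n nac] : exists n, s n < a / c.
  have ac : 0 < a / c by rewrite divr_gt0.
  have : geometric 1 (2^-1 : R) @ \oo --> 0 by apply: cvg_geometric; rewrite ger0_norm; lra.
  move=> /cvgrPdist_lt /(_ _ ac)[n _ /(_ n (leqnn n))].
  by rewrite /geometric /= mul1r sub0r normrN gtr0_norm// => ?; exists n.
apply: le_trans (step n) _; rewrite addrC lerD2r.
have s0 := s_gt0 n; have s1 := s_le1 n.
apply: (@le_trans _ _ (s n * c)).
  rewrite expr2 -mulrA ler_pM2l//.
  by have := ler_wpM2r I0 s1; rewrite /c; lra.
by rewrite -ler_pdivlMr// ltW.
Qed.

End dyadic.
End quadratic.

(** * Integration against the image of a measure with density *)

Section weighted_image.
Local Open Scope ereal_scope.
Context d1 d2 (T : measurableType d1) (T' : measurableType d2) (R : realType).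
Variables (m : {measure set T -> \bar R}) (m1 : {measure set T' -> \bar R}).
Variables (X : T -> T') (F : T -> R).
Hypotheses (mX : measurable_fun setT X) (mF : measurable_fun setT F).
Hypothesis F0 : forall x, (0 <= F x)%R.
Hypothesis m1E : forall A, measurable A -> m1 A = \int[m]_(x in X @^-1` A) (F x)%:E.

Import HBNNSimple.

Let mpre A : measurable A -> measurable (X @^-1` A).
Proof. by move=> mA; rewrite -[X in measurable X]setTI; exact: mX. Qed.

Let indic_case A : measurable A ->
  \int[m1]_x (\1_A x)%:E = \int[m]_x ((\1_A (X x))%:E * (F x)%:E).
Proof.
move=> mA; rewrite integral_indic// setIT m1E// integral_mkcond.
apply: eq_integral => x _; rewrite patchE indicE.
have -> : (x \in X @^-1` A) = (X x \in A) by apply/idP/idP => /set_mem ?; exact/mem_set.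
by case: ifP => _; rewrite ?mul1e ?mul0e.
Qed.

Let nnsfun_case (f : {nnsfun T' >-> R}) :
  \int[m1]_x (f x)%:E = \int[m]_x ((f (X x))%:E * (F x)%:E).
Proof.
under [LHS]eq_integral do rewrite fimfunE -fsumEFin//.
rewrite [LHS]ge0_integral_fsum//; last 2 first.
  - by move=> r; exact/measurable_EFinP/measurableT_comp.
  - by move=> n x _; rewrite EFinM nnfun_muleindic_ge0.
under [RHS]eq_integral.
  move=> x _; rewrite fimfunE -fsumEFin// muleC ge0_mule_fsumr; last first.
    by move=> r; rewrite EFinM nnfun_muleindic_ge0.
  over.
rewrite [RHS]ge0_integral_fsum//; last 2 first.
  - move=> r; apply: emeasurable_funM; first exact/measurable_EFinP.
    apply/measurable_EFinP; apply: measurable_funM => //.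
    by apply: measurableT_comp => //; exact: measurable_indic.
  - move=> n x _; rewrite mule_ge0//; first by rewrite lee_fin.
    by rewrite EFinM nnfun_muleindic_ge0.
apply: eq_fsbigr => r _.
rewrite integralZl_indic_nnsfun// indic_case//.
have [r0|r0] := leP 0%R r; last first.
  have -> : f @^-1` [set r] = set0 by rewrite preimage_nnfun0.
  under eq_integral do rewrite indic0 mul0e.
  rewrite integral0 mule0; under eq_integral do rewrite indic0 mulr0 mule0.
  by rewrite integral0.
under [RHS]eq_integral do rewrite EFinM muleCA [(F _)%:E * _]muleC.
rewrite ge0_integralZl//.
- apply: emeasurable_funM; last exact/measurable_EFinP.
  by apply/measurable_EFinP; apply: measurableT_comp => //; exact: measurable_indic.
- by move=> x _; rewrite mule_ge0// lee_fin.
Qed.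

(** From indicators to simple functions to monotone limits. With X the identity it turns integrals
    against mu into Lebesgue integrals weighted by the density. *)
Lemma ge0_integral_weighted_image (f : T' -> \bar R) :
  measurable_fun setT f -> (forall x, 0 <= f x) ->
  \int[m1]_x f x = \int[m]_x (f (X x) * (F x)%:E).
Proof.
move=> mf f0.
pose f_ := nnsfun_approx measurableT mf.
transitivity (lim (\int[m1]_x (f_ n x)%:E @[n --> \oo])).
  rewrite -monotone_convergence//=.
  - apply: eq_integral => ? /[!inE] xD; apply/esym/cvg_lim => //=.
    exact: cvg_nnsfun_approx.
  - by move=> n; exact/measurable_EFinP/measurable_funTS.
  - by move=> n ? _; rewrite lee_fin.
  - by move=> ? _ ? ? mn; rewrite lee_fin; exact/lefP/nd_nnsfun_approx.
transitivity (lim (\int[m]_x ((f_ n (X x))%:E * (F x)%:E) @[n --> \oo])).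
  by apply: congr_lim; apply/funext => n; exact: nnsfun_case.
rewrite -monotone_convergence//=.
- apply: eq_integral => x _; apply/cvg_lim => //=; apply: cvgeZr => //.
  exact: cvg_nnsfun_approx.
- move=> n; apply: emeasurable_funM; apply/measurable_EFinP => //.
  exact: measurableT_comp.
- by move=> n x _; rewrite mule_ge0// lee_fin.
- move=> x _ a b ab; rewrite lee_wpmul2r ?lee_fin//; exact/lefP/nd_nnsfun_approx.
Qed.

End weighted_image.

(** * The two-sided capped estimate along one direction *)

Section cap_estimate.
Context {R : realType} {d : nat}.
Local Notation m := (lebesgue_rV R d).
Variables (B B' : set 'rV[R]_d) (v : 'rV[R]_d) (u p : 'rV[R]_d -> R) (M0 Lam del M : R).
Hypotheses (mB : measurable B) (mB' : measurable B') (B'M : forall x, B' x -> `|x| <= M0).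
Hypotheses (del0 : 0 < del) (Lam0 : 0 <= Lam).
Hypothesis BB' : forall x t, B x -> `|t| <= del -> B' (x + t *: v).
Hypotheses (bu : locally_bounded u) (bp : locally_bounded p).
Hypothesis up : forall x t, B x -> `|t| <= del -> u x + t * p x - Lam * t ^+ 2 <= u (x + t *: v).
Hypotheses (M_gt0 : 0 < M) (LamM : 4 * Lam <= M) (Mdel : 1 <= M * del).

Lemma locally_bounded_cap (f : 'rV[R]_d -> R) : locally_bounded f -> locally_bounded (fun x => cap (f x)).
Proof.
move=> bf; under eq_fun do rewrite cap_posE.
apply: locally_boundedD; apply: locally_bounded_cap_pos => //.
exact: locally_boundedN.
Qed.

(** The one-sided estimate is applied along v with p and along - v with - p; both satisfy the same
    Taylor bound. *)
Lemma cap_estimate :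
  integral_rV (fun x => \1_B x * cap (p x)) <= 32 * M * integral_rV (fun x => \1_B' x * `|u x|).
Proof.
have nB : bounded_support (\1_B : 'rV[R]_d -> R).
  apply: (@bounded_support_indic _ _ _ M0) => // x Bx; apply: B'M.
  by have := @BB' x 0 Bx; rewrite normr0 scale0r addr0; apply; exact: ltW.
have bnp := locally_boundedN bp.
have h1 := cap_pos_estimate mB mB' B'M del0 Lam0 BB' bu bp up M_gt0 LamM Mdel.
have BB'2 x t : B x -> `|t| <= del -> B' (x + t *: - v).
  by move=> Bx td; rewrite scalerN -scaleNr; apply: BB' => //; rewrite normrN.
have up2 x t : B x -> `|t| <= del -> u x + t * (- p x) - Lam * t ^+ 2 <= u (x + t *: - v).
  move=> Bx td; rewrite scalerN -scaleNr; have := @up x (- t) Bx.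
  by rewrite normrN sqrrN mulNr -mulrN; exact.
have h2 := cap_pos_estimate mB mB' B'M del0 Lam0 BB'2 bu bnp up2 M_gt0 LamM Mdel.
rewrite (_ : (fun x => _) = fun x => \1_B x * cap_pos (p x) + \1_B x * cap_pos (- p x)); last first.
  by apply/funext => x; rewrite cap_posE mulrDr.
rewrite integral_rVD; last 2 first.
- by apply: bounded_supportMr => //; exact: locally_bounded_cap_pos.
- by apply: bounded_supportMr => //; exact: locally_bounded_cap_pos.
rewrite (_ : 32 * M = 16 * M + 16 * M); last by ring.
by rewrite mulrDl lerD.
Qed.

End cap_estimate.

(** * Local stability of the gradient *)

Section quartic_test_function.
Context {R : realType} {d : nat}.
Implicit Types (y : 'rV[R]_d).

Definition quad_bump (r : R) (y0 y : 'rV[R]_d) : R := Num.max 0 (r ^+ 2 - sqnorm (y - y0)).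

Lemma sqnorm_ge0 y : 0 <= sqnorm y.
Proof. by apply: sumr_ge0 => i _; exact: sqr_ge0. Qed.

Lemma coord_sq_le_sqnorm y (i : 'I_d) : y 0 i ^+ 2 <= sqnorm y.
Proof. by rewrite /sqnorm (bigD1 i)//= lerDl; apply: sumr_ge0 => j _; exact: sqr_ge0. Qed.

Lemma quad_bump_ge0 r y0 y : 0 <= quad_bump r y0 y.
Proof. by rewrite le_max lexx. Qed.

Lemma quad_bump_le r y0 y : quad_bump r y0 y <= r ^+ 2.
Proof. by rewrite ge_max sqr_ge0 gerBl sqnorm_ge0. Qed.

Lemma cap_small (a : R) : `|a| <= 1 -> cap a = a ^+ 2.
Proof.
move=> a1; rewrite /cap min_r// -real_normK ?num_real// expr2.
by rewrite ler_piMl.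
Qed.

Lemma cap_large (a : R) : 1 <= `|a| -> cap a = `|a|.
Proof.
move=> a1; rewrite /cap min_l// -[X in _ <= X]real_normK ?num_real// expr2.
by rewrite ler_peMl// (le_trans _ a1).
Qed.

Lemma cap_ge0 (a : R) : 0 <= cap a.
Proof. by rewrite /cap le_min normr_ge0 sqr_ge0. Qed.

(** The first summand is the quadratic coefficient when all displacements are at most 1. The others
    pay, when one exceeds 1, for the oscillation r^4 and for the d linear terms, each with a
    coefficient bounded by 4 r^3. *)
Definition quad_cst (r : R) : R := 2 * r ^+ 2 + r ^+ 4 + (d%:R + 1) * (4 * r ^+ 3).

(* One-sided Taylor bound: max(0,.)^2 is convex and nondecreasing and r^2 - |.|^2 is a
   concave quadratic, so the squared bump is semiconvex. *)
Lemma quad_bump_taylor r y0 y y' : 0 <= r ->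
  quad_bump r y0 y ^+ 2 - quad_bump r y0 y' ^+ 2 <=
  \sum_j (4 * quad_bump r y0 y * (y 0 j - y0 0 j) * (y' 0 j - y 0 j) +
    quad_cst r * cap (y' 0 j - y 0 j)).
Proof.
move=> r0; set b := quad_bump r y0 y; pose p j := y' 0 j - y 0 j.
have b0 : 0 <= b by exact: quad_bump_ge0.
have br : b <= r ^+ 2 by exact: quad_bump_le.
have V0 : 0 <= 4 * r ^+ 3 by rewrite mulr_ge0// exprn_ge0.
have r20 : 0 <= r ^+ 2 by exact: sqr_ge0.
have r40 : 0 <= r ^+ 4 by rewrite exprn_ge0.
have d0 : 0 <= d%:R :> R by rewrite ler0n.
have dV : 0 <= d%:R * (4 * r ^+ 3) by exact: mulr_ge0.
have C0 : 0 <= quad_cst r by rewrite /quad_cst; lra.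
have [small|large] := pselect (forall j, `|p j| <= 1).
  apply: (@le_trans _ _ (\sum_j (4 * b * (y 0 j - y0 0 j) * p j + 2 * b * p j ^+ 2))); last first.
    apply: ler_sum => j _; rewrite lerD2l cap_small; last exact: small.
    rewrite ler_wpM2r ?sqr_ge0// /quad_cst; lra.
  (* The sum recombines exactly into the tangent of max(0, .)^2 at A, evaluated in the direction A -
     A'. *)
  have -> : \sum_j (4 * b * (y 0 j - y0 0 j) * p j + 2 * b * p j ^+ 2) =
      2 * b * (sqnorm (y' - y0) - sqnorm (y - y0)).
    rewrite /sqnorm -sumrB mulr_sumr; apply: eq_bigr => j _.
    by rewrite !mxE /p; ring.
  rewrite /b /quad_bump in b0 br *; set A := r ^+ 2 - sqnorm (y - y0) in b0 br *.
  set A' := r ^+ 2 - sqnorm (y' - y0).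
  have -> : sqnorm (y' - y0) - sqnorm (y - y0) = A - A' by rewrite /A /A'; ring.
  have [A0|A0] := leP 0 A; last first.
    by rewrite expr0n/= mulr0 mul0r sub0r oppr_le0 sqr_ge0.
  have [A'0|A'0] := leP 0 A'.
    by have := sqr_ge0 (A - A'); lra.
  rewrite expr0n/= subr0.
  have : 0 <= A * - A' by rewrite mulr_ge0//; lra.
  have := sqr_ge0 A; lra.
have [j0 pj0] : exists j0, 1 < `|p j0|.
  by apply: contrapT => h; apply: large => j; rewrite leNgt; apply/negP => pj; apply: h; exists j.
(* With a displacement larger than 1 the trivial bound r^4 suffices, since the caps add up to at
   least 1. *)
apply: (@le_trans _ _ (r ^+ 4)).
  rewrite lerBlDr (@le_trans _ _ (r ^+ 4))// ?lerDl ?sqr_ge0//.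
  by rewrite -[4%N]/(2 * 2)%N exprM ler_sqr.
(* The coefficient of p j is at most 4 r^3 because the bump vanishes at distance more than r from
   y0; moreover |p j| <= 1 + cap (p j). *)
have term j : - (4 * r ^+ 3) + (quad_cst r - 4 * r ^+ 3) * cap (p j) <=
    4 * b * (y 0 j - y0 0 j) * p j + quad_cst r * cap (p j).
  rewrite mulrBl addrCA addrC lerD2r.
  have h1 : `|4 * b * (y 0 j - y0 0 j)| <= 4 * r ^+ 3.
    have [b1|b1] := eqVneq b 0; first by rewrite b1 mulr0 mul0r normr0.
    have : `|y 0 j - y0 0 j| <= r.
      have : sqnorm (y - y0) <= r ^+ 2.
        rewrite leNgt; apply/negP => h; move/eqP: b1; apply.
        by rewrite /b /quad_bump max_l//; lra.
      have := coord_sq_le_sqnorm (y - y0) j; rewrite !mxE => h /(le_trans h).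
      by rewrite -[X in X <= _]real_normK ?num_real// ler_sqr ?nnegrE.
    move=> h; rewrite !normrM (ger0_norm b0) ger0_norm// exprSr mulrA.
    by rewrite ler_pM ?mulr_ge0// ler_wpM2l.
  have h2 : `|p j| <= 1 + cap (p j).
    have [p1|p1] := leP (`|p j|) 1; first by have := cap_ge0 (p j); lra.
    by rewrite (cap_large (ltW p1)); lra.
  have := ler_norm (- (4 * b * (y 0 j - y0 0 j) * p j)); rewrite normrN normrM => h3.
  have := ler_pM (normr_ge0 _) (normr_ge0 _) h1 h2; lra.
apply: (@le_trans _ _ (\sum_(j < d) (- (4 * r ^+ 3) + (quad_cst r - 4 * r ^+ 3) * cap (p j)))); last first.
  by apply: ler_sum => j _; exact: term.
rewrite big_split/= sumr_const card_ord -mulr_sumr.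
have CV : 0 <= quad_cst r - 4 * r ^+ 3 by rewrite /quad_cst; lra.
have s1 : 1 <= \sum_(j < d) cap (p j).
  rewrite (bigD1 j0)//= cap_large ?(ltW pj0)//.
  have : 0 <= \sum_(i < d | i != j0) cap (p i) by apply: sumr_ge0 => i _; exact: cap_ge0.
  lra.
have := ler_wpM2l CV s1; rewrite mulr1 -mulr_natl /quad_cst; lra.
Qed.

End quartic_test_function.

(** * Mean value and Taylor bounds along a line *)

Section mean_value_along_axes.
Context {R : realType} {d : nat}.
Implicit Types (f : 'rV[R]_d -> R) (x v : 'rV[R]_d).

Lemma is_derive_line f x v (s : R) : derivable f (x + s *: v) v ->
  is_derive s 1 (fun t : R => f (x + t *: v)) ('D_v f (x + s *: v)).
Proof.
move=> df; have E : (fun h : R => h^-1 *: (f (x + (h *: 1 + s) *: v) - f (x + s *: v))) =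
    (fun h : R => h^-1 *: (f (h *: v + (x + s *: v)) - f (x + s *: v))).
  apply/funext => h; congr (_ *: (f _ - _)).
  by rewrite scalerDl addrCA -[h *: 1]/(h * 1) mulr1.
apply: DeriveDef.
  by rewrite /derivable /= E.
by rewrite /derive /= E.
Qed.

(** Writing the intermediate point as x + (s t) v with s in [0, 1] treats both signs of t, and t =
    0, at once. *)
Lemma mean_value_line f x v (t : R) :
  (forall s, 0 <= s <= 1 -> derivable f (x + (s * t) *: v) v) ->
  exists s, 0 <= s <= 1 /\ f (x + t *: v) - f x = t * 'D_v f (x + (s * t) *: v).
Proof.
move=> df; pose g s := f (x + s *: v).
have seg a b : a < b -> (forall s, a <= s <= b -> derivable f (x + s *: v) v) ->
    exists2 c, a <= c <= b & g b - g a = 'D_v f (x + c *: v) * (b - a).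
  move=> ab abt.
  have dg c : c \in `[a, b] -> is_derive c 1 g ('D_v f (x + c *: v)).
    by rewrite in_itv/= => /abt ct; exact: is_derive_line.
  have dgo c : c \in `]a, b[ -> is_derive c 1 g ('D_v f (x + c *: v)).
    by move=> cab; apply: dg; exact: subset_itv_oo_cc cab.
  have cg : {within `[a, b], continuous g}.
    by apply: derivable_within_continuous => c cab; have [] := dg c cab.
  have [c cab ->] := MVT ab dgo cg.
  by exists c => //; move: cab; rewrite in_itv/= => /andP[/ltW -> /ltW ->].
have [t0|t0|t0] := ltgtP 0 t.
- have [|c /andP[c0 ct]] := seg 0 t t0.
    move=> s /andP[s0 st]; rewrite -[s](divfK (negbT (gt_eqF t0))); apply: df.
    by rewrite divr_ge0 ?(ltW t0)//= ler_pdivrMr// mul1r.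
  rewrite /g scale0r addr0 subr0 => e; exists (c / t).
  split; first by rewrite divr_ge0 ?(ltW t0)//= ler_pdivrMr// mul1r.
  by rewrite divfK ?gt_eqF// e mulrC.
- have [|c /andP[tc c0]] := seg t 0 t0.
    move=> s /andP[st s0]; rewrite -[s](divfK (negbT (lt_eqF t0))); apply: df.
    by rewrite mulr_le0 ?invr_le0 ?(ltW t0)//= ler_ndivrMr// mul1r.
  rewrite /g scale0r addr0 sub0r => e; exists (c / t).
  split; first by rewrite mulr_le0 ?invr_le0 ?(ltW t0)//= ler_ndivrMr// mul1r.
  by rewrite divfK ?lt_eqF// -opprB e; ring.
- by exists 0; rewrite lexx ler01 -t0 mul0r !scale0r !addr0 subrr.
Qed.

Lemma ball_line (c x v : 'rV[R]_d) (e s t : R) : ball c e x -> ball c e (x + t *: v) ->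
  (0 <= s <= 1) -> ball c e (x + (s * t) *: v).
Proof.
rewrite !ball_rVE => h1 h2 /andP[s0 s1].
have -> : c - (x + (s * t) *: v) = (1 - s) *: (c - x) + s *: (c - (x + t *: v)).
  by apply/rowP => i; rewrite !mxE; ring.
apply: le_lt_trans (ler_normD _ _) _; rewrite !normrZ !ger0_norm//; last by lra.
have [->|sn0] := eqVneq s 0; first by rewrite subr0 mul1r mul0r addr0.
have sp : 0 < s by rewrite lt_neqAle eq_sym sn0.
have a1 : (1 - s) * `|c - x| <= (1 - s) * e by rewrite ler_wpM2l ?(ltW h1)//; lra.
have a2 : s * `|c - (x + t *: v)| < s * e by rewrite ltr_pM2l.
lra.
Qed.

Lemma mean_value_ball f c x v (e C t : R) : ball c e x -> ball c e (x + t *: v) ->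
  (forall y, ball c e y -> derivable f y v) -> (forall y, ball c e y -> `|'D_v f y| <= C) ->
  `|f (x + t *: v) - f x| <= C * `|t|.
Proof.
move=> cx cy df fC.
have [s s01|s [s01 ->]] := @mean_value_line f x v t; first by apply: df; exact: ball_line.
by rewrite normrM mulrC ler_wpM2r// fC//; exact: ball_line.
Qed.

(** The mean value theorem applied to f, then to its derivative; this costs C where a Taylor formula
    would give C / 2. *)
Lemma semiconcave_ball f c x v (e C t : R) : ball c e x -> ball c e (x + t *: v) ->
  (forall y, ball c e y -> derivable f y v) ->
  (forall y, ball c e y -> derivable ('D_v f) y v) ->
  (forall y, ball c e y -> `|'D_v ('D_v f) y| <= C) ->
  f (x + t *: v) <= f x + t * 'D_v f x + C * t ^+ 2.
Proof.
move=> cx cy df ddf fC.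
have C0 : 0 <= C by apply: le_trans (fC _ cx).
have [s s01|s [/[dup] s01 /andP[s0 s1] e1]] := @mean_value_line f x v t.
  by apply: df; exact: ball_line.
have := mean_value_ball cx (ball_line cx cy s01) ddf fC.
rewrite normrM (ger0_norm s0) => h.
rewrite -lerBlDl opprD addrA e1 -mulrBr.
apply: (le_trans (ler_norm _)); rewrite normrM -real_normK ?num_real// expr2 mulrCA.
rewrite ler_wpM2l//; apply: (le_trans h); rewrite ler_wpM2l//.
by rewrite ler_piMl.
Qed.

End mean_value_along_axes.

(** * Local bounds from Hoelder classes *)

Section holder_class_theory.
Context {R : realType} {d : nat}.
Implicit Types (f : 'rV[R]_d -> R) (U : set 'rV[R]_d).

Lemma holder_class_continuous k (alpha : R) U f s : holder_class k alpha U f -> open U ->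
  (size s <= k)%N -> {in U, continuous (partials s f)}.
Proof.
move=> [_ /(_ s) fc _] oU /fc[g gc gf].
have : {in U, continuous g}.
  rewrite -continuous_open_subspace//; apply: continuous_subspaceW gc.
  exact: subset_closure.
move=> cg x xU; have := cg x xU; move: xU; rewrite inE => xU cgx A.
rewrite gf ?inE// => /cgx /nbhs_ballP[e1 /= e10 h1].
have /nbhs_ballP[e2 /= e20 h2] : nbhs x U by exact: open_nbhs_nbhs.
apply/nbhs_ballP; exists (Num.min e1 e2); first by rewrite /= lt_min e10 e20.
move=> y; rewrite ball_rVE lt_min => /andP[y1 y2] /=; rewrite gf ?inE.
  by apply: h1; rewrite ball_rVE.
by apply: h2; rewrite ball_rVE.
Qed.

Lemma holder_class_near_bounded k (alpha : R) U f s x : holder_class k alpha U f -> open U ->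
  (size s <= k)%N -> U x ->
  exists e C : R, 0 < e /\ forall y, ball x e y -> `|partials s f y| <= C.
Proof.
move=> hf oU sk Ux.
have := holder_class_continuous hf oU sk (mem_set Ux).
have b1 : nbhs (partials s f x) (ball (partials s f x) 1) by exact: nbhsx_ballx.
move=> /(_ _ b1) /nbhs_ballP[e /= e0 he].
exists e, (`|partials s f x| + 1); split => // y /he; rewrite /= /ball/= => h.
have := ler_normB (partials s f x) (partials s f x - partials s f y).
rewrite opprB addrC subrK; lra.
Qed.

Lemma min_radius n (e : 'I_n -> R) : (forall i, 0 < e i) ->
  exists2 r, 0 < r & forall i, r <= e i.
Proof.
elim: n e => [|n IH] e e0; first by exists 1 => // -[].
have [r r0 hr] := IH (fun i => e (lift ord0 i)) (fun i => e0 _).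
exists (Num.min r (e ord0)); first by rewrite lt_min r0 e0.
move=> i; have [j ->|->] := unliftP ord0 i; last by rewrite ge_min lexx orbT.
by rewrite ge_min hr.
Qed.

Lemma max_bound n (C : 'I_n -> R) : exists2 D, 0 <= D & forall i, C i <= D.
Proof.
exists (\sum_i `|C i|); first exact: sumr_ge0.
move=> i; rewrite (bigD1 i)//= (le_trans (ler_norm _))// lerDl.
exact: sumr_ge0.
Qed.

(** One radius and one constant for finitely many indices. The monotonicity assumption allows all
    constants to be enlarged to a common one; a nested use covers pairs of indices. *)
Lemma uniformize_ball n (x : 'rV[R]_d) (P : 'I_n -> R -> 'rV[R]_d -> Prop) :
  (forall i C D y, C <= D -> P i C y -> P i D y) ->
  (forall i, exists e C : R, 0 < e /\ forall y, ball x e y -> P i C y) ->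
  exists e C : R, [/\ 0 < e, 0 <= C & forall i y, ball x e y -> P i C y].
Proof.
move=> Pm /choice[e /choice[C eC]].
have [r r0 re] := min_radius (fun i => (eC i).1).
have [D D0 CD] := max_bound C.
exists r, D; split => // i y; rewrite ball_rVE => xy; apply: (Pm i (C i)) => //.
by apply: (eC i).2; rewrite ball_rVE; exact: lt_le_trans (re i).
Qed.

End holder_class_theory.

Section axis_lipschitz.
Context {R : realType} {d : nat}.
Variables (A : set 'rV[R]_d) (v : 'rV[R]_d).
Implicit Types f g : 'rV[R]_d -> R.

(** The bound on f is part of the notion so that products stay in the class. Only increments along v
    are compared, as in the integration by parts. *)
Definition axis_lipschitz f := exists C : R,
  (forall x, A x -> `|f x| <= C) /\
  (forall x t, A x -> A (x + t *: v) -> `|f (x + t *: v) - f x| <= C * `|t|).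

Lemma axis_lipschitz_cst (c : R) : axis_lipschitz (fun=> c).
Proof.
exists `|c|; split => // x t _ _.
by rewrite subrr normr0 mulr_ge0.
Qed.

Lemma axis_lipschitz_weaken f (C D : R) : (forall x, A x -> `|f x| <= C) ->
  (forall x t, A x -> A (x + t *: v) -> `|f (x + t *: v) - f x| <= D * `|t|) ->
  axis_lipschitz f.
Proof.
move=> fC fD; exists (Num.max C D); split => [x /fC|x t Ax Axt].
  by move/le_trans; apply; rewrite le_max lexx.
apply: (le_trans (fD _ _ Ax Axt)); rewrite ler_wpM2r//.
by rewrite le_max lexx orbT.
Qed.

Lemma axis_lipschitzD f g : axis_lipschitz f -> axis_lipschitz g ->
  axis_lipschitz (fun x => f x + g x).
Proof.
move=> [C [fC fL]] [D [gD gL]]; exists (C + D); split => [x Ax|x t Ax Axt].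
  by rewrite (le_trans (ler_normD _ _))// lerD ?fC ?gD.
rewrite opprD addrACA (le_trans (ler_normD _ _))// mulrDl.
by rewrite lerD ?fL ?gL.
Qed.

Lemma axis_lipschitzM f g : axis_lipschitz f -> axis_lipschitz g ->
  axis_lipschitz (fun x => f x * g x).
Proof.
move=> [C [fC fL]] [D [gD gL]].
apply: (@axis_lipschitz_weaken _ (C * D) (2 * (C * D))) => [x Ax|x t Ax Axt].
  by rewrite normrM ler_pM ?fC ?gD.
have -> : f (x + t *: v) * g (x + t *: v) - f x * g x =
  (f (x + t *: v) - f x) * g (x + t *: v) + f x * (g (x + t *: v) - g x) by ring.
rewrite (le_trans (ler_normD _ _))// !normrM.
have h1 := ler_pM (normr_ge0 _) (normr_ge0 _) (fL _ _ Ax Axt) (gD _ Axt).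
have h2 := ler_pM (normr_ge0 _) (normr_ge0 _) (fC _ Ax) (gL _ _ Ax Axt).
lra.
Qed.

Lemma axis_lipschitzN f : axis_lipschitz f -> axis_lipschitz (fun x => - f x).
Proof.
move=> [C [fC fL]]; exists C; split => [x Ax|x t Ax Axt]; first by rewrite normrN fC.
by rewrite -opprD normrN fL.
Qed.

Lemma axis_lipschitz_max0 f : axis_lipschitz f -> axis_lipschitz (fun x => Num.max 0 (f x)).
Proof.
move=> [C [fC fL]]; exists C; split => [x Ax|x t Ax Axt].
  have := fC _ Ax; have := max0_lipschitz (f x) 0; rewrite maxxx !subr0.
  exact: le_trans.
by apply: le_trans (max0_lipschitz _ _) _; exact: fL.
Qed.

Lemma axis_lipschitz_sum n (F : 'I_n -> 'rV[R]_d -> R) :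
  (forall i, axis_lipschitz (F i)) -> axis_lipschitz (fun x => \sum_i F i x).
Proof.
elim: n F => [|n IH] F lF.
  by under eq_fun do rewrite big_ord0; exact: axis_lipschitz_cst.
under eq_fun do rewrite big_ord_recr.
by apply: axis_lipschitzD => //; exact: IH.
Qed.

End axis_lipschitz.

(** * The stability inequality on a ball *)

Section local_stability.
Context {R : realType} {d : nat}.
Variables (d_gt0 : (0 < d)%N) (phi rho : 'rV[R]_d -> R) (x0 : 'rV[R]_d) (del Lam r : R).
Local Notation B := (ball x0 del).
Local Notation B' := (ball x0 (2 * del)).

(* One-sided derivatives everywhere: they coincide with the partial derivatives almost
   everywhere and are subgradients without exception. *)
Definition grad_plus (f : 'rV[R]_d -> R) (x : 'rV[R]_d) : 'rV[R]_d := \row_i dplus f 'e_i x.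

Local Notation G := (grad_plus phi).
Local Notation h := (fun y => quad_bump r (G x0) y ^+ 2).

Hypothesis phi_convex : convex_function setT phi.
Hypotheses (del_gt0 : 0 < del) (Lam_ge0 : 0 <= Lam) (r_ge0 : 0 <= r).
Hypothesis phi_semiconcave : forall i x t, B' x -> B' (x + t *: 'e_i) ->
  phi (x + t *: 'e_i) <= phi x + t * dplus phi 'e_i x + Lam * t ^+ 2.

Let measurable_B : measurable B.
Proof. by apply: open_measurable_rV; exact: ball_open. Qed.

Let measurable_B' : measurable B'.
Proof. by apply: open_measurable_rV; apply: ball_open; lra. Qed.

Let B'_bounded x : B' x -> `|x| <= `|x0| + 2 * del.
Proof. by rewrite ball_rVE => hx; have := ler_normB x0 (x0 - x); rewrite opprB addrC subrK; lra. Qed.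

Let B_line i x t : B x -> `|t| <= del -> B' (x + t *: 'e_i).
Proof.
rewrite !ball_rVE opprD addrA => xB td; apply: le_lt_trans (ler_normB _ _) _.
rewrite normrZ; have := norm_delta_le (R := R) i; move=> e1.
have : `|t| * `|'e_i : 'rV[R]_d| <= `|t| by rewrite ler_piMr.
lra.
Qed.

Let B_subB' : B `<=` B'.
Proof. by move=> x; rewrite !ball_rVE; move: del_gt0; lra. Qed.

Let bounded_support_B : bounded_support (\1_B : 'rV[R]_d -> R).
Proof. exact: (bounded_support_indic measurable_B (fun x Bx => B'_bounded (B_subB' Bx))). Qed.

Let bounded_support_B' : bounded_support (\1_B' : 'rV[R]_d -> R).
Proof. exact: (bounded_support_indic measurable_B' B'_bounded). Qed.

Section perturbation.
Variables (f : 'rV[R]_d -> R) (a : R).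
Hypothesis f_convex : convex_function setT f.

Let u x := f x - phi x - a.
Let p j x := dplus f 'e_j x - dplus phi 'e_j x.

Let bu : locally_bounded u.
Proof.
apply: locally_boundedB; last exact: locally_bounded_cst.
by apply: locally_boundedB; apply: locally_bounded_continuous; exact: convex_continuous.
Qed.

Let bp j : locally_bounded (p j).
Proof. by apply: locally_boundedB; exact: locally_bounded_dplus. Qed.

(** The subgradient inequality for f minus the semiconcavity of phi: no regularity of f enters. *)
Let up j x t : B x -> `|t| <= del -> u x + t * p j x - Lam * t ^+ 2 <= u (x + t *: 'e_j).
Proof.
move=> Bx td; rewrite /u /p.
have := dplus_subgradient 'e_j x t f_convex.
have := phi_semiconcave (B_subB' Bx) (B_line j Bx td).
lra.
Qed.

(** The constant 4 Lam + 1 / del meets both requirements on M in [cap_estimate]: at least 4 Lam, and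
    at least 1 after multiplication by del. *)
Lemma gradient_cap_estimate j :
  integral_rV (fun x => \1_B x * cap (p j x)) <=
  32 * (4 * Lam + del^-1) * integral_rV (fun x => \1_B' x * `|u x|).
Proof.
have M0 : 0 < 4 * Lam + del^-1 by rewrite ltr_wpDl ?invr_gt0// mulr_ge0.
apply: (cap_estimate measurable_B measurable_B' B'_bounded del_gt0 Lam_ge0 _ bu (bp j)) => //.
- by move=> x t; exact: B_line.
- by move=> x t; exact: up.
- by rewrite lerDl invr_ge0 ltW.
- by rewrite mulrDl mulVf ?gt_eqF// lerDr mulr_ge0// ?mulr_ge0// ltW.
Qed.

Lemma gradient_linear_estimate j W L : locally_bounded W -> (forall x, ~ B x -> W x = 0) ->
  (forall x t, `|t| <= del -> `|W (x + t *: 'e_j) - W x| <= L * `|t|) ->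
  integral_rV (fun x => W x * p j x) <= 2 * L * integral_rV (fun x => \1_B' x * `|u x|).
Proof.
move=> bW W0 WL.
apply: (linear_estimate measurable_B' B'_bounded del_gt0 _ bu (bp j) _ bW W0 WL).
- by move=> x t; exact: B_line.
- by move=> x t; exact: up.
Qed.

End perturbation.

Hypothesis G_lipschitz : forall i j x t, B' x -> B' (x + t *: 'e_j) ->
  `|dplus phi 'e_i (x + t *: 'e_j) - dplus phi 'e_i x| <= Lam * `|t|.
Hypothesis rho_lipschitz : forall j x t, B' x -> B' (x + t *: 'e_j) ->
  `|rho (x + t *: 'e_j) - rho x| <= Lam * `|t|.
Hypothesis rho_bounded : forall x, B' x -> 0 <= rho x <= Lam.
Hypothesis rho_measurable : measurable_fun setT (fun x => \1_B x * rho x).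
Hypothesis h_support : forall x, B' x -> ~ B x -> quad_bump r (G x0) (G x) = 0.

Lemma locally_bounded_bump f y0 : convex_function setT f ->
  locally_bounded (fun x => quad_bump r y0 (grad_plus f x)).
Proof.
move=> cf; apply: locally_bounded_max; first exact: locally_bounded_cst.
apply: locally_boundedB; first exact: locally_bounded_cst.
apply: locally_bounded_sum => i _.
under eq_fun do rewrite expr2 !mxE.
by apply: locally_boundedM; apply: locally_boundedB;
  [exact: locally_bounded_dplus|exact: locally_bounded_cst|
   exact: locally_bounded_dplus|exact: locally_bounded_cst].
Qed.

Let b x := quad_bump r (G x0) (G x).
Let w j x := rho x * (4 * b x * (dplus phi 'e_j x - dplus phi 'e_j x0)).
Let W j x := \1_B x * rho x * (4 * b x * (dplus phi 'e_j x - dplus phi 'e_j x0)).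

Let lip_G i j : axis_lipschitz B' 'e_j (fun x => dplus phi 'e_i x - dplus phi 'e_i x0).
Proof.
apply: axis_lipschitzD; last exact: axis_lipschitz_cst.
have [_ /(_ (`|x0| + 2 * del))[C hC]] := locally_bounded_dplus 'e_i d_gt0 phi_convex.
apply: (@axis_lipschitz_weaken _ _ _ _ _ C Lam); first by move=> x /B'_bounded; exact: hC.
by move=> x t; exact: G_lipschitz.
Qed.

Let lip_w j : axis_lipschitz B' 'e_j (w j).
Proof.
apply: axis_lipschitzM.
  apply: (@axis_lipschitz_weaken _ _ _ _ _ Lam Lam).
    by move=> x /rho_bounded/andP[r0 rL]; rewrite ger0_norm.
  by move=> x t; exact: rho_lipschitz.
apply: axis_lipschitzM => //; apply: axis_lipschitzM; first exact: axis_lipschitz_cst.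
apply: axis_lipschitz_max0; apply: axis_lipschitzD; first exact: axis_lipschitz_cst.
apply: axis_lipschitzN; apply: axis_lipschitz_sum => i.
by under eq_fun do rewrite expr2 !mxE; exact: axis_lipschitzM.
Qed.

(** The bump vanishes on B' outside B, so the cutoff by B is invisible there and creates no jump at
    the boundary of B. *)
Let W_w j x : B' x -> W j x = w j x.
Proof.
move=> B'x; rewrite /W /w indicE; have [Bx|nBx] := pselect (B x).
  by rewrite mem_set// mul1r.
by rewrite memNset// /b h_support// !mulr0 !mul0r mulr0.
Qed.

(** If one end of the step is in B, the other is in B' and the increment is that of [w j]; otherwise
    both values are 0. *)
Let W_lip j : exists L, forall x t, `|t| <= del -> `|W j (x + t *: 'e_j) - W j x| <= L * `|t|.
Proof.
have [L [_ hL]] := lip_w j; exists L => x t td.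
have W0 y : ~ B y -> W j y = 0 by move=> nBy; rewrite /W indicE memNset// !mul0r.
(* The sign of L is read off the bound for the step from x0 to x0 + del e_j. *)
have L0 : 0 <= L.
  have B'0 : B' x0 by rewrite ball_rVE subrr normr0; have := del_gt0; lra.
  have B0 : B x0 by rewrite ball_rVE subrr normr0.
  have dd : `|del| <= del by rewrite gtr0_norm.
  have := le_trans (normr_ge0 _) (hL x0 del B'0 (B_line j B0 dd)).
  by rewrite pmulr_lge0// gtr0_norm.
have [Bx|nBx] := pselect (B x).
  by rewrite !W_w; [apply: hL|..] => //; [exact: B_subB'|exact: B_line|exact: B_subB'|exact: B_line].
have [Bxt|nBxt] := pselect (B (x + t *: 'e_j)); last by rewrite !W0// subrr normr0 mulr_ge0.
have B'x : B' x.
  by have := @B_line j _ (- t) Bxt; rewrite normrN scaleNr addrK; exact.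
by rewrite !W_w//; [apply: hL => //; exact: B_subB'|exact: B_subB'].
Qed.

Let brho : locally_bounded (fun x => \1_B x * rho x).
Proof.
split=> // M; exists Lam => x _; rewrite indicE.
have [Bx|nBx] := pselect (B x); last by rewrite memNset// mul0r normr0.
rewrite mem_set// mul1r; have /andP[r0 rL] := rho_bounded (B_subB' Bx).
by rewrite ger0_norm.
Qed.

Let bW j : locally_bounded (W j).
Proof.
apply: locally_boundedM; first exact: brho.
apply: locally_boundedM.
  by apply: locally_boundedM; [exact: locally_bounded_cst|exact: locally_bounded_bump].
by apply: locally_boundedB; [exact: locally_bounded_dplus|exact: locally_bounded_cst].
Qed.

(** [quad_bump_taylor] bounds the integrand by the terms W j * p j, integrated with
    [gradient_linear_estimate], and by capped terms, integrated with [gradient_cap_estimate]. The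
    constant depends on neither f nor a. *)
Lemma local_stability : exists C : R, 0 < C /\
  forall f a, convex_function setT f ->
  integral_rV (fun x => \1_B x * rho x * (h (G x) - h (grad_plus f x))) <=
  C * integral_rV (fun x => \1_B' x * `|f x - phi x - a|).
Proof.
have /choice[L hL] := W_lip.
pose K := 32 * (4 * Lam + del^-1).
pose C1 := quad_cst (d := d) r * Lam.
have C10 : 0 <= C1.
  by rewrite mulr_ge0// /quad_cst !addr_ge0 ?mulr_ge0 ?addr_ge0 ?exprn_ge0.
exists (\sum_j (`|2 * L j| + C1 * `|K|) + 1); split.
  rewrite ltr_wpDl//; apply: sumr_ge0 => j _; rewrite addr_ge0// mulr_ge0//.
move=> f a cf; pose u x := f x - phi x - a.
pose p j x := dplus f 'e_j x - dplus phi 'e_j x.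
have bp j : locally_bounded (p j) by apply: locally_boundedB; exact: locally_bounded_dplus.
have nrho : bounded_support (fun x => \1_B x * rho x).
  split=> //; have [_ [M hM]] := bounded_support_B; exists M => x /hM ->; exact: mul0r.
have bh g : convex_function setT g -> locally_bounded (fun x => h (grad_plus g x)).
  by move=> cg; under eq_fun do rewrite expr2; apply: locally_boundedM; exact: locally_bounded_bump.
have nW j : bounded_support (W j).
  split=> //; have [_ [M hM]] := bounded_support_B; exists M => x /hM; rewrite /W => ->; by rewrite !mul0r.
have nc j : bounded_support (fun x => \1_B x * cap (p j x)).
  by apply: bounded_supportMr => //; exact: locally_bounded_cap.
have I0 : 0 <= integral_rV (fun x => \1_B' x * `|u x|).
  by apply: integral_rV_ge0 => x; rewrite mulr_ge0// indicE.
apply: (@le_trans _ _ (integral_rV (fun x => \sum_j (W j x * p j x + C1 * (\1_B x * cap (p j x)))))).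
  apply: ler_integral_rV.
  - by apply: bounded_supportMr => //; apply: locally_boundedB; exact: bh.
  - by apply: bounded_support_sum => j _; apply: bounded_supportD;
      [exact: bounded_supportMr|exact: bounded_supportZ].
  move=> x; have [Bx|nBx] := pselect (B x); last first.
    rewrite /W indicE memNset// !mul0r big1// => j _.
    by rewrite !mul0r mulr0 addr0.
  have /andP[r0 rL] := rho_bounded (B_subB' Bx).
  have := ler_wpM2l r0 (quad_bump_taylor (G x0) (G x) (grad_plus f x) r_ge0).
  rewrite /W indicE mem_set// mul1r => /le_trans; apply.
  rewrite mulr_sumr; apply: ler_sum => j _; rewrite mulrDr !mxE.
  rewrite mul1r /p /b lerD//; first by rewrite !mulrA.
  rewrite mulrA ler_wpM2r ?cap_ge0// /C1 mulrC ler_wpM2l//.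
  by rewrite /quad_cst !addr_ge0 ?mulr_ge0 ?addr_ge0 ?exprn_ge0.
rewrite integral_rV_sum; last by move=> j _; apply: bounded_supportD;
  [exact: bounded_supportMr|exact: bounded_supportZ].
apply: (@le_trans _ _ (\sum_j (`|2 * L j| + C1 * `|K|) * integral_rV (fun x => \1_B' x * `|u x|)));
  last first.
  by rewrite -mulr_suml ler_wpM2r// lerDl.
apply: ler_sum => j _; rewrite integral_rVD; [|exact: bounded_supportMr|exact: bounded_supportZ].
rewrite mulrDl integral_rVZ// lerD//.
  have W0 x : ~ B x -> W j x = 0 by move=> nBx; rewrite /W indicE memNset// !mul0r.
  apply: le_trans (gradient_linear_estimate a cf (bW j) W0 (hL j)) _.
  by rewrite ler_wpM2r// ler_norm.
rewrite -[leRHS]mulrA ler_wpM2l//.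
apply: le_trans (gradient_cap_estimate a cf j) _.
by rewrite ler_wpM2r// ler_norm.
Qed.

End local_stability.

Section sup_balls.
Context {R : realType} {d : nat}.
Implicit Types (x c : 'rV[R]_d).

(** Balls of the sup norm are cubes. *)
Lemma lebesgue_rV_ball c (e : R) : 0 < e ->
  lebesgue_rV R d (ball c e) = ((2 * e) ^+ d)%:E.
Proof.
move=> e0.
have mb i : measurable (ball (c 0 i) e : set R) by apply: open_measurable; exact: ball_open.
rewrite (_ : ball c e = [set v : 'rV[R]_d | forall i, ball (c 0 i) e (v 0 i)]).
  rewrite [LHS](@lebesgue_rV_box R d (fun i => ball (c 0 i) e) mb) (eq_bigr (fun=> (2 * e)%:E)); last first.
    move=> i _; rewrite lebesgue_measure_ball ?ltW//.
    by rewrite mulr_natl.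
  by rewrite prodEFin prodr_const card_ord.
apply/seteqP; split => [v [_ h] i|v h]; first exact: (h 0 i).
by split=> // i j; rewrite (ord1 i); exact: h.
Qed.

Lemma norm_le_sqnorm x : `|x| ^+ 2 <= sqnorm x.
Proof.
have -> : sqnorm x = Num.sqrt (sqnorm x) ^+ 2 by rewrite sqr_sqrtr// sqnorm_ge0.
rewrite ler_sqr ?nnegrE ?sqrtr_ge0//; apply: norm_rV_leP; first exact: sqrtr_ge0.
by move=> i; rewrite -sqrtr_sqr ler_wsqrtr// coord_sq_le_sqnorm.
Qed.

End sup_balls.

(** * Regular points of a smooth strongly convex function *)

Section strong_convexity.
Context {R : realType} {d : nat}.
Variables (d_gt0 : (0 < d)%N) (phi : 'rV[R]_d -> R) (kappa : R).
Hypotheses (kappa_gt0 : 0 < kappa) (phi_sc : strongly_convex kappa phi).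
Implicit Types (x y v : 'rV[R]_d).

Lemma strongly_convex_le x y t : 0 <= t <= 1 ->
  phi (t *: x + (1 - t) *: y) <=
  t * phi x + (1 - t) * phi y - kappa / 2 * (t * (1 - t) * sqnorm (x - y)).
Proof.
move=> t01; have := convex_functionP phi_sc x y t01.
have -> : sqnorm (t *: x + (1 - t) *: y) =
    t * sqnorm x + (1 - t) * sqnorm y - t * (1 - t) * sqnorm (x - y).
  rewrite /sqnorm !mulr_sumr -big_split -sumrB/=; apply: eq_bigr => i _.
  by rewrite !mxE; ring.
lra.
Qed.

Lemma strongly_convex_convex : convex_function setT phi.
Proof.
move=> t x y _ _.
have := @strongly_convex_le x y t%:num.
have t0 : 0 <= t%:num :> R by [].
have t1 : t%:num <= 1 :> R by [].
rewrite t0 t1 => /(_ erefl)/le_trans; apply.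
have : 0 <= kappa / 2 * (t%:num * (1 - t%:num) * sqnorm (x - y)).
  by rewrite !mulr_ge0 ?sqnorm_ge0 ?subr_ge0// ?invr_ge0// ltW.
move=> h; apply: (@le_trans _ _ (t%:num * phi x + (1 - t%:num) * phi y)) => //.
by rewrite gerBl.
Qed.

Definition semiconcave_at x (del Lam : R) := 0 < del /\ forall i t, `|t| <= del ->
  phi (x + t *: 'e_i) <= phi x + t * dplus phi 'e_i x + Lam * t ^+ 2.

(* The difference quotients along - v are reduced by convexity to the axes, the only
   directions in which semiconcavity is assumed. *)
Lemma strongly_convex_gradient x v del Lam : semiconcave_at x del Lam ->
  phi x + \sum_i v 0 i * dplus phi 'e_i x + kappa / 2 * sqnorm v <= phi (x + v).
Proof.
move=> [del0 sc]; have d0 : 0 < d%:R :> R by rewrite ltr0n.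
pose dv := d%:R * (`|v| + 1); have dv0 : 0 < dv.
  by rewrite mulr_gt0// ltr_wpDl.
(* For t <= e the points x - (d t v_i) e_i produced by [convex_axes] stay in the range of the
   semiconcavity bound. *)
pose e := Num.min 1 (del / dv).
have e0 : 0 < e by rewrite lt_min ltr01 divr_gt0.
pose c := Lam * d%:R * sqnorm v + kappa / 2 * sqnorm v.
apply: (@ler_vanishing _ _ _ c e e0) => t t0 te.
have t1 : t <= 1 by apply: le_trans te _; rewrite /e ge_min lexx.
have tdv : t * dv <= del by rewrite -ler_pdivlMr//; apply: le_trans te _; rewrite /e ge_min lexx orbT.
have t01 : 0 <= t <= 1 by rewrite ltW.
have cphi := strongly_convex_convex.
have h1 := strongly_convex_le (x + v) x t01.
rewrite (_ : t *: (x + v) + _ = x + t *: v) in h1; last first.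
  by apply/rowP => i; rewrite !mxE; ring.
rewrite (_ : x + v - x = v) in h1; last by rewrite addrC addrA addNr add0r.
have h2 := convex_axes x (- (t *: v)) d_gt0 cphi.
have h3 : phi (x - t *: v) <= phi x - t * \sum_i v 0 i * dplus phi 'e_i x + Lam * d%:R * t ^+ 2 * sqnorm v.
  apply: (le_trans h2); rewrite ler_pdivrMl//.
  have -> : d%:R * (phi x - t * (\sum_i v 0 i * dplus phi 'e_i x) + Lam * d%:R * t ^+ 2 * sqnorm v) =
      \sum_i (phi x + - (d%:R * t * v 0 i) * dplus phi 'e_i x + Lam * (- (d%:R * t * v 0 i)) ^+ 2).
    rewrite !big_split/= sumr_const card_ord -[phi x *+ d]mulr_natl !mulrDr; congr (_ + _ + _).
      by rewrite mulrN mulrA mulr_sumr -sumrN; apply: eq_bigr => i _; ring.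
    by rewrite /sqnorm !mulr_sumr; apply: eq_bigr => i _; ring.
  apply: ler_sum => i _; rewrite !mxE mulrN mulrA; apply: sc.
  rewrite normrN !normrM (gtr0_norm t0) (gtr0_norm d0); apply: le_trans tdv.
  rewrite [d%:R * t]mulrC -mulrA ler_pM2l// /dv ler_pM2l//.
  by have := ler_norm_rV v i; lra.
(* x is the midpoint of x + t v and x - t v, so the upper bound [h3] at x - t v becomes a lower
   bound at x + t v. *)
have h4 := @convex_functionP _ _ phi cphi (x + t *: v) (x - t *: v) (2^-1).
rewrite (_ : _ *: _ + _ = x) in h4; last by apply/rowP => i; rewrite !mxE; field.
have {}h4 : phi x <= 2^-1 * phi (x + t *: v) + (1 - 2^-1) * phi (x - t *: v) by apply: h4; lra.
rewrite -(ler_pM2l t0) /c.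
have : t * (1 - t) = t - t ^+ 2 by ring.
move: h1 h3 h4; set S := \sum_i _; set q := sqnorm v; rewrite expr2; lra.
Qed.

(** The gradient inequalities at x and y give kappa |v|^2 <= <v, a>; then |a - kappa v|^2 >= 0
    replaces the Cauchy-Schwarz inequality. *)
Lemma grad_plus_expanding x y del Lam del' Lam' : semiconcave_at x del Lam -> semiconcave_at y del' Lam' ->
  kappa ^+ 2 * sqnorm (y - x) <= sqnorm (grad_plus phi y - grad_plus phi x).
Proof.
move=> hx hy; pose v := y - x; pose a := grad_plus phi y - grad_plus phi x.
have h1 := strongly_convex_gradient v hx.
have h2 := strongly_convex_gradient (- v) hy.
rewrite (_ : x + v = y) in h1; last by rewrite /v addrC subrK.
rewrite (_ : y + - v = x) in h2; last by rewrite /v opprB addrC subrK.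
have e1 : sqnorm (- v) = sqnorm v by apply: eq_bigr => i _; rewrite !mxE sqrrN.
have e2 : \sum_i (- v) 0 i * dplus phi 'e_i y = - \sum_i v 0 i * dplus phi 'e_i y.
  by rewrite -sumrN; apply: eq_bigr => i _; rewrite !mxE mulNr.
have e3 : \sum_i v 0 i * a 0 i = \sum_i v 0 i * dplus phi 'e_i y - \sum_i v 0 i * dplus phi 'e_i x.
  by rewrite -sumrB; apply: eq_bigr => i _; rewrite !mxE mulrBr.
rewrite e1 e2 in h2; have h3 : kappa * sqnorm v <= \sum_i v 0 i * a 0 i by lra.
have h4 : sqnorm (a - kappa *: v) = sqnorm a - 2 * kappa * (\sum_i v 0 i * a 0 i) + kappa ^+ 2 * sqnorm v.
  rewrite /sqnorm !mulr_sumr -sumrB -big_split/=; apply: eq_bigr => i _.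
  by rewrite !mxE; ring.
have := sqnorm_ge0 (a - kappa *: v); rewrite h4.
have := ler_wpM2l (ltW kappa_gt0) h3; rewrite /a /v expr2; lra.
Qed.

End strong_convexity.

Section local_regularity.
Context {R : realType} {d : nat}.
Variables (d_gt0 : (0 < d)%N) (Omega V : set 'rV[R]_d) (phi rho : 'rV[R]_d -> R) (alpha lambda : R).
Hypotheses (Omega_open : open Omega) (V_open : open V) (OmegaV : closure Omega `<=` V).
Hypothesis phi_convex : convex_function setT phi.
Hypothesis phi_smooth : holder_class 3 alpha V phi.
Hypothesis rho_smooth : holder_class 1 alpha Omega rho.
Hypotheses (lambda_gt0 : 0 < lambda) (rho_ge : forall x, Omega x -> lambda <= rho x).

Lemma dplus_partial i x : Omega x -> dplus phi 'e_i x = 'D_('e_i) phi x.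
Proof.
move=> Ox; have [phid _ _] := phi_smooth.
have /(derivable_convexP _ _ phi_convex) e : derivable phi x 'e_i.
  by apply: (phid [::]) => //; apply: OmegaV; exact: subset_closure.
by rewrite derive_convexE// e eqxx.
Qed.

Definition regular_ball (x0 : 'rV[R]_d) (del Lam : R) :=
  [/\ ball x0 (2 * del) `<=` Omega,
    forall i x t, ball x0 (2 * del) x -> ball x0 (2 * del) (x + t *: 'e_i) ->
      phi (x + t *: 'e_i) <= phi x + t * dplus phi 'e_i x + Lam * t ^+ 2,
    forall i j x t, ball x0 (2 * del) x -> ball x0 (2 * del) (x + t *: 'e_j) ->
      `|dplus phi 'e_i (x + t *: 'e_j) - dplus phi 'e_i x| <= Lam * `|t|,
    forall j x t, ball x0 (2 * del) x -> ball x0 (2 * del) (x + t *: 'e_j) ->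
      `|rho (x + t *: 'e_j) - rho x| <= Lam * `|t| &
    forall x, ball x0 (2 * del) x -> 0 <= rho x <= Lam].

(** Continuity bounds the second partial derivatives of phi and the first ones of rho near x0, and
    the mean value lemmas turn these bounds into increments with a common constant. *)
Lemma regular_ballE x0 : Omega x0 -> exists del Lam : R,
  [/\ 0 < del, 0 <= Lam & regular_ball x0 del Lam].
Proof.
move=> Ox0; have OV x : Omega x -> V x by move=> Ox; apply: OmegaV; exact: subset_closure.
have second i : exists e C : R, 0 < e /\
    forall y, ball x0 e y -> forall j, `|partials [:: j; i] phi y| <= C.
  have [|j|e [C [e0 _ h]]] := @uniformize_ball R d d x0 (fun j C y => `|partials [:: j; i] phi y| <= C).
  - by move=> j C D y CD h; exact: le_trans CD.
  - exact: (holder_class_near_bounded (s := [:: j; i]) phi_smooth V_open erefl (OV _ Ox0)).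
  - by exists e, C; split=> // y yb j; exact: h.
have [|e1 [C1 [e10 C10 h1]]] :=
    @uniformize_ball R d d x0 (fun i C y => forall j, `|partials [:: j; i] phi y| <= C) _ second.
  by move=> i C D y CD h j; exact: le_trans CD.
have [|j|e2 [C2 [e20 C20 h2]]] := @uniformize_ball R d d x0 (fun j C y => `|partials [:: j] rho y| <= C).
- by move=> j C D y CD h; exact: le_trans CD.
- exact: (holder_class_near_bounded (s := [:: j]) rho_smooth Omega_open erefl Ox0).
have [e3 [C3 [e30 h3]]] :=
  holder_class_near_bounded (s := [::]) rho_smooth Omega_open erefl Ox0.
have /nbhs_ballP[e4 /= e40 h4] : nbhs x0 Omega by exact: open_nbhs_nbhs.
pose e := Num.min (Num.min e1 e2) (Num.min e3 e4).
have e0 : 0 < e by rewrite /e !lt_min e10 e20 e30 e40.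
exists (e / 2), (C1 + C2 + `|C3|); split; [lra|by rewrite !addr_ge0|].
rewrite /regular_ball (_ : 2 * (e / 2) = e); last by field.
have be x : ball x0 e x -> [/\ ball x0 e1 x, ball x0 e2 x, ball x0 e3 x & ball x0 e4 x].
  by rewrite !ball_rVE /e !lt_min => /andP[/andP[-> ->] /andP[-> ->]].
have eO x : ball x0 e x -> Omega x by move=> /be[_ _ _]; exact: h4.
have [phid _ _] := phi_smooth; have [rhod _ _] := rho_smooth.
split=> //.
- move=> i x t xb xtb; rewrite dplus_partial; last exact: eO.
  apply: (@le_trans _ _ (phi x + t * 'D_('e_i) phi x + C1 * t ^+ 2)).
    apply: (semiconcave_ball xb xtb).
    + by move=> y /eO/OV Vy; exact: (phid [::]).
    + by move=> y /eO/OV Vy; exact: (phid [:: i]).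
    + by move=> y /be[yb _ _ _]; exact: h1.
  by rewrite lerD2l ler_wpM2r ?sqr_ge0// -addrA lerDl addr_ge0.
- move=> i j x t xb xtb; rewrite !dplus_partial; [|exact: eO|exact: eO].
  apply: (@le_trans _ _ (C1 * `|t|)).
    apply: (@mean_value_ball _ _ ('D_('e_i) phi) _ _ _ _ C1 _ xb xtb).
    + by move=> y /eO/OV Vy; exact: (phid [:: i]).
    + by move=> y /be[yb _ _ _]; exact: h1.
  by rewrite ler_wpM2r// -addrA lerDl addr_ge0.
- move=> j x t xb xtb; apply: (@le_trans _ _ (C2 * `|t|)).
    apply: (@mean_value_ball _ _ rho _ _ _ _ C2 _ xb xtb).
    + by move=> y /eO Oy; exact: (rhod [::]).
    + by move=> y /be[_ yb _ _]; exact: h2.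
  by rewrite ler_wpM2r// addrAC lerDr addr_ge0.
- move=> x xb; have Ox := eO _ xb; have [_ _ xb3 _] := be _ xb.
  rewrite (le_trans (ltW lambda_gt0) (rho_ge Ox))/=.
  apply: (le_trans (ler_norm _)); apply: (le_trans (h3 _ xb3)).
  by apply: (le_trans (ler_norm _)); rewrite lerDr addr_ge0.
Qed.

Lemma semiconcave_on x : Omega x -> exists del Lam, semiconcave_at phi x del Lam.
Proof.
move=> Ox; have [del [Lam [del0 Lam0 [_ sc _ _ _]]]] := regular_ballE Ox.
exists del, Lam; split => // i t td; apply: sc; rewrite ball_rVE ?subrr ?normr0; first by lra.
rewrite opprD addrA subrr sub0r normrN normrZ.
have := norm_delta_le (R := R) i => e1.
have : `|t| * `|'e_i : 'rV[R]_d| <= `|t| by rewrite ler_piMr.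
lra.
Qed.

(** Keeps the bump close to its maximum near x0, for the positivity of the variance in
    [stability]. *)
Lemma grad_plus_continuous_at x0 (eta : R) : Omega x0 -> 0 < eta ->
  exists2 e, 0 < e & forall y, ball x0 e y -> Omega y /\
    sqnorm (grad_plus phi y - grad_plus phi x0) <= eta.
Proof.
move=> Ox0 eta0; have Vx0 : V x0 by apply: OmegaV; exact: subset_closure.
pose et := Num.sqrt (eta / d%:R).
have d0 : 0 < d%:R :> R by rewrite ltr0n.
have et0 : 0 < et by rewrite sqrtr_gt0 divr_gt0.
have near i : exists e C : R, 0 < e /\
    forall y, ball x0 e y -> `|partials [:: i] phi y - partials [:: i] phi x0| <= et.
  have := holder_class_continuous (s := [:: i]) phi_smooth V_open erefl (mem_set Vx0).
  move=> /(_ _ (nbhsx_ballx _ et et0))/nbhs_ballP[e /= e0 he].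
  by exists e, 0; split=> // y /he; rewrite /= /ball/= distrC => /ltW.
have [//|e [_ [e0 _ he]]] := @uniformize_ball R d d x0
  (fun i _ y => `|partials [:: i] phi y - partials [:: i] phi x0| <= et) _ near.
have /nbhs_ballP[e4 /= e40 h4] : nbhs x0 Omega by exact: open_nbhs_nbhs.
exists (Num.min e e4); first by rewrite lt_min e0 e40.
move=> y; rewrite ball_rVE lt_min => /andP[ye ye4].
have Oy : Omega y by apply: h4; rewrite ball_rVE.
split=> //.
apply: (@le_trans _ _ (\sum_(i < d) et ^+ 2)).
  apply: ler_sum => i _; rewrite !mxE !dplus_partial//.
  rewrite -[X in X <= _]real_normK ?num_real// ler_sqr ?nnegrE// ?(ltW et0)//.
  by apply: he; rewrite ball_rVE.
rewrite sumr_const card_ord sqr_sqrtr ?divr_ge0 ?(ltW eta0)// ?(ltW d0)//.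
by rewrite -[_ *+ d]mulr_natr divfK// gt_eqF.
Qed.

End local_regularity.

Lemma open_rV_balls (R : realType) (d : nat) (U : set 'rV[R]_d) :
  (forall x, U x -> exists2 e, 0 < e & ball x e `<=` U) -> open U.
Proof.
move=> h; rewrite openE => x /h[e e0 eU]; apply/nbhs_ballP; exists e => //.
Qed.

(** * Gradients almost everywhere and the density of mu *)

Section gradient_ae.
Context {R : realType} {d : nat}.
Local Notation m := (lebesgue_rV R d).

Lemma EFin_integral_rV (F : 'rV[R]_d -> R) : bounded_support F -> ((integral_rV F)%:E = \int[m]_x (F x)%:E)%E.
Proof.
by move=> nF; rewrite /integral_rV /Rintegral fineK//; apply: integrable_fin_num => //;
  exact: bounded_support_integrable.
Qed.

Lemma ae_gradientE (f : 'rV[R]_d -> R) : (0 < d)%N -> convex_function setT f ->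
  {ae m, forall x, gradient f x = grad_plus f x}.
Proof.
move=> d0 cf.
have : {ae m, forall x, forall i : 'I_d, dplus f 'e_i x = - dplus f (- 'e_i) x}.
  (* The coordinate is quantified as a natural number with a proof of n < d, so that [ae_foralln]
     applies. *)
  have h (n : nat) : {ae m, forall x, forall lt : (n < d)%N,
    dplus f 'e_(Ordinal lt) x = - dplus f (- 'e_(Ordinal lt)) x}.
    have [lt|nlt] := pselect (n < d)%N; last by apply: aeW.
    apply: filterS (ae_dplusN 'e_(Ordinal lt) d0 cf) => x e lt'.
    by rewrite (bool_irrelevance lt' lt).
  have := ae_foralln h; apply: filterS => x hx i.
  by have := hx i (ltn_ord i); rewrite (_ : Ordinal _ = i)//; apply/val_inj.
apply: filterS => x e; apply/rowP => i; rewrite !mxE derive_convexE//.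
by rewrite -e eqxx.
Qed.

End gradient_ae.

Section density.
Context {R : realType} {d : nat}.
Local Notation m := (lebesgue_rV R d).
Variables (Omega : set 'rV[R]_d) (mu : probability 'rV[R]_d R) (rho : 'rV[R]_d -> R).
Variables (alpha lambda : R).
Hypotheses (Omega_open : open Omega) (mu_density : has_density_on mu Omega rho).
Hypothesis rho_smooth : holder_class 1 alpha Omega rho.
Hypotheses (lambda_gt0 : 0 < lambda) (rho_ge : forall x, Omega x -> lambda <= rho x).

(** Outside Omega nothing is known of rho, not even measurability. *)
Definition density_ext (x : 'rV[R]_d) : R := \1_Omega x * rho x.

Lemma measurable_density : measurable_fun setT density_ext.
Proof.
have mO : measurable Omega by exact: open_measurable_rV.
have crho := holder_class_continuous rho_smooth Omega_open (isT : (size (@nil 'I_d) <= 1)%N).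
suff h : measurable_fun Omega rho.
  rewrite (_ : density_ext = rho \_ Omega); last first.
    by apply/funext => x; rewrite /density_ext patchE indicE; case: ifP; rewrite ?mul1r ?mul0r.
  by apply/(measurable_restrictT _ _).1.
apply: (measurability _ (RGenOpens.measurableE R)) => //.
move=> _ [_ [a [b ->]] <-]; apply: open_measurable_rV.
apply: open_rV_balls => x [Ox /= xab].
have /nbhs_ballP[e1 /= e10 h1] : nbhs x Omega by exact: open_nbhs_nbhs.
have oab : nbhs (rho x) `]a, b[%classic by apply: open_nbhs_nbhs; split => //; exact: interval_open.
have /nbhs_ballP[e2 /= e20 h2] := crho x (mem_set Ox) _ oab.
exists (Num.min e1 e2); first by rewrite lt_min e10 e20.
move=> y; rewrite ball_rVE lt_min => /andP[y1 y2]; split.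
  by apply: h1; rewrite ball_rVE.
by apply: h2; rewrite ball_rVE.
Qed.

Lemma density_ge0 x : 0 <= density_ext x.
Proof.
rewrite /density_ext indicE; have [/set_mem Ox|_] := boolP (x \in Omega); last by rewrite mul0r.
by rewrite mul1r (le_trans (ltW lambda_gt0))// rho_ge.
Qed.

Lemma integral_density (f : 'rV[R]_d -> \bar R) : measurable_fun setT f ->
  (forall x, 0 <= f x)%E -> (\int[mu]_x f x = \int[m]_x (f x * (density_ext x)%:E))%E.
Proof.
move=> mf f0.
apply: (@ge0_integral_weighted_image _ _ _ _ R m mu id density_ext _ _ density_ge0) => //.
  exact: measurable_density.
move=> A mA; rewrite [LHS]mu_density// integral_mkcondr; apply: eq_integral => x _.
by rewrite patchE /density_ext indicE; case: ifP; rewrite ?mul1r ?mul0r.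
Qed.

Lemma density_ge_measure A : measurable A -> A `<=` Omega -> (lambda%:E * m A <= mu A)%E.
Proof.
move=> mA AO; rewrite mu_density// setIidl// -integral_cst//.
apply: ge0_le_integral => //.
- by move=> y _; rewrite lee_fin ltW.
- apply/measurable_EFinP; apply: (@eq_measurable_fun _ _ _ _ _ density_ext).
    by move=> y /set_mem /AO Oy; rewrite /density_ext indicE mem_set// mul1r.
  by apply: measurable_funTS; exact: measurable_density.
- by move=> y /AO /rho_ge; rewrite lee_fin.
Qed.

Lemma density_ball_gt0 x e : 0 < e -> ball x e `<=` Omega -> (0 < mu (ball x e))%E.
Proof.
move=> e0 xO; have mb : measurable (ball x e) by apply: open_measurable_rV; exact: ball_open.
apply: lt_le_trans (density_ge_measure mb xO).
by rewrite lebesgue_rV_ball// -EFinM lte_fin mulr_gt0// exprn_gt0// mulr_gt0.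
Qed.

Lemma le_integral_density (u : 'rV[R]_d -> R) B' : measurable B' -> B' `<=` Omega ->
  bounded_support (fun x => \1_B' x * `|u x|) -> measurable_fun setT u ->
  ((lambda * integral_rV (fun x => \1_B' x * `|u x|))%:E <= \int[mu]_x `|u x|%:E)%E.
Proof.
move=> mB' B'O nu mu'; rewrite integral_density//; last first.
  by apply/measurable_EFinP; exact: measurableT_comp.
rewrite -integral_rVZ// EFin_integral_rV; last exact: bounded_supportZ.
apply: ge0_le_integral => //.
- by move=> x _; rewrite lee_fin !mulr_ge0// ?indicE// ltW.
- by apply/measurable_EFinP; have [[mF _] _] := bounded_supportZ lambda nu.
- apply: emeasurable_funM; apply/measurable_EFinP; last exact: measurable_density.
  exact: measurableT_comp.
- move=> x _; rewrite -EFinM lee_fin [leRHS]mulrC mulrA ler_wpM2r// indicE.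
  have [/set_mem/B'O Ox|_] := boolP (x \in B'); last by rewrite mulr0 density_ge0.
  by rewrite mulr1 /density_ext indicE mem_set// mul1r rho_ge.
Qed.

End density.

Section rV_points.
Context {R : realType} {d : nat}.

Lemma measurable_set1_rV (x : 'rV[R]_d) : measurable [set x].
Proof.
rewrite (_ : [set x] = \bigcap_(i in [set: 'I_d]) ((fun v : 'rV[R]_d => v 0 i) @^-1` [set x 0 i])).
  apply: fin_bigcap_measurable => // i _.
  by rewrite -[X in measurable X]setTI; exact: measurable_rV_coord.
apply/seteqP; split => [y -> i _//|y h]; apply/rowP => i; exact: h.
Qed.

Lemma measurable_range_rV n (x : 'I_n -> 'rV[R]_d) : measurable (range x).
Proof.
rewrite (_ : range x = \bigcup_(i in [set: 'I_n]) [set x i]).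
  by apply: fin_bigcup_measurable => // i _; exact: measurable_set1_rV.
by apply/seteqP; split => [_ [i _ <-]|y [i _ ->]]; exists i.
Qed.

Lemma measurable_quad_bump (r : R) y0 : measurable_fun setT (fun y : 'rV[R]_d => quad_bump r y0 y).
Proof.
apply: measurable_maxr => //; apply: measurable_funB => //; rewrite /sqnorm.
apply: measurable_sum => i.
have mi : measurable_fun setT (fun y : 'rV[R]_d => (y - y0) 0 i).
  under eq_fun do rewrite !mxE; apply: measurable_funB => //; exact: measurable_rV_coord.
by under eq_fun do rewrite expr2; exact: measurable_funM.
Qed.

End rV_points.

(** * Stability and quantization in L^1(mu) *)

Lemma integral_gt0_on d1 (T : measurableType d1) (R : realType) (mu : {measure set T -> \bar R})
    (F : T -> R) (U : set T) (K : R) : measurable U -> (0 < mu U)%E -> 0 < K ->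
  measurable_fun setT F -> (forall x, 0 <= F x) -> (forall x, U x -> K <= F x) ->
  (0 < \int[mu]_x (F x)%:E)%E.
Proof.
move=> mU U0 K0 mF F0 KF; have mF' := (measurable_EFinP _ _).2 mF.
apply: (@lt_le_trans _ _ (K%:E * mu U)%E); first by rewrite mule_gt0.
apply: (@le_trans _ _ (\int[mu]_(x in U) (F x)%:E)%E).
  rewrite -integral_cst//; apply: ge0_le_integral => //.
  - by move=> x _; rewrite lee_fin ltW.
  - exact: measurable_funTS.
by apply: ge0_subset_integral => // x _; rewrite lee_fin.
Qed.

Section stability.
Context {R : realType} {d : nat}.
Local Notation m := (lebesgue_rV R d).
Variables (d_gt0 : (0 < d)%N) (Omega V : set 'rV[R]_d) (phi rho : 'rV[R]_d -> R).
Variables (mu : probability 'rV[R]_d R) (alpha lambda kappa : R).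
Hypotheses (Omega_open : open Omega) (V_open : open V) (OmegaV : closure Omega `<=` V).
Hypotheses (kappa_gt0 : 0 < kappa) (phi_sc : strongly_convex kappa phi).
Hypothesis phi_smooth : holder_class 3 alpha V phi.
Hypothesis mu_density : has_density_on mu Omega rho.
Hypothesis rho_smooth : holder_class 1 alpha Omega rho.
Hypotheses (lambda_gt0 : 0 < lambda) (rho_ge : forall x, Omega x -> lambda <= rho x).

Let phi_convex := strongly_convex_convex kappa_gt0 phi_sc.

(** Otherwise mu would have total mass 0. *)
Lemma density_support_nonempty : Omega !=set0.
Proof.
apply/set0P/negP => /eqP O0; have := mu_density measurableT.
rewrite probability_setT O0 setI0 integral_set0 => /eqP.
by rewrite eqe oner_eq0.
Qed.

Lemma local_data : exists x0 del Lam,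
  [/\ Omega x0, 0 < del, 0 <= Lam & regular_ball Omega phi rho x0 del Lam].
Proof.
have [x0 Ox0] := density_support_nonempty.
have [del [Lam [del0 Lam0 rb]]] := regular_ballE Omega_open V_open OmegaV phi_convex
  phi_smooth rho_smooth lambda_gt0 rho_ge Ox0.
by exists x0, del, Lam.
Qed.

Let gradE x : Omega x -> gradient phi x = grad_plus phi x.
Proof.
move=> Ox; apply/rowP => i; rewrite !mxE.
by rewrite (dplus_partial OmegaV phi_convex phi_smooth).
Qed.

(** The inequality is additive because the integral of |f - phi - a| may be infinite. The positivity
    clause, for every c, yields a positive variance for h under nu. *)
Lemma stability : exists (h : 'rV[R]_d -> R) (C H : R),
  [/\ 0 < C, measurable_fun setT h, forall y, 0 <= h y <= H,
      forall c, (0 < \int[mu]_x ((h (gradient phi x) - c) ^+ 2)%:E)%E &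
      forall f a, convex_function setT f ->
        (\int[mu]_x (h (gradient phi x))%:E <=
         \int[mu]_x (h (gradient f x))%:E + C%:E * \int[mu]_x `|f x - phi x - a|%:E)%E].
Proof.
have [x0 [del [Lam [Ox0 del0 Lam0 [bO sc Glip rlip rb]]]]] := local_data.
(* By [grad_plus_expanding], grad phi sends the points of Omega outside the ball of radius del to
   distance at least r from its value at x0. *)
pose r := kappa * del; have r0 : 0 < r by rewrite mulr_gt0.
pose h y := quad_bump r (grad_plus phi x0) y ^+ 2.
have mh : measurable_fun setT h.
  by rewrite /h; under eq_fun do rewrite expr2; apply: measurable_funM; exact: measurable_quad_bump.
have supp x : Omega x -> ~ ball x0 del x -> quad_bump r (grad_plus phi x0) (grad_plus phi x) = 0.
  move=> Ox; rewrite ball_rVE => /negP; rewrite -leNgt distrC => dx.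
  have [e1 [L1 s1]] :=
    semiconcave_on Omega_open V_open OmegaV phi_convex phi_smooth rho_smooth lambda_gt0 rho_ge Ox0.
  have [e2 [L2 s2]] :=
    semiconcave_on Omega_open V_open OmegaV phi_convex phi_smooth rho_smooth lambda_gt0 rho_ge Ox.
  have h1 := grad_plus_expanding d_gt0 kappa_gt0 phi_sc s1 s2.
  apply: max_l; rewrite subr_le0; apply: le_trans h1.
  rewrite /r exprMn ler_wpM2l ?sqr_ge0//; apply: le_trans (norm_le_sqnorm _).
  by rewrite ler_sqr ?nnegrE// ltW.
pose B := ball x0 del; pose B' := ball x0 (2 * del).
have mB : measurable B by apply: open_measurable_rV; exact: ball_open.
have mB' : measurable B' by apply: open_measurable_rV; apply: ball_open; lra.
have BB' : B `<=` B' by move=> x; rewrite /B /B' !ball_rVE; lra.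
have B'M x : B' x -> `|x| <= `|x0| + 2 * del.
  by rewrite /B' ball_rVE => hx; have := ler_normB x0 (x0 - x); rewrite opprB addrC subrK; lra.
have nB : bounded_support (\1_B : 'rV[R]_d -> R) by apply: (bounded_support_indic mB) => x /BB'; exact: B'M.
have nB' : bounded_support (\1_B' : 'rV[R]_d -> R) by exact: (bounded_support_indic mB' B'M).
have rE : (fun x => \1_B x * rho x) = (fun x => \1_B x * density_ext Omega rho x).
  apply/funext => x; rewrite /density_ext !indicE.
  have [Bx|nBx] := pselect (B x); last by rewrite memNset// !mul0r.
  by rewrite mem_set// mem_set ?mul1r//; apply: bO; exact: BB'.
have md := measurable_density Omega_open rho_smooth.
have mrho : measurable_fun setT (fun x => \1_B x * rho x).
  by rewrite rE; apply: measurable_funM.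
have [C [C0 hC]] := local_stability d_gt0 phi_convex del0 Lam0 (ltW r0) sc Glip rlip rb mrho
  (fun x bx => supp x (bO _ bx)).
have mgrad (f : 'rV[R]_d -> R) : convex_function setT f -> measurable_fun setT (gradient f).
  exact: measurable_gradient.
have mhg (f : 'rV[R]_d -> R) : convex_function setT f -> measurable_fun setT (fun x => h (gradient f x)).
  by move=> cf; apply: (measurableT_comp mh); exact: mgrad.
exists h, (C / lambda), (r ^+ 4); split => //.
- by rewrite divr_gt0.
- move=> y; rewrite sqr_ge0/= -[4%N]/(2 * 2)%N exprM ler_sqr ?nnegrE ?quad_bump_ge0 ?sqr_ge0//.
  exact: quad_bump_le.
- move=> c; have r4 : 0 < r ^+ 4 by rewrite exprn_gt0.
  have mF : measurable_fun setT (fun x => (h (gradient phi x) - c) ^+ 2).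
    under eq_fun do rewrite expr2.
    by apply: measurable_funM; apply: measurable_funB => //; exact: mhg.
  have gap : 0 < (r ^+ 4 / 8) ^+ 2 by rewrite exprn_gt0// divr_gt0.
  (* Near x0 the function h (grad phi) is at least r^4 / 4, and it vanishes on a ball in B' outside
     B; on one of the two it differs from c by at least r^4 / 8. *)
  have [cs|cl] := leP c (r ^+ 4 / 8).
    have r2 : 0 < r ^+ 2 / 2 by rewrite divr_gt0// exprn_gt0.
    have [e e0 he] := grad_plus_continuous_at d_gt0 Omega_open V_open OmegaV phi_convex phi_smooth Ox0 r2.
    have eO : ball x0 e `<=` Omega by move=> x /he[].
    apply: (@integral_gt0_on _ _ _ _ _ (ball x0 e) ((r ^+ 4 / 8) ^+ 2)) => //.
    + by apply: open_measurable_rV; exact: ball_open.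
    + exact: (density_ball_gt0 Omega_open mu_density rho_smooth lambda_gt0 rho_ge).
    + by move=> x; exact: sqr_ge0.
    move=> x /he[Ox sx]; rewrite gradE//.
    have h4 : r ^+ 4 / 4 <= h (grad_plus phi x).
      rewrite /h; have b1 : r ^+ 2 / 2 <= quad_bump r (grad_plus phi x0) (grad_plus phi x).
        by rewrite /quad_bump le_max; apply/orP; right; lra.
      have -> : r ^+ 4 / 4 = (r ^+ 2 / 2) ^+ 2 by field.
      by rewrite ler_sqr ?nnegrE ?quad_bump_ge0// ltW.
    rewrite ler_sqr ?nnegrE; [lra|lra|].
    by rewrite subr_ge0; lra.
  (* The ball of radius del / 2 centered at distance 3 del / 2 from x0 fits between B and B'. *)
  pose i := Ordinal d_gt0; pose x1 := x0 + (3 / 2 * del) *: 'e_i.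
  have x1i (y : 'rV[R]_d) : ball x1 (del / 2) y -> B' y /\ ~ B y.
    rewrite /B /B' !ball_rVE => hy; split.
      have := ler_normD (x1 - y) (x0 - x1); rewrite addrC addrA subrK => /le_lt_trans; apply.
      rewrite {2}/x1 opprD addrA subrr sub0r normrN normrZ.
      have e1 := norm_delta_le (R := R) i.
      have : `|3 / 2 * del| * `|'e_i : 'rV[R]_d| <= 3 / 2 * del.
        by rewrite ger0_norm ?ler_piMr//; lra.
      lra.
    apply/negP; rewrite -leNgt.
    have := ler_norm_rV (x1 - y) i; have := ler_norm_rV (x0 - y) i.
    rewrite !mxE !eqxx mulr1 => a1 a2.
    have := ler_norm (y 0 i - x0 0 i); rewrite distrC.
    have := ler_norm (x0 0 i + 3 / 2 * del - y 0 i); lra.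
  apply: (@integral_gt0_on _ _ _ _ _ (ball x1 (del / 2)) ((r ^+ 4 / 8) ^+ 2)) => //.
  + by apply: open_measurable_rV; apply: ball_open; lra.
  + apply: (density_ball_gt0 Omega_open mu_density rho_smooth lambda_gt0 rho_ge); first by lra.
    by move=> y /x1i[/bO].
  + by move=> x; exact: sqr_ge0.
  move=> x /x1i[/bO Ox nBx]; rewrite gradE// /h supp// expr0n/= sub0r sqrrN.
  by rewrite ler_sqr ?nnegrE; lra.
move=> f a cf.
have mI (g : 'rV[R]_d -> 'rV[R]_d) : measurable_fun setT (fun x => h (g x)) ->
    (\int[mu]_x (h (g x))%:E = \int[m]_x ((density_ext Omega rho x * h (g x))%:E))%E.
  move=> mg; rewrite (integral_density Omega_open mu_density rho_smooth lambda_gt0 rho_ge); last first.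
  - by move=> x; rewrite lee_fin sqr_ge0.
  - exact/measurable_EFinP.
  by apply: eq_integral => x _; rewrite -EFinM mulrC.
have d0' x : 0 <= density_ext Omega rho x by exact: (density_ge0 lambda_gt0 rho_ge).
have bh (g : 'rV[R]_d -> R) : convex_function setT g -> locally_bounded (fun x => h (grad_plus g x)).
  by move=> cg; rewrite /h; under eq_fun do rewrite expr2; apply: locally_boundedM;
    exact: locally_bounded_bump.
have nrho : bounded_support (fun x => \1_B x * rho x).
  split; last by have [_ [M hM]] := nB; exists M => x /hM ->; exact: mul0r.
  split=> // M; exists Lam => x _; rewrite indicE.
  have [Bx|nBx] := pselect (B x); last by rewrite memNset// mul0r normr0.
  by rewrite mem_set// mul1r; have /andP[r1 rL] := rb _ (BB' _ Bx); rewrite ger0_norm.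
have nh (g : 'rV[R]_d -> R) : convex_function setT g ->
  bounded_support (fun x => \1_B x * rho x * h (grad_plus g x)).
  by move=> cg; apply: bounded_supportMr => //; exact: bh.
have E1 : (\int[mu]_x (h (gradient phi x))%:E = (integral_rV (fun x => \1_B x * rho x * h (grad_plus
  phi x)))%:E)%E.
  rewrite mI; last exact: mhg.
  rewrite EFin_integral_rV; last exact: nh.
  apply: eq_integral => x _; congr EFin; rewrite /density_ext !indicE.
  have [Ox|nOx] := pselect (Omega x); last first.
    rewrite memNset// memNset; first by rewrite !mul0r.
    by move=> Bx; apply: nOx; apply: bO; exact: BB'.
  rewrite gradE//; have [Bx|nBx] := pselect (B x); first by rewrite !mem_set.
  by rewrite (memNset nBx) mem_set// /h supp// expr0n/= !mulr0.
(* For f only an inequality holds, since grad f may meet the support of h outside B; h >= 0 gives it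
   the right direction. *)
have E2 : ((integral_rV (fun x => \1_B x * rho x * h (grad_plus f x)))%:E <=
  \int[mu]_x (h (gradient f x))%:E)%E.
  rewrite mI; last exact: mhg.
  rewrite EFin_integral_rV; last exact: nh.
  have mhf := mhg _ cf; have [[mhp _] _] := nh _ cf.
  apply: ae_ge0_le_integral => //.
  - move=> x _; rewrite lee_fin [\1_B x * _](congr1 (fun F => F x) rE) mulr_ge0 ?sqr_ge0//.
    by rewrite mulr_ge0.
  - exact/measurable_EFinP.
  - by move=> x _; rewrite lee_fin mulr_ge0 ?sqr_ge0.
  - by apply/measurable_EFinP; exact: measurable_funM.
  apply: filterS (ae_gradientE d_gt0 cf) => x -> _.
  rewrite lee_fin [\1_B x * _](congr1 (fun F => F x) rE) ler_wpM2r ?sqr_ge0//.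
  by rewrite ler_piMl// indicE; case: (_ \in _).
pose u x := f x - phi x - a.
have bu : locally_bounded u.
  apply: locally_boundedB; last exact: locally_bounded_cst.
  by apply: locally_boundedB; apply: locally_bounded_continuous; exact: convex_continuous.
have nu : bounded_support (fun x => \1_B' x * `|u x|) by apply: bounded_supportMr => //;
  exact: locally_bounded_norm.
have E3 := le_integral_density Omega_open mu_density rho_smooth lambda_gt0 rho_ge mB' bO nu bu.1.
have key := hC f a cf.
have key2 : integral_rV (fun x => \1_B x * rho x * h (grad_plus phi x)) <=
    integral_rV (fun x => \1_B x * rho x * h (grad_plus f x)) + C / lambda * (lambda * integral_rV
      (fun x => \1_B' x * `|u x|)).
  rewrite mulrA divfK ?gt_eqF// -lerBlDl -integral_rVB; [|exact: nh|exact: nh].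
  by move: key; under [X in integral_rV X <= _]eq_fun do rewrite mulrBr.
rewrite E1; apply: (@le_trans _ _ (integral_rV (fun x => \1_B x * rho x * h (grad_plus f x)) +
    C / lambda * (lambda * integral_rV (fun x => \1_B' x * `|u x|)))%:E).
  by rewrite lee_fin.
rewrite EFinD EFinM leeD// lee_pmul2l// lte_fin divr_gt0//.
Qed.

End stability.

Lemma measure_bigsetU_le d1 (T : measurableType d1) (R : realType)
    (mu : {measure set T -> \bar R}) I (r : seq I) (A : I -> set T) :
  (forall i, measurable (A i)) ->
  (mu (\big[setU/set0]_(i <- r) A i) <= \sum_(i <- r) mu (A i))%E.
Proof.
move=> mA; elim: r => [|i r IH]; first by rewrite !big_nil measure0.
rewrite !big_cons; apply: le_trans (measureU2 _ _ _) (leeD2l _ IH) => //.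
exact: bigsetU_measurable.
Qed.

Section quantization.
Context {R : realType} {d : nat}.
Local Notation m := (lebesgue_rV R d).
Variables (d_gt0 : (0 < d)%N) (Omega V : set 'rV[R]_d) (phi rho : 'rV[R]_d -> R).
Variables (mu : probability 'rV[R]_d R) (alpha lambda kappa : R).
Hypotheses (Omega_open : open Omega) (V_open : open V) (OmegaV : closure Omega `<=` V).
Hypotheses (kappa_gt0 : 0 < kappa) (phi_sc : strongly_convex kappa phi).
Hypothesis phi_smooth : holder_class 3 alpha V phi.
Hypothesis mu_density : has_density_on mu Omega rho.
Hypothesis rho_smooth : holder_class 1 alpha Omega rho.
Hypotheses (lambda_gt0 : 0 < lambda) (rho_ge : forall x, Omega x -> lambda <= rho x).
Hypothesis phiE : forall x, phi x = sqnorm x / 2.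

Let phi_convex := strongly_convex_convex kappa_gt0 phi_sc.

Lemma grad_plus_sqnorm x : grad_plus phi x = x.
Proof.
apply/rowP => i; rewrite mxE.
have sl t : 0 < t -> slope phi 'e_i x t = x 0 i + t / 2.
  move=> t0; rewrite /slope !phiE.
  have -> : sqnorm (x + t *: 'e_i) = sqnorm x + 2 * t * x 0 i + t ^+ 2.
    rewrite /sqnorm (bigD1 i)//= [in RHS](bigD1 i)//= !mxE !eqxx mulr1.
    rewrite (eq_bigr (fun j => x 0 j ^+ 2)); last first.
      by move=> j /negbTE ji; rewrite !mxE ji andbF mulr0 addr0.
    by ring.
  by field; lra.
apply/eqP; rewrite eq_le; apply/andP; split.
  apply: (@ler_vanishing _ _ _ (2^-1) 1) => // t t0 _.
  by have := dplus_le_slope 'e_i x phi_convex t0; rewrite sl.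
by apply: dplus_ge => // t t0; rewrite sl// lerDl divr_ge0// ltW.
Qed.

Lemma cap_ge_sq (a e : R) : 0 <= e <= 1 -> e <= `|a| -> e ^+ 2 <= cap a.
Proof.
move=> /andP[e0 e1] ea; rewrite /cap le_min; apply/andP; split.
  by apply: le_trans ea; rewrite expr2 ler_piMl.
by rewrite -[X in _ <= X]real_normK ?num_real// ler_sqr.
Qed.

Lemma le_norm_coord (v : 'rV[R]_d) (e : R) : 0 < e -> e <= `|v| -> exists j, e <= `|v 0 j|.
Proof.
move=> e0 ev; apply: contrapT => h.
have : ball 0 e v.
  split=> // i j; rewrite (ord1 i) mxE /ball/= sub0r normrN ltNge.
  by apply/negP => hj; apply: h; exists j.
by rewrite ball_rVE sub0r normrN ltNge ev.
Qed.

Lemma quantization : exists2 c : R, 0 < c &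
  forall (n : nat) (x : 'I_n -> 'rV[R]_d) (f : 'rV[R]_d -> R) (a : R), (0 < n)%N ->
    convex_function setT f -> gradient_pushes mu f (empirical x) ->
    ((c * n%:R `^ (- (2 / d%:R)))%:E <= \int[mu]_x `|f x - phi x - a|%:E)%E.
Proof.
have [x0 [del [Lam [Ox0 del0 Lam0 [bO sc _ _ _]]]]] :=
  local_data Omega_open V_open OmegaV kappa_gt0 phi_sc phi_smooth mu_density rho_smooth lambda_gt0 rho_ge.
pose B := ball x0 del; pose B' := ball x0 (2 * del).
have mB : measurable B by apply: open_measurable_rV; exact: ball_open.
have mB' : measurable B' by apply: open_measurable_rV; apply: ball_open; lra.
have BB' : B `<=` B' by move=> x; rewrite /B /B' !ball_rVE; lra.
have B'M x : B' x -> `|x| <= `|x0| + 2 * del.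
  by rewrite /B' ball_rVE => hx; have := ler_normB x0 (x0 - x); rewrite opprB addrC subrK; lra.
have nB : bounded_support (\1_B : 'rV[R]_d -> R) by apply: (bounded_support_indic mB) => x /BB'; exact: B'M.
have nB' : bounded_support (\1_B' : 'rV[R]_d -> R) by exact: (bounded_support_indic mB' B'M).
(* theta <= 1 keeps eps in the range where [cap] is quadratic. theta <= del / 2 bounds the total
   volume n (2 eps)^d = (2 theta)^d of the cubes around the atoms by half the volume of B. *)
pose theta := Num.min 1 (del / 2).
have th0 : 0 < theta by rewrite lt_min ltr01 divr_gt0.
pose M := 4 * Lam + del^-1.
have M0 : 0 < M by rewrite ltr_wpDl ?invr_gt0// mulr_ge0.
have dR : 0 < d%:R :> R by rewrite ltr0n.
pose K := d%:R * (32 * M).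
have K0 : 0 < K by rewrite !mulr_gt0.
exists (lambda / K * (theta ^+ 2 * ((2 * del) ^+ d / 2))).
  by rewrite !mulr_gt0 ?invr_gt0 ?exprn_gt0 ?mulr_gt0.
move=> n x f a n0 cf push.
have nR : 0 < n%:R :> R by rewrite ltr0n.
pose eps := theta * n%:R `^ (- (1 / d%:R)).
have nd0 : 0 < n%:R `^ (- (1 / d%:R)) :> R by rewrite powR_gt0.
have eps0 : 0 < eps by rewrite mulr_gt0.
have eps1 : eps <= 1.
  apply: (@le_trans _ _ (1 * 1)); last by rewrite mulr1.
  apply: ler_pM; rewrite ?(ltW th0) ?(ltW nd0)//; first by rewrite /theta ge_min lexx.
  rewrite powRN invf_le1 ?powR_gt0//.
  have : 1 `^ (1 / d%:R) <= n%:R `^ (1 / d%:R) :> R.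
    by rewrite ge0_ler_powR ?nnegrE ?ler1n// divr_ge0// ltW.
  by rewrite powR1.
have epsd : eps ^+ d = theta ^+ d / n%:R.
  rewrite exprMn; congr (_ * _); rewrite -powR_mulrn ?(ltW nd0)// -powRrM.
  by rewrite mulNr divfK ?gt_eqF// powR_inv1// ltW.
have eps2 : eps ^+ 2 = theta ^+ 2 * n%:R `^ (- (2 / d%:R)).
  rewrite exprMn; congr (_ * _); rewrite -powR_mulrn ?(ltW nd0)// -powRrM.
  by congr (_ `^ _); field; rewrite gt_eqF.
pose u y := f y - phi y - a.
have bu : locally_bounded u.
  apply: locally_boundedB; last exact: locally_bounded_cst.
  by apply: locally_boundedB; apply: locally_bounded_continuous; exact: convex_continuous.
have nu : bounded_support (fun x => \1_B' x * `|u x|) by apply: bounded_supportMr => //;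
  exact: locally_bounded_norm.
pose p j y := dplus f 'e_j y - dplus phi 'e_j y.
have bp j : locally_bounded (p j) by apply: locally_boundedB; exact: locally_bounded_dplus.
have nc j : bounded_support (fun x => \1_B x * cap (p j x)).
  by apply: bounded_supportMr => //; exact: locally_bounded_cap.
have upper : integral_rV (fun y => \sum_j \1_B y * cap (p j y)) <=
  K * integral_rV (fun x => \1_B' x * `|u x|).
  rewrite integral_rV_sum//;
    apply: (@le_trans _ _ (\sum_(j < d) (32 * M) * integral_rV (fun x => \1_B' x * `|u x|))).
    by apply: ler_sum => j _; exact: (gradient_cap_estimate d_gt0 phi_convex del0 Lam0 sc a cf j).
  by rewrite sumr_const card_ord /K -[leLHS]mulr_natl mulrA.
(* Outside the balls of radius eps around the atoms, the displacement is at least eps. *)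
pose bad := \big[setU/set0]_(i < n) ball (x i) eps.
have mball i : measurable (ball (x i) eps).
  by apply: open_measurable_rV; exact: ball_open.
have mbad : measurable bad by exact: bigsetU_measurable.
(* The points where grad f is not an atom: mu-null by the push-forward condition, hence
   Lebesgue-null in B because the density is at least lambda there. *)
pose N := gradient f @^-1` (~` range x).
have mg := measurable_gradient d_gt0 cf.
have mN : measurable N.
  by rewrite -[X in measurable X]setTI; apply: mg => //; apply: measurableC; exact: measurable_range_rV.
have muN : mu N = 0%E.
  have /push : measurable (~` range x) by apply: measurableC; exact: measurable_range_rV.
  rewrite /pushforward -/N => ->; rewrite /empirical big1 ?mule0// => i _.
  by rewrite diracE memNset// => h; apply: h; exists i.
have mBN : m (B `&` N) = 0%E.
  have mBN : measurable (B `&` N) by exact: measurableI.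
  have := density_ge_measure Omega_open mu_density rho_smooth lambda_gt0 rho_ge mBN
    (fun y yBN => bO _ (BB' _ yBN.1)).
  have : (mu (B `&` N) <= mu N)%E by apply: le_measure; rewrite ?inE//; exact: subIsetr.
  rewrite muN => h1 h2; have := le_trans h2 h1.
  by rewrite pmule_rle0 ?lte_fin// measure_le0 => /eqP.
pose S := B `\` (bad `|` N).
have mS : measurable S by apply: measurableD => //; exact: measurableU.
have mSge : (((2 * del) ^+ d / 2)%:E <= m S)%E.
  have h1 : (m B <= m S + (m bad + m (B `&` N)))%E.
    apply: le_trans (le_trans (measureU2 _ _ _) (leeD2l _ (measureU2 _ _ _))) => //.
    - apply: le_measure; rewrite ?inE//.
        by apply: measurableU => //; apply: measurableU => //; exact: measurableI.
      move=> y By; have [hb|hb] := pselect (bad y); first by right; left.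
      have [hN|hN] := pselect (N y); first by right; right.
      by left; split => // -[].
    - by apply: measurableU => //; exact: measurableI.
    - exact: measurableI.
  have h2 : (m bad <= (theta ^+ d * 2 ^+ d)%:E)%E.
    apply: (@le_trans _ _ (\sum_(i < n) m (ball (x i) eps))%E).
      exact: measure_bigsetU_le.
    rewrite (eq_bigr (fun=> ((2 * eps) ^+ d)%:E)); last by move=> i _; rewrite lebesgue_rV_ball.
    rewrite sumEFin lee_fin sumr_const card_ord exprMn epsd -[leLHS]mulr_natr.
    by rewrite -mulrA divfK ?gt_eqF// mulrC.
  rewrite mBN adde0 lebesgue_rV_ball// in h1.
  have h3 : ((theta ^+ d * 2 ^+ d)%:E <= ((2 * del) ^+ d / 2)%:E)%E.
    rewrite lee_fin exprMn mulrC -mulrA ler_wpM2l ?exprn_ge0//.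
    have th : theta <= del / 2 by rewrite /theta ge_min lexx orbT.
    apply: (@le_trans _ _ ((del / 2) ^+ d)); first by rewrite lerXn2r ?nnegrE ?divr_ge0// ltW.
    rewrite exprMn ler_wpM2l ?exprn_ge0 ?(ltW del0)//.
    rewrite -[leRHS]expr1 ler_wiXn2l//; lra.
  have h4 := le_trans h1 (leeD2l _ (le_trans h2 h3)).
  have Sfin : m S \is a fin_num.
    rewrite ge0_fin_numE//; apply: (lebesgue_rV_bounded mS) => y [/BB' yB _]; exact: B'M yB.
  rewrite -(fineK Sfin) -EFinD lee_fin in h4; rewrite -(fineK Sfin) lee_fin; lra.
have lower : eps ^+ 2 * ((2 * del) ^+ d / 2) <= integral_rV (fun y => \sum_j \1_B y * cap (p j y)).
  rewrite -lee_fin EFin_integral_rV; last exact: bounded_support_sum.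
  apply: (@le_trans _ _ ((eps ^+ 2)%:E * m S)%E).
    by rewrite EFinM lee_wpmul2l// lee_fin sqr_ge0.
  rewrite -integral_cst// [leLHS]integral_mkcond.
  have msum : measurable_fun setT (fun y => \sum_j \1_B y * cap (p j y)).
    have nS : bounded_support (fun y => \sum_j \1_B y * cap (p j y)) by exact: bounded_support_sum.
    exact: nS.1.1.
  apply: ae_ge0_le_integral => //.
  - by move=> y _; rewrite patchE; case: ifP => // _; rewrite lee_fin sqr_ge0.
  - by apply/(measurable_restrictT _ _).1.
  - move=> y _; rewrite lee_fin; apply: sumr_ge0 => j _.
    by rewrite mulr_ge0 ?cap_ge0// indicE.
  - exact/measurable_EFinP.
  apply: filterS (ae_gradientE d_gt0 cf) => y gy _; rewrite patchE.
  have sum0 : 0 <= \sum_j \1_B y * cap (p j y).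
    by apply: sumr_ge0 => j _; rewrite mulr_ge0 ?cap_ge0// indicE.
  case: ifPn => [/set_mem[By nyb]|_]; last by rewrite lee_fin.
  have [i _ xi] : range x (gradient f y) by apply: contrapT => h; apply: nyb; right.
  have nb : eps <= `|grad_plus f y - y|.
    rewrite -gy -xi leNgt; apply/negP => h; apply: nyb; left.
    by rewrite /bad (bigD1 i)//=; left; rewrite ball_rVE.
  have [j hj] := le_norm_coord eps0 nb.
  rewrite lee_fin (bigD1 j)//=; apply: (@le_trans _ _ (\1_B y * cap (p j y))).
    rewrite indicE mem_set// mul1r; apply: cap_ge_sq; first by rewrite (ltW eps0).
    apply: le_trans hj _; rewrite /p !mxE.
    by have := congr1 (fun w : 'rV[R]_d => w 0 j) (grad_plus_sqnorm y); rewrite mxE => ->.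
  rewrite lerDl; apply: sumr_ge0 => k _.
  by rewrite mulr_ge0 ?cap_ge0// indicE.
have E3 := le_integral_density Omega_open mu_density rho_smooth lambda_gt0 rho_ge mB' bO nu bu.1.
apply: le_trans E3; rewrite lee_fin.
have := le_trans lower upper; rewrite eps2 => h.
set J := integral_rV _ in h *.
have -> : lambda * J = lambda / K * (K * J) by rewrite mulrA divfK// gt_eqF.
rewrite -[leLHS]mulrA ler_wpM2l ?divr_ge0 ?(ltW lambda_gt0) ?(ltW K0)//.
by apply: le_trans h; rewrite mulrAC.
Qed.

End quantization.

(** * Sums of independent bounded variables *)

(** The sum is the integer part of t, written as a sum of indicators of superlevel conditions. *)
Lemma count_le_bounds (R : realDomainType) (t : R) (m : nat) : 0 <= t <= m%:R ->
  t - 1 <= \sum_(j < m) (nat_of_bool (j.+1%:R <= t))%:R <= t.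
Proof.
elim: m => [|m IH] /andP[t0 tm]; first by rewrite big_ord0 t0 andbT; lra.
rewrite big_ord_recr/=; have [mt|mt] := leP t m%:R.
  have := IH; rewrite t0 mt => /(_ erefl).
  have -> : m.+1%:R <= t = false by apply/negbTE; rewrite -ltNge -natr1; lra.
  by rewrite addr0.
rewrite (eq_bigr (fun=> 1)); last first.
  by move=> j _; rewrite (_ : _ <= _) //; apply: le_trans (ltW mt); rewrite ler_nat.
rewrite sumr_const card_ord; move: tm; rewrite -natr1 => tm.
have [h|h] := leP (m%:R + 1) t; rewrite /= ?mulr1n ?mulr0n; apply/andP; split; lra.
Qed.

Section bounded_random_variables.
Context d1 {T : measurableType d1} {R : realType} (P : probability T R).
Implicit Types F G : T -> R.

Definition bounded_rv F := measurable_fun setT F /\ exists M : R, forall w, `|F w| <= M.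

Definition Ex F : R := \int[P]_w F w.

Lemma bounded_rv_cst (c : R) : bounded_rv (fun=> c).
Proof. by split=> //; exists `|c|. Qed.

Lemma bounded_rvD F G : bounded_rv F -> bounded_rv G -> bounded_rv (fun w => F w + G w).
Proof.
move=> [mF [M FM]] [mG [N GN]]; split; first exact: measurable_funD.
by exists (M + N) => w; rewrite (le_trans (ler_normD _ _))// lerD.
Qed.

Lemma bounded_rvM F G : bounded_rv F -> bounded_rv G -> bounded_rv (fun w => F w * G w).
Proof.
move=> [mF [M FM]] [mG [N GN]]; split; first exact: measurable_funM.
by exists (M * N) => w; rewrite normrM ler_pM.
Qed.

Lemma bounded_rvZ (c : R) F : bounded_rv F -> bounded_rv (fun w => c * F w).
Proof. by apply: bounded_rvM; exact: bounded_rv_cst. Qed.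

Lemma bounded_rv_sum I (r : seq I) (F : I -> T -> R) : (forall i, bounded_rv (F i)) ->
  bounded_rv (fun w => \sum_(i <- r) F i w).
Proof.
move=> bF; elim: r => [|i r IH].
  by under eq_fun do rewrite big_nil; exact: bounded_rv_cst.
by under eq_fun do rewrite big_cons; exact: bounded_rvD.
Qed.

Lemma bounded_rv_norm F : bounded_rv F -> bounded_rv (fun w => `|F w|).
Proof.
move=> [mF [M FM]]; split; first exact: measurableT_comp.
by exists M => w; rewrite normr_id.
Qed.

Lemma bounded_rv_integrable F : bounded_rv F -> P.-integrable setT (EFin \o F).
Proof.
move=> [mF [M FM]]; apply: measurable_bounded_integrable => //.
  exact: le_lt_trans (probability_le1 P measurableT) (ltry _).
by exists M; split; [exact: num_real|move=> N MN w _; exact: le_trans (FM w) (ltW MN)].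
Qed.

Lemma ExD F G : bounded_rv F -> bounded_rv G -> Ex (fun w => F w + G w) = Ex F + Ex G.
Proof. by move=> bF bG; rewrite /Ex RintegralD//; exact: bounded_rv_integrable. Qed.

Lemma ExB F G : bounded_rv F -> bounded_rv G -> Ex (fun w => F w - G w) = Ex F - Ex G.
Proof. by move=> bF bG; rewrite /Ex RintegralB//; exact: bounded_rv_integrable. Qed.

Lemma ExZ (c : R) F : bounded_rv F -> Ex (fun w => c * F w) = c * Ex F.
Proof. by move=> bF; rewrite /Ex RintegralZl//; exact: bounded_rv_integrable. Qed.

Lemma Ex_cst (c : R) : Ex (fun=> c) = c.
Proof. by rewrite /Ex Rintegral_cst// [fine _](congr1 fine (probability_setT P)) mulr1. Qed.

Lemma Ex_sum I (r : seq I) (F : I -> T -> R) : (forall i, bounded_rv (F i)) ->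
  Ex (fun w => \sum_(i <- r) F i w) = \sum_(i <- r) Ex (F i).
Proof.
move=> bF; elim: r => [|i r IH].
  by under eq_fun do rewrite big_nil; rewrite big_nil Ex_cst.
under eq_fun do rewrite big_cons.
by rewrite big_cons ExD ?IH//; exact: bounded_rv_sum.
Qed.

Lemma ler_Ex F G : bounded_rv F -> bounded_rv G -> (forall w, F w <= G w) -> Ex F <= Ex G.
Proof. by move=> bF bG FG; apply: le_Rintegral => //; exact: bounded_rv_integrable. Qed.

Lemma Ex_norm_le F M : bounded_rv F -> (forall w, `|F w| <= M) -> `|Ex F| <= M.
Proof.
move=> bF FM; rewrite ler_norml; apply/andP; split.
  rewrite -(Ex_cst (- M)); apply: ler_Ex => //; first exact: bounded_rv_cst.
  by move=> w; have := FM w; rewrite ler_norml => /andP[].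
rewrite -[leRHS]Ex_cst; apply: ler_Ex => //; first exact: bounded_rv_cst.
by move=> w; have := FM w; rewrite ler_norml => /andP[].
Qed.

Lemma EFin_Ex F : bounded_rv F -> ((Ex F)%:E = \int[P]_w (F w)%:E)%E.
Proof.
by move=> bF; rewrite /Ex /Rintegral fineK//; apply: integrable_fin_num => //; exact: bounded_rv_integrable.
Qed.

(* The hypothesis says that the measures with densities G1 and G2 have the same image by Y. *)
Lemma Ex_eq_of_indic d2 (T2 : measurableType d2) (Y : T -> T2) G1 G2 (g : T2 -> R) (H : R) :
  measurable_fun setT Y -> bounded_rv G1 -> bounded_rv G2 ->
  measurable_fun setT g -> (forall y, 0 <= g y <= H) ->
  (forall D, measurable D -> Ex (fun w => G1 w * \1_D (Y w)) = Ex (fun w => G2 w * \1_D (Y w))) ->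
  Ex (fun w => G1 w * g (Y w)) = Ex (fun w => G2 w * g (Y w)).
Proof.
move=> mY b1 b2 mg gH e.
have [N HN] : exists N : nat, H <= N%:R.
  by exists (Num.truncn H).+1; apply: ltW; exact: truncnS_gt.
have b1D D : measurable D -> bounded_rv (fun w => \1_D (Y w) : R).
  move=> mD; split; first by apply: measurableT_comp => //; exact: measurable_indic.
  by exists 1 => w; rewrite indicE; case: (_ \in _); rewrite ?normr1 ?normr0.
have bg : bounded_rv (fun w => g (Y w)).
  split; first exact: measurableT_comp.
  by exists H => w; have /andP[g0 g1] := gH (Y w); rewrite ger0_norm.
have [M M0 [M1 M2]] : exists2 M : R, 0 <= M & (forall w, `|G1 w| <= M) /\ (forall w, `|G2 w| <= M).
  have [_ [A hA]] := b1; have [_ [B hB]] := b2.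
  exists (`|A| + `|B|); first by rewrite addr_ge0.
  by split=> w; [apply: (le_trans (hA w))|apply: (le_trans (hB w))];
    apply: (le_trans (ler_norm _)); rewrite ?lerDl ?lerDr.
(* The superlevel sets of (k + 1) g at the integers; [gk k] below is the integer part of (k + 1) g
   divided by k + 1, within 1 / (k + 1) of g. As g <= H <= N, the first (k + 1) N levels suffice. *)
pose D (k : nat) (j : nat) := [set y | j.+1%:R <= k.+1%:R * g y].
have mD k j : measurable (D k j).
  rewrite (_ : D k j = (fun y => k.+1%:R * g y) @^-1` `[j.+1%:R, +oo[); last first.
    by apply/seteqP; split => y; rewrite /D /= in_itv/= andbT.
  rewrite -[X in measurable X]setTI; apply: (measurable_funM (measurable_cst _) mg) => //.
pose gk k y := k.+1%:R^-1 * \sum_(j < k.+1 * N) \1_(D k j) y : R.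
have gkE k y : `|g y - gk k y| <= k.+1%:R^-1.
  have k0 : 0 < k.+1%:R :> R by rewrite ltr0n.
  have /andP[g0 g1] := gH y.
  have := @count_le_bounds R (k.+1%:R * g y) (k.+1 * N).
  rewrite mulr_ge0 ?(ltW k0)//= natrM ler_pM2l// (le_trans g1 HN) => /(_ erefl)/andP[].
  have -> : \sum_(j < k.+1 * N) (nat_of_bool (j.+1%:R <= k.+1%:R * g y))%:R = k.+1%:R * gk k y.
    rewrite /gk mulrA divff ?gt_eqF// mul1r; apply: eq_bigr => j _.
    rewrite indicE; congr (nat_of_bool _)%:R.
    by apply/idP/idP; [move=> ?; apply/mem_set|move=> /set_mem].
  move=> h1 h2; rewrite ler_norml; apply/andP; split; rewrite -(ler_pM2l k0).
    by rewrite mulrN divff ?gt_eqF// mulrBr; lra.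
  by rewrite divff ?gt_eqF// mulrBr; lra.
have bgk k : bounded_rv (fun w => gk k (Y w)).
  by apply: bounded_rvZ; apply: bounded_rv_sum => j; exact: b1D.
have Gk G k : bounded_rv G -> Ex (fun w => G w * gk k (Y w)) =
    k.+1%:R^-1 * \sum_(j < k.+1 * N) Ex (fun w => G w * \1_(D k j) (Y w)).
  move=> bG; rewrite -Ex_sum; last by move=> j; apply: bounded_rvM => //; exact: b1D.
  rewrite -ExZ; last by apply: bounded_rv_sum => j; apply: bounded_rvM => //; exact: b1D.
  by congr Ex; apply/funext => w; rewrite /gk mulrCA mulr_sumr.
have close G k : bounded_rv G -> (forall w, `|G w| <= M) ->
    `|Ex (fun w => G w * g (Y w)) - Ex (fun w => G w * gk k (Y w))| <= M * k.+1%:R^-1.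
  move=> bG GM; rewrite -ExB; [|exact: bounded_rvM|exact: bounded_rvM].
  apply: Ex_norm_le.
    have bgg : bounded_rv (fun w => G w * (g (Y w) + -1 * gk k (Y w))).
      by apply: bounded_rvM => //; apply: bounded_rvD => //; exact: bounded_rvZ.
    by rewrite (_ : (fun w => _) = fun w => G w * (g (Y w) + -1 * gk k (Y w)))//; apply/funext => w; ring.
  by move=> w; rewrite -mulrBr normrM ler_pM.
have eqk k : Ex (fun w => G1 w * gk k (Y w)) = Ex (fun w => G2 w * gk k (Y w)).
  by rewrite !Gk//; congr (_ * _); apply: eq_bigr => j _; exact: e.
apply/eqP; rewrite -subr_eq0 -normr_le0; apply/ler_addgt0Pl => a a0; rewrite addr0.
pose k := Num.truncn (2 * M / a).
have ka : 2 * M / a < k.+1%:R by exact: truncnS_gt.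
have k0 : 0 < k.+1%:R :> R by rewrite ltr0n.
have c1 := close G1 k b1 M1; have c2 := close G2 k b2 M2; rewrite -eqk in c2.
have ka2 : M * k.+1%:R^-1 <= a / 2.
  rewrite ler_pdivrMr// -(ler_pM2l (ltr0Sn R 1)) mulrA [_ * (a / 2)]mulrC divfK//.
  by rewrite ltr_pdivrMr// in ka; lra.
have := ler_distD (Ex (fun w => G1 w * gk k (Y w))) (Ex (fun w => G1 w * g (Y w))) (Ex (fun w => G2
  w * g (Y w))).
rewrite [X in _ <= _ + X -> _]distrC => tri.
by apply: (le_trans tri); rewrite [leRHS]splitr; apply: lerD; [apply: le_trans ka2|apply: le_trans ka2].
Qed.

(** g + H is nonnegative, and taking D = setT shows that the corrections H * Ex G1 and H * Ex G2
    agree. *)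
Lemma Ex_eq_of_indic_bounded d2 (T2 : measurableType d2) (Y : T -> T2) G1 G2 (g : T2 -> R) (H : R) :
  measurable_fun setT Y -> bounded_rv G1 -> bounded_rv G2 ->
  measurable_fun setT g -> (forall y, `|g y| <= H) ->
  (forall D, measurable D -> Ex (fun w => G1 w * \1_D (Y w)) = Ex (fun w => G2 w * \1_D (Y w))) ->
  Ex (fun w => G1 w * g (Y w)) = Ex (fun w => G2 w * g (Y w)).
Proof.
move=> mY b1 b2 mg gH e.
have e1 : Ex G1 = Ex G2.
  by have := e _ measurableT; congr (_ = _); congr Ex; apply/funext => w; rewrite indicT mulr1.
have bg : bounded_rv (fun w => g (Y w)).
  by split; [exact: measurableT_comp|exists H => w].
have shift G : bounded_rv G ->
    Ex (fun w => G w * g (Y w)) = Ex (fun w => G w * (g (Y w) + H)) - H * Ex G.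
  move=> bG; rewrite -ExZ// -ExB; last by exact: bounded_rvZ.
    by congr Ex; apply/funext => w; ring.
  by apply: bounded_rvM => //; apply: bounded_rvD => //; exact: bounded_rv_cst.
rewrite !shift// e1; congr (_ - _).
apply: (@Ex_eq_of_indic _ _ _ _ _ (fun y => g y + H) (H + H)) => //.
  by apply: measurable_funD.
by move=> y; have := gH y; rewrite ler_norml => /andP[? ?]; apply/andP; split; lra.
Qed.

End bounded_random_variables.

Section sums_of_independent_variables.
Context d1 {T : measurableType d1} d2 {T2 : measurableType d2} {R : realType} (P : probability T R).
Variables (X : nat -> T -> T2).
Hypothesis mX : forall k, measurable_fun setT (X k).
Hypothesis indep : forall n (A : nat -> set T2), (forall i, measurable (A i)) ->
  Ex P (fun w => \prod_(i < n) \1_(A i) (X i w)) = \prod_(i < n) Ex P (fun w => \1_(A i) (X i w)).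
Implicit Types F : T -> R.
Local Notation E := (Ex P).

(* Independence of F from the variables X i, k <= i, tested on indicators only. *)
Definition nonanticipating k F := bounded_rv F /\
  forall n (A : nat -> set T2), (forall i, measurable (A i)) ->
  E (fun w => F w * \prod_(i < n) \1_(A i) (X (k + i)%N w)) =
  E F * \prod_(i < n) E (fun w => \1_(A i) (X (k + i)%N w)).

Lemma bounded_rv_indic (D : set T2) k : measurable D -> bounded_rv (fun w => \1_D (X k w) : R).
Proof.
move=> mD; split; first by apply: measurableT_comp => //; exact: measurable_indic.
by exists 1 => w; rewrite indicE; case: (_ \in _); rewrite ?normr1 ?normr0.
Qed.

Lemma bounded_rv_prod_indic k n (A : nat -> set T2) : (forall i, measurable (A i)) ->
  bounded_rv (fun w => \prod_(i < n) \1_(A i) (X (k + i)%N w) : R).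
Proof.
move=> mA; elim: n => [|n IH].
  by under eq_fun do rewrite big_ord0; exact: bounded_rv_cst.
under eq_fun do rewrite big_ord_recr/=.
by apply: bounded_rvM => //; exact: bounded_rv_indic.
Qed.

Lemma nonanticipating1 : nonanticipating 0 (fun=> 1).
Proof.
split; first exact: bounded_rv_cst.
move=> n A mA; rewrite Ex_cst mul1r -indep//.
by congr E; apply/funext => w; rewrite mul1r.
Qed.

Lemma nonanticipatingD k F G : nonanticipating k F -> nonanticipating k G ->
  nonanticipating k (fun w => F w + G w).
Proof.
move=> [bF iF] [bG iG]; split; first exact: bounded_rvD.
move=> n A mA; have bp := bounded_rv_prod_indic k n mA.
rewrite ExD// mulrDl -iF// -iG// -ExD; [|exact: bounded_rvM|exact: bounded_rvM].
by congr E; apply/funext => w; rewrite mulrDl.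
Qed.

Lemma nonanticipatingZ k (c : R) F : nonanticipating k F -> nonanticipating k (fun w => c * F w).
Proof.
move=> [bF iF]; split; first exact: bounded_rvZ.
move=> n A mA; have bp := bounded_rv_prod_indic k n mA.
rewrite ExZ// -mulrA -iF// -ExZ; last exact: bounded_rvM.
by congr E; apply/funext => w; rewrite mulrA.
Qed.

Lemma nonanticipating_sum k I (r : seq I) (F : I -> T -> R) :
  (forall i, nonanticipating k (F i)) -> nonanticipating k (fun w => \sum_(i <- r) F i w).
Proof.
move=> iF; elim: r => [|i r IH].
  under eq_fun do rewrite big_nil.
  split; first exact: bounded_rv_cst.
  move=> n A mA; rewrite Ex_cst mul0r -[RHS](@Ex_cst _ _ _ P).
  by congr E; apply/funext => w; rewrite mul0r.
by under eq_fun do rewrite big_cons; exact: nonanticipatingD.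
Qed.

(** Passes from indicators of X k to bounded functions of X k, while the later variables are still
    tested on indicators; this keeps the class stable under induction on k. *)
Lemma nonanticipating_step k F (g : T2 -> R) (B : R) : nonanticipating k F ->
  measurable_fun setT g -> (forall y, `|g y| <= B) ->
  nonanticipating k.+1 (fun w => F w * g (X k w)) /\
  E (fun w => F w * g (X k w)) = E F * E (fun w => g (X k w)).
Proof.
move=> [bF iF] mg gB.
have bg : bounded_rv (fun w => g (X k w)) by split; [exact: measurableT_comp|exists B].
have main n (A : nat -> set T2) : (forall i, measurable (A i)) ->
    E (fun w => F w * g (X k w) * \prod_(i < n) \1_(A i) (X (k.+1 + i)%N w)) =
    E F * E (fun w => g (X k w)) * \prod_(i < n) E (fun w => \1_(A i) (X (k.+1 + i)%N w)).
  move=> mA; have bp := bounded_rv_prod_indic k.+1 n mA.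
  set p := fun w => \prod_(i < n) \1_(A i) (X (k.+1 + i)%N w) : R.
  set q := \prod_(i < n) _.
  rewrite (_ : (fun w => _) = fun w => F w * p w * g (X k w)); last first.
    by apply/funext => w; rewrite mulrAC.
  (* F * p is compared with the constant E F * q: both weights give the same integral against
     indicators of X k. *)
  rewrite (@Ex_eq_of_indic_bounded _ _ _ _ _ _ _ _ (fun=> E F * q) _ B)//.
  - by rewrite ExZ// mulrAC.
  - exact: bounded_rvM.
  - exact: bounded_rv_cst.
  (* Putting D in front of the family A makes the condition an instance of the hypothesis on F with
     n + 1 sets starting at X k. *)
  move=> D mD; pose A' i := if i is j.+1 then A j else D.
  have mA' i : measurable (A' i) by case: i.
  have kS (i : 'I_n) : (k + lift ord0 i = k.+1 + i)%N by rewrite lift0 addnS addSn.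
  have pE w : \prod_(i < n.+1) \1_(A' i) (X (k + i)%N w) = \1_D (X k w) * p w :> R.
    rewrite big_ord_recl addn0; congr (_ * _).
    by apply: eq_bigr => i _; rewrite kS lift0.
  have qE : \prod_(i < n.+1) E (fun w => \1_(A' i) (X (k + i)%N w)) = E (fun w => \1_D (X k w)) * q.
    rewrite big_ord_recl addn0; congr (_ * _).
    by apply: eq_bigr => i _; rewrite kS lift0.
  have := iF n.+1 _ mA'; rewrite qE => eq.
  rewrite ExZ; last exact: bounded_rv_indic.
  rewrite -mulrA [q * _]mulrC -eq.
  by congr E; apply/funext => w; rewrite pE; ring.
have eq : E (fun w => F w * g (X k w)) = E F * E (fun w => g (X k w)).
  have := main 0%N (fun=> set0) (fun=> measurable0); rewrite big_ord0 mulr1 => <-.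
  by congr E; apply/funext => w; rewrite big_ord0 mulr1.
split=> //; split; first exact: bounded_rvM.
by move=> n A mA; rewrite main// eq.
Qed.

Variables (g : T2 -> R) (B s : R).
Hypothesis mg : measurable_fun setT g.
Hypothesis gB : forall y, `|g y| <= B.
Hypothesis centered : forall k, E (fun w => g (X k w)) = 0.
Hypothesis variance : forall k, E (fun w => g (X k w) ^+ 2) = s.

Definition partial_sum k w : R := \sum_(i < k) g (X i w).

Lemma g_exp_bounded j : measurable_fun setT (fun y => g y ^+ j) /\
  forall y, `|g y ^+ j| <= B ^+ j.
Proof.
split; first exact: measurable_funX.
by move=> y; rewrite normrX lerXn2r// ?nnegrE// (le_trans _ (gB y)).
Qed.

Lemma partial_sumS k w : partial_sum k.+1 w = partial_sum k w + g (X k w).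
Proof. by rewrite /partial_sum big_ord_recr. Qed.

(** Binomial expansion of the last step; the induction on k carries all exponents at once since the
    expansion involves the lower powers. *)
Lemma nonanticipating_partial_sum k j : nonanticipating k (fun w => partial_sum k w ^+ j).
Proof.
elim: k j => [|k IH] j.
  rewrite (_ : (fun w => _) = fun w => (0 ^+ j) * 1); last first.
    by apply/funext => w; rewrite /partial_sum big_ord0 mulr1.
  by apply: nonanticipatingZ; exact: nonanticipating1.
under eq_fun do rewrite partial_sumS exprDn.
apply: nonanticipating_sum => i.
under eq_fun do rewrite -mulr_natl.
apply: nonanticipatingZ.
have [mgi gBi] := g_exp_bounded i.
by have [] := nonanticipating_step (IH (j - i)%N) mgi gBi.
Qed.

Lemma Ex_partial_sum_exp k j i :
  E (fun w => partial_sum k w ^+ j * g (X k w) ^+ i) =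
  E (fun w => partial_sum k w ^+ j) * E (fun w => g (X k w) ^+ i).
Proof.
have [mgi gBi] := g_exp_bounded i.
by have [] := nonanticipating_step (nonanticipating_partial_sum k j) mgi gBi.
Qed.

Lemma bounded_rv_g_exp k i : bounded_rv (fun w => g (X k w) ^+ i).
Proof.
have [mgi gBi] := g_exp_bounded i.
by split; [exact: (measurableT_comp mgi)|exists (B ^+ i)].
Qed.

Lemma bounded_rv_partial_sum k j : bounded_rv (fun w => partial_sum k w ^+ j).
Proof. by have [] := nonanticipating_partial_sum k j. Qed.

Lemma bounded_rv_term k j i : bounded_rv (fun w => partial_sum k w ^+ j * g (X k w) ^+ i).
Proof. by apply: bounded_rvM; [exact: bounded_rv_partial_sum|exact: bounded_rv_g_exp]. Qed.

Lemma Ex_partial_sum1 k : E (fun w => partial_sum k w ^+ 1) = 0.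
Proof.
elim: k => [|k IH].
  by rewrite -[RHS](@Ex_cst _ _ _ P); congr E; apply/funext => w; rewrite /partial_sum big_ord0 expr1.
rewrite (_ : (fun w => _) = fun w => partial_sum k w ^+ 1 + g (X k w) ^+ 1); last first.
  by apply/funext => w; rewrite partial_sumS !expr1.
rewrite ExD ?IH ?add0r; [|exact: bounded_rv_partial_sum|exact: bounded_rv_g_exp].
by rewrite -[RHS](centered k); congr E.
Qed.

Lemma Ex_partial_sum2 k : E (fun w => partial_sum k w ^+ 2) = k%:R * s.
Proof.
elim: k => [|k IH].
  rewrite mul0r -[RHS](@Ex_cst _ _ _ P); congr E; apply/funext => w.
  by rewrite /partial_sum big_ord0 expr0n.
rewrite (_ : (fun w => _) = fun w => partial_sum k w ^+ 2 +
    (2 * (partial_sum k w ^+ 1 * g (X k w) ^+ 1) + g (X k w) ^+ 2)); last first.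
  by apply/funext => w; rewrite partial_sumS; ring.
have b11 := bounded_rvZ 2 (bounded_rv_term k 1 1).
have b2 := bounded_rv_g_exp k 2.
rewrite ExD; [|exact: bounded_rv_partial_sum|exact: bounded_rvD].
rewrite ExD// ExZ; last exact: bounded_rv_term.
by rewrite Ex_partial_sum_exp Ex_partial_sum1 IH variance -natr1; ring.
Qed.

(** The terms with a factor E g or E S vanish, so the increment is 6 k s^2 + E g^4, at most (6 k +
    3) B^4 = 3 ((k + 1)^2 - k^2) B^4 since s <= B^2. *)
Lemma Ex_partial_sum4 k : E (fun w => partial_sum k w ^+ 4) <= 3 * k%:R ^+ 2 * B ^+ 4.
Proof.
elim: k => [|k IH].
  rewrite expr0n/= mulr0 mul0r -[leRHS](@Ex_cst _ _ _ P).
  rewrite (_ : (fun w => _) = fun=> 0)//; apply/funext => w.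
  by rewrite /partial_sum big_ord0 expr0n.
rewrite (_ : (fun w => _) = fun w => partial_sum k w ^+ 4 +
    (4 * (partial_sum k w ^+ 3 * g (X k w) ^+ 1) +
    (6 * (partial_sum k w ^+ 2 * g (X k w) ^+ 2) +
    (4 * (partial_sum k w ^+ 1 * g (X k w) ^+ 3) + g (X k w) ^+ 4)))); last first.
  by apply/funext => w; rewrite partial_sumS; ring.
have b31 := bounded_rvZ 4 (bounded_rv_term k 3 1).
have b22 := bounded_rvZ 6 (bounded_rv_term k 2 2).
have b13 := bounded_rvZ 4 (bounded_rv_term k 1 3).
have b4 := bounded_rv_g_exp k 4.
have b5 := bounded_rvD b13 b4.
have b6 := bounded_rvD b22 b5.
have b7 := bounded_rvD b31 b6.
rewrite ExD//; last exact: bounded_rv_partial_sum.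
rewrite ExD// ExD// ExD// !ExZ; try exact: bounded_rv_term.
rewrite !Ex_partial_sum_exp Ex_partial_sum1 Ex_partial_sum2 variance.
have -> : E (fun w => g (X k w) ^+ 1) = 0 by rewrite -[RHS](centered k); congr E.
have gle i : `|E (fun w => g (X k w) ^+ i)| <= B ^+ i.
  by apply: Ex_norm_le; [exact: bounded_rv_g_exp|move=> w; have [_] := g_exp_bounded i].
have := gle 4; have := gle 2; rewrite variance !ler_norml => /andP[_ sB] /andP[_ B4].
have s0 : 0 <= s.
  rewrite -(variance k) -[leLHS](@Ex_cst _ _ _ P); apply: ler_Ex.
  - exact: bounded_rv_cst.
  - exact: bounded_rv_g_exp.
  - by move=> w; exact: sqr_ge0.
have ss : s * s <= B ^+ 4 by rewrite (_ : B ^+ 4 = B ^+ 2 * B ^+ 2); [exact: ler_pM|ring].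
have k0 : 0 <= k%:R :> R by [].
have kss : k%:R * (s * s) <= k%:R * B ^+ 4 by rewrite ler_wpM2l.
rewrite -[k.+1%:R]natr1 !(mulr0, mul0r) !add0r.
have -> : 3 * (k%:R + 1) ^+ 2 * B ^+ 4 = 3 * k%:R ^+ 2 * B ^+ 4 + (6 * (k%:R * B ^+ 4) + 3 * B ^+ 4) by ring.
have -> : 6 * (k%:R * s * s) = 6 * (k%:R * (s * s)) by ring.
have B40 : 0 <= B ^+ 4 by rewrite exprn_even_ge0.
lra.
Qed.

Hypothesis s_gt0 : 0 < s.

(* E max(0, -S) = E|S|/2, and |S| >= S^2/a - S^4/a^3 for every a > 0. *)
Lemma negative_part_partial_sum : exists2 c : R, 0 < c & forall n, (0 < n)%N ->
  c * Num.sqrt n%:R <= E (fun w => Num.max 0 (- partial_sum n w)).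
Proof.
(* B = 0 would force g, and with it the variance s, to vanish. *)
have B40 : 0 < B ^+ 4.
  rewrite exprn_even_gt0//; apply/orP; right; apply/eqP => B0.
  have : `|E (fun w => g (X 0 w) ^+ 2)| <= B ^+ 2.
    by apply: Ex_norm_le; [exact: bounded_rv_g_exp|move=> w; have [_] := g_exp_bounded 2].
  by rewrite variance B0 expr0n/= normr_le0 gt_eqF.
(* With a = K sqrt n, this choice makes the fourth-moment term half of the second-moment term,
   leaving E|S| >= s sqrt n / (2 K). *)
pose K := Num.sqrt (6 * B ^+ 4 / s).
have K0 : 0 < K by rewrite sqrtr_gt0 divr_gt0// mulr_gt0.
have K2 : K ^+ 2 = 6 * B ^+ 4 / s by rewrite sqr_sqrtr// ltW// divr_gt0// mulr_gt0.
exists (s / (4 * K)); first by rewrite divr_gt0// mulr_gt0.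
move=> n n0.
have b j := bounded_rv_partial_sum n j.
have b1 : bounded_rv (partial_sum n).
  by have := b 1%N; congr bounded_rv; apply/funext => w; rewrite expr1.
have bN := bounded_rv_norm b1.
have -> : E (fun w => Num.max 0 (- partial_sum n w)) = E (fun w => `|partial_sum n w|) / 2.
  rewrite (_ : (fun w => _) = fun w => 2^-1 * (`|partial_sum n w| - partial_sum n w ^+ 1)).
    have bD : bounded_rv (fun w => `|partial_sum n w| + -1 * partial_sum n w ^+ 1).
      by apply: bounded_rvD => //; exact: bounded_rvZ.
    rewrite ExZ; last by move: bD; congr bounded_rv; apply/funext => w; ring.
    by rewrite ExB// Ex_partial_sum1 subr0 mulrC.
  apply/funext => w; rewrite expr1; have [s0|s0] := leP 0 (partial_sum n w).
    by rewrite ger0_norm// subrr mulr0; apply/max_idPl; lra.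
  rewrite ltr0_norm//; have -> : Num.max 0 (- partial_sum n w) = - partial_sum n w.
    by apply/max_idPr; lra.
  by field.
pose q : R := Num.sqrt n%:R.
have q0 : 0 < q by rewrite sqrtr_gt0 ltr0n.
have q2 : q ^+ 2 = n%:R by rewrite sqr_sqrtr.
pose a := K * q.
have a0 : 0 < a by rewrite mulr_gt0.
(* After scaling by a this is t^2 - t^4 <= t for t >= 0. *)
have pt w : a^-1 * partial_sum n w ^+ 2 - a ^- 3 * partial_sum n w ^+ 4 <= `|partial_sum n w|.
  set x := partial_sum n w; pose t := `|x| / a.
  have t0 : 0 <= t by rewrite divr_ge0// ltW.
  have xE : `|x| = a * t by rewrite /t mulrCA divff ?gt_eqF// mulr1.
  have -> : x ^+ 2 = `|x| ^+ 2 by rewrite real_normK// num_real.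
  have -> : x ^+ 4 = (`|x| ^+ 2) ^+ 2 by rewrite real_normK ?num_real// -exprM.
  rewrite xE (_ : _ - _ = a * (t ^+ 2 - t ^+ 4)); last first.
    by field; rewrite gt_eqF.
  rewrite ler_wpM2l ?(ltW a0)//.
  have : 0 <= t * (1 - t + t ^+ 3).
    rewrite mulr_ge0//; have [t1|t1] := leP t 1.
      have : 0 <= t ^+ 3 by rewrite exprn_ge0.
      lra.
    have : t ^+ 1 <= t ^+ 3 by rewrite ler_weXn2l// ltW.
    by rewrite expr1; lra.
  by rewrite (_ : t * _ = t - (t ^+ 2 - t ^+ 4)) ?subr_ge0//; ring.
have bl : bounded_rv (fun w => a^-1 * partial_sum n w ^+ 2 + (- a ^- 3) * partial_sum n w ^+ 4).
  by apply: bounded_rvD; exact: bounded_rvZ.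
have h : a^-1 * (n%:R * s) - a ^- 3 * (3 * n%:R ^+ 2 * B ^+ 4) <= E (fun w => `|partial_sum n w|).
  apply: (@le_trans _ _ (E (fun w => a^-1 * partial_sum n w ^+ 2 + (- a ^- 3) * partial_sum n w ^+
    4))); last first.
    by apply: ler_Ex => // w; rewrite mulNr; exact: pt.
  rewrite ExD; [|exact: bounded_rvZ|exact: bounded_rvZ].
  rewrite !ExZ// Ex_partial_sum2 lerD2l mulNr lerN2 ler_wpM2l ?Ex_partial_sum4//.
  by rewrite invr_ge0 exprn_ge0// ltW.
have -> : s / (4 * K) * Num.sqrt n%:R =
    (a^-1 * (n%:R * s) - a ^- 3 * (3 * n%:R ^+ 2 * B ^+ 4)) / 2.
  rewrite -/q -q2 /a.
  have -> : B ^+ 4 = K ^+ 2 * s / 6 by rewrite K2; field; rewrite gt_eqF.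
  by field; rewrite !gt_eqF.
by rewrite ler_pM2r// invr_gt0.
Qed.

End sums_of_independent_variables.

(** * The empirical potential *)

(** No measurability is assumed: phihat depends on the sample in an arbitrary way. The integral of a
    nonnegative function is a supremum over the simple functions below it, hence monotone. *)
Lemma ge0_le_integralr d1 (T : measurableType d1) (R : realType) (mu : {measure set T -> \bar R})
    (f g : T -> \bar R) :
  (forall x, (0 <= f x)%E) -> (forall x, (f x <= g x)%E) ->
  (\int[mu]_x f x <= \int[mu]_x g x)%E.
Proof.
move=> f0 fg; have g0 x : (0 <= g x)%E by exact: le_trans (fg x).
rewrite !ge0_integralTE//; apply: le_ereal_sup => _ [h hf <-].
by exists h => // x; exact: le_trans (hf x) (fg x).
Qed.

Section pushforward.
Context {R : realType} {d : nat}.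
Hypothesis d_gt0 : (0 < d)%N.
Implicit Types (f : 'rV[R]_d -> R) (mu nu : probability 'rV[R]_d R).

Lemma gradient_pushes_integral mu f (nu : {measure set 'rV[R]_d -> \bar R}) (g : 'rV[R]_d -> R) :
  convex_function setT f -> gradient_pushes mu f nu ->
  measurable_fun setT g -> (forall y, 0 <= g y) ->
  (\int[mu]_x (g (gradient f x))%:E = \int[nu]_y (g y)%:E)%E.
Proof.
move=> cf pf mg g0; have mgrad := measurable_gradient d_gt0 cf.
transitivity (\int[pushforward mu (gradient f)]_y (g y)%:E)%E; last first.
  by apply: eq_measure_integral => A mA _; exact: pf.
rewrite ge0_integral_pushforward ?preimage_setT//; first exact/measurable_EFinP.
by move=> y _; rewrite lee_fin.
Qed.

Lemma gradient_pushes_empirical mu f n (x : nat -> 'rV[R]_d) (g : 'rV[R]_d -> R) :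
  convex_function setT f -> gradient_pushes mu f (empirical (fun i : 'I_n => x i)) ->
  measurable_fun setT g -> (forall y, 0 <= g y) ->
  (\int[mu]_y (g (gradient f y))%:E = (n%:R^-1 * \sum_(i < n) g (x i))%:E)%E.
Proof.
move=> cf pf mg g0.
have n0 : 0 <= n%:R^-1 :> R by rewrite invr_ge0.
have mEg : measurable_fun setT (fun y => (g y)%:E) by exact/measurable_EFinP.
have g0' y : setT y -> (0 <= (g y)%:E)%E by rewrite lee_fin.
(* [empirical] is a bare set function; it is replaced by a scaled sum of Dirac measures, against
   which integrals can be computed. *)
rewrite (@gradient_pushes_integral _ _ (mscale (NngNum n0) (msum (fun i => \d_(x i)) n)))//.
rewrite ge0_integral_mscale//= EFinM; congr (_ * _)%E.
rewrite ge0_integral_measure_sum// -sumEFin; apply: eq_bigr => i _.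
by rewrite integral_dirac// diracT mul1e.
Qed.

End pushforward.

Section fluctuation.
Context {R : realType} {d : nat}.
Variables (d_gt0 : (0 < d)%N) (mu nu : probability 'rV[R]_d R) (phi h : 'rV[R]_d -> R) (C H : R).
Hypothesis phi_convex : convex_function setT phi.
Hypothesis phi_nu : gradient_pushes mu phi nu.
Hypothesis C_gt0 : 0 < C.
Hypothesis mh : measurable_fun setT h.
Hypothesis hH : forall y, 0 <= h y <= H.
Hypothesis variance_gt0 : forall c : R, (0 < \int[mu]_x ((h (gradient phi x) - c) ^+ 2)%:E)%E.
Hypothesis phi_stable : forall (f : 'rV[R]_d -> R) (a : R), convex_function setT f ->
  (\int[mu]_x (h (gradient phi x))%:E <=
   \int[mu]_x (h (gradient f x))%:E + C%:E * \int[mu]_x `|f x - phi x - a|%:E)%E.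
Context d1 (T : measurableType d1) (P : probability T R) (X : nat -> {RV P >-> 'rV[R]_d}).
Hypothesis X_iid : iid X nu.
Variable phihat : nat -> T -> 'rV[R]_d -> R.
Hypothesis phihatP : forall n w, (0 < n)%N -> convex_function setT (phihat n w) /\
  gradient_pushes mu (phihat n w) (empirical (fun i : 'I_n => X i w)).

(** Independence of events recast as a product formula for expectations of indicators, the form
    required for sums of independent variables. *)
Lemma iid_indep n (A : nat -> set 'rV[R]_d) : (forall i, measurable (A i)) ->
  Ex P (fun w => \prod_(i < n) \1_(A i) (X i w)) = \prod_(i < n) Ex P (fun w => \1_(A i) (X i w)).
Proof.
move=> mA; have [indep _] := X_iid.
have mXA i : measurable (X i @^-1` A i).
  by rewrite -[X in measurable X]setTI; exact: measurable_funPT.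
have mcap : measurable (\bigcap_(i in [set` index_iota 0 n]) X i @^-1` A i).
  by apply: fin_bigcap_measurable => //; exact: finite_seq.
have Ex_indic B : measurable B -> (Ex P (\1_B))%:E = P B.
  move=> mB; rewrite EFin_Ex; last first.
    split; first exact: measurable_indic.
    by exists 1 => w; rewrite indicE; case: (_ \in _); rewrite ?normr1 ?normr0.
  by rewrite integral_indic// setIT.
apply: EFin_inj.
transitivity (Ex P (\1_(\bigcap_(i in [set` index_iota 0 n]) X i @^-1` A i)))%:E.
  congr EFin; congr Ex; apply/funext => w; rewrite indicE.
  have [wA|wA] := boolP (w \in _).
    rewrite big1// => i _; rewrite indicE mem_set//.
    by move/set_mem: wA; apply; rewrite /= mem_index_iota ltn_ord.
  have /existsNP[i /not_implyP[+ iA]] : ~ (\bigcap_(i in [set` index_iota 0 n]) X i @^-1` A i) w.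
    by move=> /mem_set; exact/negP.
  rewrite /= mem_index_iota => /andP[_ lin].
  by rewrite (bigD1 (Ordinal lin))//= indicE memNset// mul0r.
rewrite Ex_indic// indep ?iota_uniq// big_mkord.
rewrite (_ : (\prod_(i < n) _)%E = \prod_(i < n) (Ex P (\1_(X i @^-1` A i)))%:E)%E; last first.
  by apply: eq_bigr => i _; rewrite Ex_indic.
by rewrite prodEFin.
Qed.

Lemma Ex_iid k (g : 'rV[R]_d -> R) (M : R) : measurable_fun setT g -> (forall y, 0 <= g y <= M) ->
  Ex P (fun w => g (X k w)) = Ex mu (fun x => g (gradient phi x)).
Proof.
move=> mg gM; have [_ Xnu] := X_iid.
have g0 y : 0 <= g y by have /andP[] := gM y.
have gn y : `|g y| <= M by rewrite ger0_norm//; have /andP[] := gM y.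
have mgrad := measurable_gradient d_gt0 phi_convex.
apply: EFin_inj; rewrite !EFin_Ex.
- rewrite (gradient_pushes_integral d_gt0 phi_convex phi_nu)//.
  rewrite -[LHS](@ge0_integral_distribution _ _ _ _ _ P (X k) (fun y => (g y)%:E))//.
  + by apply: eq_measure_integral => A mA _; exact: Xnu.
  + exact/measurable_EFinP.
- split; first exact: (measurableT_comp mg mgrad).
  by exists M.
- split; first exact: (measurableT_comp mg).
  by exists M.
Qed.

Let c := Ex mu (fun x => h (gradient phi x)).
Let g y := h y - c.

(** Stability for phihat bounds c minus the empirical mean of h, that is - S / n, by C times the
    distance, for every a. The distance being nonnegative, the maximum with 0 is free; an infinite
    distance is trivial. *)
Lemma L1_dist_ge_fluctuation n w : (0 < n)%N ->
  ((n%:R^-1 * C^-1 * Num.max 0 (- partial_sum X g n w))%:E <= L1_dist_mod_cst mu (phihat n w) phi)%E.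
Proof.
move=> n0; have [cf pf] := phihatP w n0.
have n0R : 0 < n%:R :> R by rewrite ltr0n.
apply: le_ereal_inf_tmp => _ [a _ <-]; rewrite Lnorm1 /=.
set I := (\int[mu]_x _)%E; have I0 : (0 <= I)%E by apply: integral_ge0 => x _.
have h0 y : 0 <= h y by have /andP[] := hH y.
have := phi_stable a cf.
rewrite (gradient_pushes_empirical (x := fun i => X i w) d_gt0 cf pf)//.
rewrite -EFin_Ex -/c; last first.
  split; first by apply: measurableT_comp => //; exact: measurable_gradient.
  by exists H => x; rewrite ger0_norm//; have /andP[] := hH (gradient phi x).
rewrite -/I; case: I I0 => [r| |]//; last by move=> _ _; rewrite leey.
rewrite -EFinM -EFinD !lee_fin => r0 cle.
rewrite -invfM ler_pdivrMl ?mulr_gt0// ge_max; apply/andP; split.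
  by rewrite mulr_ge0// ltW// mulr_gt0.
have -> : - partial_sum X g n w = n%:R * c - \sum_(i < n) h (X i w).
  by rewrite /partial_sum sumrB sumr_const card_ord mulr_natl opprB.
rewrite -(ler_pM2l n0R) mulrDr mulVKf ?gt_eqF// in cle.
by rewrite -mulrA; lra.
Qed.

Lemma fluctuation_lower_bound : (0 < limn_einf (fun n => (Num.sqrt n%:R)%:E *
  \int[P]_w L1_dist_mod_cst mu (phihat n w) phi))%E.
Proof.
have mX k : measurable_fun setT (X k) by exact: measurable_funPT.
have mg : measurable_fun setT g by exact: measurable_funB.
have H0 : 0 <= H by have /andP[] := hH 0; exact: le_trans.
have gB y : `|g y| <= H + `|c|.
  rewrite (le_trans (ler_normB _ _))// lerD2r.
  by have /andP[h0 h1] := hH y; rewrite ger0_norm.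
have centered k : Ex P (fun w => g (X k w)) = 0.
  have bh : bounded_rv (fun w => h (X k w)).
    split; first exact: measurableT_comp.
    by exists H => w; have /andP[h0 h1] := hH (X k w); rewrite ger0_norm.
  rewrite /g ExB//; last exact: bounded_rv_cst.
  by rewrite Ex_cst (Ex_iid k mh hH) subrr.
have g2 y : 0 <= g y ^+ 2 <= (H + `|c|) ^+ 2.
  rewrite sqr_ge0 -[g y ^+ 2]real_normK ?num_real// lerXn2r// nnegrE.
  by rewrite addr_ge0.
have mg2 : measurable_fun setT (fun y => g y ^+ 2) by exact: measurable_funX.
have variance k := Ex_iid k mg2 g2.
have s_gt0 : 0 < Ex mu (fun x => g (gradient phi x) ^+ 2).
  rewrite -lte_fin EFin_Ex; first exact: variance_gt0.
  split; first by apply: (measurableT_comp mg2); exact: measurable_gradient.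
  by exists ((H + `|c|) ^+ 2) => x; have /andP[a b] := g2 (gradient phi x); rewrite ger0_norm.
have [e e0 eS] := negative_part_partial_sum mX iid_indep mg gB centered variance s_gt0.
have key n : (0 < n)%N -> ((e / C)%:E <= (Num.sqrt n%:R)%:E *
    \int[P]_w L1_dist_mod_cst mu (phihat n w) phi)%E.
  move=> n0; have q0 : 0 < Num.sqrt n%:R :> R by rewrite sqrtr_gt0 ltr0n.
  have n0R : 0 < n%:R :> R by rewrite ltr0n.
  have bS : bounded_rv (fun w => Num.max 0 (- partial_sum X g n w)).
    have [mS [M SM]] : bounded_rv (partial_sum X g n).
      have := bounded_rv_partial_sum mX iid_indep mg gB n 1.
      by congr bounded_rv; apply/funext => w; rewrite expr1.
    split; first by apply: measurable_maxr => //; exact: measurable_funN.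
    exists M => w; have := SM w; rewrite ler_norml => /andP[S1 S2].
    have [S0|S0] := leP 0 (- partial_sum X g n w).
      by rewrite ger0_norm//; lra.
    by rewrite normr0 (le_trans _ (SM w)).
  apply: (@le_trans _ _ ((Num.sqrt n%:R)%:E *
      \int[P]_w (n%:R^-1 * C^-1 * Num.max 0 (- partial_sum X g n w))%:E)%E); last first.
    rewrite lee_pmul2l//; apply: ge0_le_integralr => w; last exact: L1_dist_ge_fluctuation.
    by rewrite lee_fin !mulr_ge0 ?invr_ge0 ?(ltW C_gt0)// le_max lexx.
  rewrite -EFin_Ex; last exact: bounded_rvZ.
  rewrite ExZ// -EFinM lee_fin.
  apply: (@le_trans _ _ (Num.sqrt n%:R * (n%:R^-1 * C^-1 * (e * Num.sqrt n%:R)))).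
    rewrite le_eqVlt; apply/orP; left; apply/eqP.
    have : Num.sqrt n%:R ^+ 2 = n%:R :> R by rewrite sqr_sqrtr// ltW.
    move: (Num.sqrt n%:R) q0 => q q0 <-.
    by field; rewrite !gt_eqF.
  rewrite ler_pM2l// ler_wpM2l ?eS// mulr_ge0 ?invr_ge0//; exact: ltW.
apply: (@lt_le_trans _ _ (e / C)%:E); first by rewrite lte_fin divr_gt0.
(* The lower limit is the limit of the infima over tails; those starting at n >= 1 are bounded below
   by [key], which excludes n = 0. *)
rewrite limn_einf_lim; apply: lime_ge; first exact: is_cvg_einfs.
near=> n; apply: le_ereal_inf_tmp => _ [k /= nk <-]; apply: key.
by apply: leq_trans nk; near: n; exists 1%N.
Unshelve. all: by end_near. Qed.

End fluctuation.

Theorem mainTheorem6 (R : realType) (d : nat) (d_gt0 : (0 < d)%N)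
    (alpha : R) (alpha_gt0 : 0 < alpha) (alpha_lt1 : alpha < 1)
    (Omega : set 'rV[R]_d)
    (Omega_open : open Omega) (Omega_bounded : bounded_set Omega)
    (Omega_connected : connected Omega)
    (Omega_boundary : holder_boundary 2 alpha Omega)
    (phi : 'rV[R]_d -> R) (kappa : R) (kappa_gt0 : 0 < kappa)
    (phi_convex : strongly_convex kappa phi)
    (phi_smooth : exists V : set 'rV[R]_d,
      [/\ open V, closure Omega `<=` V & holder_class 3 alpha V phi])
    (mu : probability 'rV[R]_d R) (rho : 'rV[R]_d -> R)
    (mu_density : has_density_on mu Omega rho)
    (rho_smooth : holder_class 1 alpha Omega rho)
    (lambda : R) (lambda_gt0 : 0 < lambda)
    (rho_ge : forall x, Omega x -> lambda <= rho x) :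
  ((d <= 3)%N ->
    forall (nu : probability 'rV[R]_d R), gradient_pushes mu phi nu ->
    forall (disp : measure_display) (T : measurableType disp)
      (P : probability T R) (X : nat -> {RV P >-> 'rV[R]_d}), iid X nu ->
    forall phihat : nat -> T -> 'rV[R]_d -> R,
      (forall n w, (0 < n)%N ->
        convex_function setT (phihat n w) /\
        gradient_pushes mu (phihat n w) (empirical (fun i : 'I_n => X i w))) ->
      (0 < limn_einf (fun n => (Num.sqrt n%:R)%:E *
        \int[P]_w L1_dist_mod_cst mu (phihat n w) phi))%E)
  /\
  ((4 <= d)%N -> convex_set Omega -> (forall x, phi x = sqnorm x / 2) ->
    exists2 c : R, 0 < c &
      forall (n : nat) (x : 'I_n -> 'rV[R]_d) (phihat : 'rV[R]_d -> R),
        (0 < n)%N ->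
        convex_function setT phihat ->
        gradient_pushes mu phihat (empirical x) ->
        ((c * n%:R `^ (- (2 / d%:R)))%:E <= L1_dist_mod_cst mu phihat phi)%E).
Proof.
have [V [V_open OmegaV phiV]] := phi_smooth.
split=> [_ nu phi_nu disp T P X X_iid phihat phihatP|_ _ phiE].
  have [h [C [H [C_gt0 mh hH var_gt0 stab]]]] := stability d_gt0 Omega_open V_open OmegaV kappa_gt0
    phi_convex phiV mu_density rho_smooth lambda_gt0 rho_ge.
  apply: (fluctuation_lower_bound d_gt0 (strongly_convex_convex kappa_gt0 phi_convex) phi_nu
    C_gt0 mh hH var_gt0 _ X_iid phihatP).
  by move=> f a; exact: stab.
have [c c_gt0 cP] := quantization d_gt0 Omega_open V_open OmegaV kappa_gt0
  phi_convex phiV mu_density rho_smooth lambda_gt0 rho_ge phiE.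
exists c => // n x f n0 cf pf; apply: le_ereal_inf_tmp => _ [a _ <-].
by rewrite Lnorm1; exact: (cP n x f a n0 cf pf).
Qed.
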